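(* Consider the linear regression setting and the hierarchical Bayesian model with hyper-pMOM priors described in the context. Assume: (1) There exist $\epsilon_n<1$ such that $0<\epsilon_n\le\lambda_k^m\le\lambda_k^M\le\epsilon_n^{-1}$ for every nonempty model $\mathbf k$, where $\epsilon_n^{-1}=O((\log n)^{1/8})$. (2) $\pi(\mathbf k)=0$ for all models with $|\mathbf k|>q_n$, where $q_n=O(n^{\xi})$ and $\xi<1$. (3) There exists a constant $\omega>0$ such that $\pi(\mathbf t)/\pi(\mathbf k)>\omega$ for every $\mathbf k$ with $\pi(\mathbf k)>0$. (4) There are constants $a_1,a_2$ not depending on $n$ such that, for every $n\ge1$, all eigenvalues of $A_p$ lie strictly between $a_1$ and $a_2$, where $0<a_1<a_2<\infty$. Then $$\max_{\mathbf k\neq\mathbf t}\frac{\pi(\mathbf k\mid\mathbf y_n)}{\pi(\mathbf t\mid\mathbf y_n)}\to0\quad\text{in probability as }n\to\infty .$$ In particular, $$P\big(\mathbf t=\arg\max_{\mathbf k}\pi(\mathbf k\mid\mathbf y_n)\big)\to1\quad\text{as }n\to\infty .$$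
   Context: **Data.** The number of coefficients $p=p_n$ increases with the sample size $n$. $X_n$ is an $n\times p$ design matrix. The data are truly generated by $\mathbf y_n=X_n\boldsymbol\beta_0+\boldsymbol\epsilon_n$, where the entries of $\boldsymbol\epsilon_n$ are i.i.d. $N(0,\sigma_0^2)$ and $\boldsymbol\beta_0\in\mathbb R^{p_n}$. The nonzero entries of $\boldsymbol\beta_0$ are exactly those with index in $\mathbf t\subseteq\{1,\dots,p_n\}$. The set $\mathbf t$, the vector $\boldsymbol\beta_{0,t}$ of nonzero entries, and $\sigma_0^2>0$ do not vary with $n$. Probabilities and convergence in probability are with respect to this true law of $\mathbf y_n$. **Models.** A model is a subset $\mathbf k=\{k_1,\dots,k_m\}\subseteq\{1,\dots,p\}$, the set of indices of nonzero coefficients (there are $2^{p}$ models). Its cardinality is also denoted $k=|\mathbf k|$, and $t=|\mathbf t|$. $X_k$ is the submatrix of $X_n$ formed by the columns in $\mathbf k$; $\boldsymbol\beta_k=(\beta_{k_1},\dots,\beta_{k_k})^T$; $A_k$ is the $k\times k$ principal submatrix of the symmetric $p\times p$ matrix $A_p$ indexed by $\mathbf k$. **Hierarchical model (hyper-pMOM).** Fix a positive integer $r$ and constants $\alpha_1,\alpha_2>0$. Set - $\mathbf y_n\mid\boldsymbol\beta_k,\sigma^2,\mathbf k\sim N(X_k\boldsymbol\beta_k,\sigma^2I_n)$; - $\pi(\boldsymbol\beta_k\mid\tau,\sigma^2,\mathbf k)=d_k(2\pi)^{-k/2}(\tau\sigma^2)^{-rk-k/2}|A_k|^{1/2}\exp\{-\boldsymbol\beta_k^TA_k\boldsymbol\beta_k/(2\tau\sigma^2)\}\prod_{i=1}^k\beta_{k_i}^{2r}$,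 where $d_k$ is the normalizing constant (independent of $\tau,\sigma^2$); - $\pi(\tau)=\frac{(n/2)^{1/2}}{\Gamma(1/2)}\tau^{-3/2}e^{-n/(2\tau)}$, $\tau>0$; - $\pi(\sigma^2)=\frac{\alpha_2^{\alpha_1}}{\Gamma(\alpha_1)}(\sigma^2)^{-(\alpha_1+1)}e^{-\alpha_2/\sigma^2}$, $\sigma^2>0$; - $\pi(\mathbf k)$ a prior probability distribution on the set of models. The marginal density is $m_{\mathbf k}(\mathbf y_n)=\int_0^\infty\int_0^\infty\int_{\mathbb R^k}\pi(\mathbf y_n\mid\boldsymbol\beta_k,\sigma^2,\mathbf k)\,\pi(\boldsymbol\beta_k\mid\tau,\sigma^2,\mathbf k)\,\pi(\tau)\,\pi(\sigma^2)\,d\boldsymbol\beta_k\,d\sigma^2\,d\tau$, and the posterior probability of model $\mathbf k$ is $\pi(\mathbf k\mid\mathbf y_n)=\pi(\mathbf k)m_{\mathbf k}(\mathbf y_n)/\sum_{\mathbf j}\pi(\mathbf j)m_{\mathbf j}(\mathbf y_n)$. **Eigenvalues.** $\nu_j(A)$ is the $j$-th largest nonzero eigenvalue of a symmetric matrix $A$; $\lambda_k^m=\min_{1\le j\le\min(n,k)}\nu_j(X_k^TX_k/n)$ and $\lambda_k^M=\max_{1\le j\le\min(n,k)}\nu_j(X_k^TX_k/n)$. *)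

(* Defs.v *)
From HB Require Import structures.
From mathcomp Require Import all_boot all_order all_algebra finmap.
From mathcomp Require Import all_classical all_reals all_analysis.
From mathcomp Require polyrcf.

Set Implicit Arguments.
Unset Strict Implicit.
Unset Printing Implicit Defensive.

Import Order.TTheory GRing.Theory Num.Theory.
Import numFieldNormedType.Exports.

Local Open Scope classical_set_scope.
Local Open Scope ring_scope.

Definition cons_pair (T : Type) (k : nat) (z : T * k.-tuple T) : k.+1.-tuple T :=
  [tuple of z.1 :: z.2].

(* Lebesgue measure on R^k, as the k-fold product of the Lebesgue measure on R
   transported to k-tuples (a point mass when k = 0). *)
Fixpoint lebesgue_tuple (R : realType) (k : nat) :
    set (k.-tuple R) -> \bar R :=
  match k return set (k.-tuple R) -> \bar R with
  | 0 => dirac [tuple]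
  | k'.+1 =>
      pushforward (@lebesgue_measure R \x @lebesgue_tuple R k')%E
        (@cons_pair R k')
  end.

Section LebesgueTupleMeasure.
Context (R : realType).

Let measurable_cons_pair k :
  measurable_fun [set: R * k.-tuple R] (@cons_pair R k).
Proof.
by apply: measurable_cons; [exact: measurable_fst|exact: measurable_snd].
Qed.

Let uncons_pair k (x : k.+1.-tuple R) : R * k.-tuple R :=
  (tnth x ord0, [tuple of behead x]).

Let measurable_uncons_pair k :
  measurable_fun [set: k.+1.-tuple R] (@uncons_pair k).
Proof.
by apply/measurable_fun_pair; [exact: measurable_tnth|exact: measurable_behead].
Qed.

Let cons_pairK k : cancel (@cons_pair R k) (@uncons_pair k).
Proof. by move=> [x b]; congr pair; apply/val_inj. Qed.

Section Step.
Context (k : nat) (mu : {sigma_finite_measure set (k.-tuple R) -> \bar R}).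

Let step : set (k.+1.-tuple R) -> \bar R :=
  pushforward (@lebesgue_measure R \x mu)%E (@cons_pair R k).

Let step0 : step set0 = 0%E.
Proof. by rewrite /step /pushforward preimage_set0 measure0. Qed.

Let step_ge0 B : (0 <= step B)%E.
Proof. by rewrite /step /pushforward measure_ge0. Qed.

Let step_sigma_additive : semi_sigma_additive step.
Proof.
move=> F mF tF mUF; rewrite /step /pushforward preimage_bigcup.
apply: measure_semi_sigma_additive.
- by move=> n; rewrite -[X in measurable X]setTI; exact: measurable_cons_pair.
- apply/trivIsetP => /= i j _ _ ij; rewrite -preimage_setI.
  by move/trivIsetP : tF => /(_ _ _ _ _ ij) ->//; rewrite preimage_set0.
- rewrite -preimage_bigcup -[X in measurable X]setTI.
  exact: measurable_cons_pair.
Qed.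

HB.instance Definition _ :=
  isMeasure.Build _ _ _ step step0 step_ge0 step_sigma_additive.

Let step_sigma_finite : sigma_finite setT step.
Proof.
have /sigma_finiteP[F [TF ndF Foo]] := sigma_finiteT (@lebesgue_measure R).
have /sigma_finiteP[G [TG ndG Goo]] := sigma_finiteT mu.
exists (fun n => @uncons_pair k @^-1` (F n `*` G n)).
  rewrite -preimage_bigcup (_ : \bigcup_n _ = setT) ?preimage_setT//.
  rewrite -subTset => -[x b] _.
  have [n _ Fnx] : (\bigcup_n F n) x by rewrite -TF.
  have [m _ Gmb] : (\bigcup_n G n) b by rewrite -TG.
  exists (maxn n m) => //; split => /=.
    by move: x Fnx; exact/subsetPset/ndF/leq_maxl.
  by move: b Gmb; exact/subsetPset/ndG/leq_maxr.
move=> n; have [mFn Fn_oo] := Foo n; have [mGn Gn_oo] := Goo n; split.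
  rewrite -[X in measurable X]setTI; apply: measurable_uncons_pair => //.
  exact: measurableX.
rewrite /step /pushforward (_ : _ @^-1` _ = F n `*` G n); last first.
  by apply/seteqP; split=> z; rewrite /preimage /mkset cons_pairK.
by rewrite product_measure1E// lte_mul_pinfty// ge0_fin_numE.
Qed.

HB.instance Definition _ :=
  @Measure_isSigmaFinite.Build _ _ _ step step_sigma_finite.

Lemma lebesgue_tuple_step :
  exists nu : {sigma_finite_measure set (k.+1.-tuple R) -> \bar R},
    nu = pushforward (@lebesgue_measure R \x mu)%E (@cons_pair R k)
      :> (set (k.+1.-tuple R) -> \bar R).
Proof. by exists step. Qed.

End Step.

Lemma lebesgue_tuple_bundle k :
  exists mu : {sigma_finite_measure set (k.-tuple R) -> \bar R},
    mu = @lebesgue_tuple R k :> (set (k.-tuple R) -> \bar R).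
Proof.
elim: k => [|k [mu muE]]; first by exists (dirac [tuple]).
by have [nu nuE] := lebesgue_tuple_step mu; exists nu; rewrite nuE muE.
Qed.

Let lebesgue_tuple0 k : @lebesgue_tuple R k set0 = 0%E.
Proof. by have [mu <-] := lebesgue_tuple_bundle k; exact: measure0. Qed.

Let lebesgue_tuple_ge0 k B : (0 <= @lebesgue_tuple R k B)%E.
Proof. by have [mu <-] := lebesgue_tuple_bundle k; exact: measure_ge0. Qed.

Let lebesgue_tuple_sigma_additive k :
  semi_sigma_additive (@lebesgue_tuple R k).
Proof.
have [mu <-] := lebesgue_tuple_bundle k.
exact: measure_semi_sigma_additive.
Qed.

HB.instance Definition _ k := isMeasure.Build _ _ _ (@lebesgue_tuple R k)
  (@lebesgue_tuple0 k) (@lebesgue_tuple_ge0 k)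
  (@lebesgue_tuple_sigma_additive k).

Let lebesgue_tuple_sigma_finite k : sigma_finite setT (@lebesgue_tuple R k).
Proof. by have [mu <-] := lebesgue_tuple_bundle k; exact: sigma_finiteT. Qed.

HB.instance Definition _ k := @Measure_isSigmaFinite.Build _ _ _
  (@lebesgue_tuple R k) (@lebesgue_tuple_sigma_finite k).

End LebesgueTupleMeasure.

Definition Gamma (R : realType) (a : R) : R :=
  \int[@lebesgue_measure R]_(x in `]0, +oo[) (x `^ (a - 1) * expR (- x)).

Definition inv_gamma_pdf (R : realType) (a b x : R) : R :=
  b `^ a / Gamma a * x `^ (- (a + 1)) * expR (- (b / x)).

Section Eigenvalues.
Context (R : realType).

(* Real eigenvalues in increasing order, repeated according to their
   multiplicity in the characteristic polynomial. *)
Definition eigenvalues_seq (m : nat) (M : 'M[R]_m) : seq R :=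
  flatten [seq nseq (mup x (char_poly M)) x
          | x <- polyrcf.rootsR (char_poly M)].

(* The j-th largest nonzero eigenvalue, j >= 1, and 0 when there are fewer than
   j nonzero eigenvalues: a positive lower bound on nu j M also asserts that M
   has at least j nonzero eigenvalues. *)
Definition nu (j : nat) (m : nat) (M : 'M[R]_m) : R :=
  nth 0 (rev [seq x <- eigenvalues_seq M | x != 0]) j.-1.

End Eigenvalues.

Section Models.
Context (R : realType) (n p : nat).
Implicit Types (X : 'M[R]_(n, p)) (A : 'M[R]_p) (k : {set 'I_p}).

Definition design_sub X k : 'M[R]_(n, #|k|) :=
  colsub (@enum_val _ (mem k)) X.

Definition principal_sub A k : 'M[R]_#|k| :=
  mxsub (@enum_val _ (mem k)) (@enum_val _ (mem k)) A.

Definition scaled_gram X k : 'M[R]_#|k| :=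
  n%:R^-1 *: ((design_sub X k)^T *m design_sub X k).

Definition lambda_min X k : R :=
  \big[Num.min/nu 1 (scaled_gram X k)]_(1 <= j < (minn n #|k|).+1)
     nu j (scaled_gram X k).

Definition lambda_max X k : R :=
  \big[Num.max/nu 1 (scaled_gram X k)]_(1 <= j < (minn n #|k|).+1)
     nu j (scaled_gram X k).

Definition col_of_tuple m (b : m.-tuple R) : 'cV[R]_m := \col_i tnth b i.

(* The density of N(X_k b, s2 I_n) at y; normal_pdf takes the standard
   deviation. *)
Definition likelihood X k (y : 'cV[R]_n) (b : #|k|.-tuple R) (s2 : R) : R :=
  \prod_(i < n)
    normal_pdf ((design_sub X k *m col_of_tuple b) i 0) (Num.sqrt s2) (y i 0).

(* The pMOM density without its normalizing constant; v stands for
   tau * sigma^2. *)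
Definition pmom_kernel (r : nat) A k (v : R) (b : #|k|.-tuple R) : R :=
  (2 * pi) `^ (- (#|k|%:R / 2))
  * v `^ (- (r * #|k|)%:R - #|k|%:R / 2)
  * Num.sqrt (\det (principal_sub A k))
  * expR (- (((col_of_tuple b)^T *m principal_sub A k *m col_of_tuple b) 0 0
             / (2 * v)))
  * \prod_(i < #|k|) tnth b i ^+ (2 * r).

(* The substitution b = sqrt v * u shows that the integral of the kernel does
   not depend on v > 0, so the normalizing constant is computed at v = 1. *)
Definition pmom_const (r : nat) A k : R :=
  (\int[@lebesgue_tuple R #|k|]_b pmom_kernel r A 1 b)^-1.

Definition pmom_pdf (r : nat) A k (tau s2 : R) (b : #|k|.-tuple R) : R :=
  pmom_const r A k * pmom_kernel r A (tau * s2) b.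

Definition marginal (r : nat) (alpha1 alpha2 : R) X A (y : 'cV[R]_n) k : R :=
  fine (\int[@lebesgue_measure R]_(tau in `]0%R, +oo[)
        \int[@lebesgue_measure R]_(s2 in `]0%R, +oo[)
        \int[@lebesgue_tuple R #|k|]_b
          (likelihood X y b s2 * pmom_pdf r A tau s2 b
           * inv_gamma_pdf (1 / 2) (n%:R / 2) tau
           * inv_gamma_pdf alpha1 alpha2 s2)%:E)%E.

Definition posterior (r : nat) (alpha1 alpha2 : R) X A
    (prior : {set 'I_p} -> R) (y : 'cV[R]_n) k : R :=
  prior k * marginal r alpha1 alpha2 X A y k
  / \sum_(j : {set 'I_p}) prior j * marginal r alpha1 alpha2 X A y j.

Definition is_model_prior (prior : {set 'I_p} -> R) : Prop :=
  (forall k, 0 <= prior k) /\ \sum_(k : {set 'I_p}) prior k = 1.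

(* Coordinates are numbered from 0. *)
Definition model_of_support (t : {fset nat}) : {set 'I_p} :=
  [set i : 'I_p | val i \in t]%SET.

Definition coef_vector (beta0 : nat -> R) : 'cV[R]_p := \col_(i < p) beta0 i.

End Models.

Section Randomness.
Context (R : realType).

Definition mutually_independent (d : measure_display) (T : measurableType d)
    (P : probability T R) (I : finType) (Z : I -> {RV P >-> R}) : Prop :=
  forall (J : {set I}) (B : I -> set R), (forall i, measurable (B i)) ->
    P [set w | forall i, i \in J -> B i (Z i w)]
    = (\prod_(i in J) P (Z i @^-1` B i))%E.

Definition iid_normal (d : measure_display) (T : measurableType d)
    (P : probability T R) (I : finType) (Z : I -> {RV P >-> R}) (sd : R) :
    Prop :=
  mutually_independent Z /\
  forall i (B : set R), measurable B ->
    distribution P (Z i) B = normal_prob 0 sd B.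

Definition response (n p : nat) (X : 'M[R]_(n, p)) (beta0 : nat -> R)
    (T : Type) (noise : 'I_n -> T -> R) (w : T) : 'cV[R]_n :=
  X *m coef_vector p beta0 + \col_i noise i w.

(* The n-th variable lives on the n-th probability space. *)
Definition cvg_in_probability (d : nat -> measure_display)
    (T : forall n, measurableType (d n)) (P : forall n, probability (T n) R)
    (Z : forall n, T n -> R) (l : R) : Prop :=
  forall e : R, 0 < e ->
    P n [set w | e < `|Z n w - l|] @[n --> \oo] --> 0%E.

End Randomness.

(* Main.v *)
(** Write m = |k \ t|. Integrating out the coefficients, the variance and tau
    bounds the marginal density of k above by the peak of its likelihood times
    C^|k| n^-((2r+1) m + (r+1) |k :&: t|) m^((r+1/2) m), up to powers of
    1 / eps and a factor n^(1/10). Restricting the integral to a box of side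
    n^-(1/2) at the true coefficients bounds the marginal density of t below by
    its own peak times n^-((r+1) |t| + 1), up to a constant and the factor
    exp (- |t| / (eps sigma0^2)). On the event where, for every k, the energy of
    the noise in the span of the columns k :|: t is at most
    sigma0^2 (5/2 m ln n + ln n / 10), the m superfluous coordinates multiply the
    likelihood by about n^(5/4 m) at most, which is beaten by the net nonlocal
    penalty n^-((r+1/2) m). A model that misses a coordinate of t has a residual
    larger by about n eps min |beta0|^2 and loses a factor exp (- c n eps). The
    exceptional event has small probability by exponential Markov and a union
    bound in which k costs z^|k| with p z bounded; this uses p <= n / eps^2, a
    consequence of the eigenvalue bounds for the full and the singleton models. *)
Require Import Defs.
From HB Require Import structures.
From mathcomp Require Import all_boot all_order all_algebra finmap.
From mathcomp Require Import all_classical all_reals all_analysis.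
From mathcomp Require Import measurable_realfun.
From mathcomp Require Import ring lra.
From mathcomp Require polyrcf.

Set Implicit Arguments.
Unset Strict Implicit.
Unset Printing Implicit Defensive.

Import Order.TTheory GRing.Theory Num.Theory.
Import numFieldNormedType.Exports.

Local Open Scope classical_set_scope.
Local Open Scope ring_scope.

(** * Quadratic forms *)

(** No closed form of the marginal density is used, and no least-squares estimator appears: every
    integral is centred at the true coefficients. A parameter [th] splits the quadratic part of the
    residual. The share [1 - th] pays for the cross term with the noise, which lowers the peak by
    [q / (1 - th)]; the share [th] is bounded below coordinate by coordinate, so the integral over
    the coefficients factors. The price is a power of [1 / (th * ep)] per coordinate, whose
    logarithm is a small multiple of [ln n]. The value [th = 1/50] leaves room in the tightest
    comparison. At [r = 1] the net penalty is [3/2 m ln n], and the noise costs [5/4 m ln n], which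
    becomes [133/100 m ln n] after the losses in [th] and in the energy of the noise. The further
    factor [n^(11/10)] is beaten because [m ln m <= m ln n - ln n + m], which recovers a power
    [n^(r+1/2)]. Marginals are reals extracted by [fine] from extended integrals, so comparisons are
    first made between the integrals, and finiteness and measurability are proved along the way. *)

Definition sqn (R : realType) n (v : 'cV[R]_n) : R := \sum_i v i 0 ^+ 2.

Definition dotc (R : realType) n (u v : 'cV[R]_n) : R := \sum_i u i 0 * v i 0.

Section Dot.
Context (R : realType).

Lemma dotcE n (u v : 'cV[R]_n) : dotc u v = (u^T *m v) 0 0.
Proof. by rewrite /dotc mxE; apply: eq_bigr => i _; rewrite mxE. Qed.

Lemma sqnE n (v : 'cV[R]_n) : sqn v = dotc v v.
Proof. by apply: eq_bigr => i _; rewrite expr2. Qed.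

Lemma dotcC n (u v : 'cV[R]_n) : dotc u v = dotc v u.
Proof. by apply: eq_bigr => i _; rewrite mulrC. Qed.

Lemma dotcDl n (u v w : 'cV[R]_n) : dotc (u + v) w = dotc u w + dotc v w.
Proof. by rewrite -big_split; apply: eq_bigr => i _; rewrite mxE mulrDl. Qed.

Lemma dotcZl n a (u w : 'cV[R]_n) : dotc (a *: u) w = a * dotc u w.
Proof. by rewrite mulr_sumr; apply: eq_bigr => i _; rewrite mxE mulrA. Qed.

Lemma dotcNl n (u w : 'cV[R]_n) : dotc (- u) w = - dotc u w.
Proof. by rewrite -scaleN1r dotcZl mulN1r. Qed.

Lemma dotcDr n (u v w : 'cV[R]_n) : dotc w (u + v) = dotc w u + dotc w v.
Proof. by rewrite dotcC dotcDl !(dotcC w). Qed.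

Lemma dotcZr n a (u w : 'cV[R]_n) : dotc w (a *: u) = a * dotc w u.
Proof. by rewrite dotcC dotcZl dotcC. Qed.

Lemma dotcNr n (u w : 'cV[R]_n) : dotc w (- u) = - dotc w u.
Proof. by rewrite dotcC dotcNl dotcC. Qed.

Lemma dotc_mull n m (A : 'M[R]_(n, m)) u v : dotc (A *m u) v = dotc u (A^T *m v).
Proof. by rewrite !dotcE trmx_mul mulmxA. Qed.

Lemma sqn_ge0 n (v : 'cV[R]_n) : 0 <= sqn v.
Proof. by apply: sumr_ge0 => i _; exact: sqr_ge0. Qed.

Lemma sqn0 n : sqn (0 : 'cV[R]_n) = 0.
Proof. by rewrite /sqn big1// => i _; rewrite mxE expr0n. Qed.

Lemma sqn_eq0 n (v : 'cV[R]_n) : (sqn v == 0) = (v == 0).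
Proof.
apply/eqP/eqP => [h|->]; last exact: sqn0.
apply/colP => i; rewrite mxE.
have := @psumr_eq0P R _ predT (fun i => v i 0 ^+ 2) (fun i _ => sqr_ge0 _) h i isT.
by move/eqP; rewrite sqrf_eq0 => /eqP.
Qed.

Lemma sqnD n (u v : 'cV[R]_n) : sqn (u + v) = sqn u + 2 * dotc u v + sqn v.
Proof. by rewrite !sqnE dotcDl !dotcDr (dotcC v u); ring. Qed.

Lemma sqnZ n a (u : 'cV[R]_n) : sqn (a *: u) = a ^+ 2 * sqn u.
Proof. by rewrite !sqnE dotcZl dotcZr mulrA expr2. Qed.

Lemma sqnN n (u : 'cV[R]_n) : sqn (- u) = sqn u.
Proof. by rewrite -scaleN1r sqnZ sqrrN expr1n mul1r. Qed.

Lemma sqnB n (u v : 'cV[R]_n) : sqn (u - v) = sqn u - 2 * dotc u v + sqn v.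
Proof. by rewrite sqnD sqnN dotcNr; ring. Qed.

Lemma dotc_CS n (u v : 'cV[R]_n) : dotc u v ^+ 2 <= sqn u * sqn v.
Proof.
have [->|v0] := eqVneq v 0.
  by rewrite sqn0 mulr0 /dotc big1 ?expr0n// => i _; rewrite mxE mulr0.
have vp : 0 < sqn v by rewrite lt_def sqn_ge0 andbT sqn_eq0.
have := sqn_ge0 (sqn v *: u - dotc u v *: v).
rewrite sqnB !sqnZ dotcZl dotcZr => h.
have : 0 <= sqn v * (sqn u * sqn v - dotc u v ^+ 2) by apply: le_trans h _; lra.
by rewrite pmulr_rge0// subr_ge0.
Qed.

(** The Rayleigh quotient attains its maximum on the compact unit sphere, and the first-order
    condition at a maximiser is the eigenvector equation. The vector [v] only certifies that the
    sphere is nonempty. *)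
Lemma qform_eigen_max n (G : 'M[R]_n) (v : 'cV[R]_n) : G^T = G -> v != 0 ->
  exists2 M, eigenvalue G M & forall w, dotc w (G *m w) <= M * sqn w.
Proof.
move=> Gs v0.
pose S : set 'rV[R]_n := [set x | sqn x^T = 1].
pose f (x : 'rV[R]_n) := dotc x^T (G *m x^T).
have cc i : continuous (fun x : 'rV[R]_n => x 0 i) by exact: coord_continuous.
have cM (g h : 'rV[R]_n -> R) :
    continuous g -> continuous h -> continuous (fun x => g x * h x).
  by move=> cg ch x; exact: (cvgM (cg x) (ch x)).
have csqn : continuous (fun x : 'rV[R]_n => sqn x^T).
  have -> : (fun x : 'rV[R]_n => sqn x^T) = (fun x => \sum_i x 0 i * x 0 i).
    by apply/funext => x; apply: eq_bigr => i _; rewrite mxE expr2.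
  by apply: continuous_big => [|i _]; [exact: add_continuous|exact: cM].
have cf : continuous f.
  have -> : f = (fun x => \sum_i x 0 i * \sum_j G i j * x 0 j).
    apply/funext => x; apply: eq_bigr => i _; rewrite !mxE; congr (_ * _).
    by apply: eq_bigr => j _; rewrite mxE.
  apply: continuous_big => [|i _]; first exact: add_continuous.
  apply: (cM) => //; apply: continuous_big => [|j _]; first exact: add_continuous.
  by apply: (cM (fun=> _) (fun x : 'rV[R]_n => x 0 j)) ; [exact: cst_continuous|exact: cc].
have S0 : S !=set0.
  exists ((Num.sqrt (sqn v))^-1 *: v)^T; rewrite /S/= trmxK sqnZ exprVn.
  by rewrite sqr_sqrtr ?sqn_ge0// mulVf// sqn_eq0.
have cS : compact S.
  apply: (@subclosed_compact _ _ [set x : 'rV[R]_n | forall i, `[-1, 1]%classic (x 0 i)]).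
  - by have := (closed_comp (fun x _ => csqn x) (@closed_eq _ 1)).
  - exact: (@rV_compact R n (fun=> `[-1, 1]%classic) (fun=> @segment_compact _ _ _)).
  - move=> x /= sx i; rewrite in_itv/=.
    have : x 0 i ^+ 2 <= 1.
      rewrite -sx /sqn (bigD1 i)//= mxE lerDl; apply: sumr_ge0 => j _; exact: sqr_ge0.
    by rewrite -real_normK ?num_real// expr_le1// ler_norml.
have [c cS' cmax] := EVT_max_rV S0 cS (continuous_subspaceT cf).
rewrite inE/= /S in cS'.
pose M := f c; pose x := c^T.
have PS w : dotc w (G *m w) <= M * sqn w.
  have [->|w0] := eqVneq w 0; first by rewrite sqn0 mulr0 dotcE mulmx0 mulmx0 mxE.
  have wp : 0 < sqn w by rewrite lt_def sqn_ge0 andbT sqn_eq0.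
  have zS : ((Num.sqrt (sqn w))^-1 *: w)^T \in S.
    apply/mem_set; rewrite /S/= trmxK sqnZ exprVn sqr_sqrtr ?sqn_ge0//.
    by rewrite mulVf// gt_eqF.
  have := cmax _ zS.
  rewrite /f trmxK -scalemxAr dotcZl dotcZr mulrA -expr2 exprVn sqr_sqrtr ?sqn_ge0//.
  by rewrite ler_pdivrMl// mulrC.
exists M => //.
(* Perturbing the maximiser [x] along [w] gives a quadratic in the step size [s] that is nonnegative
   for all [s] and vanishes at 0, so its linear coefficient [a] is 0. *)
have GE : forall w, dotc (M *: x - G *m x) w = 0.
  move=> w; set a := dotc _ w.
  have q s : 0 <= 2 * s * a + s ^+ 2 * (M * sqn w - dotc w (G *m w)).
    have := PS (x + s *: w).
    rewrite sqnD mulmxDr !dotcDl !dotcDr -scalemxAr !dotcZl !dotcZr sqnZ cS'.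
    have -> : dotc x (G *m w) = dotc w (G *m x) by rewrite dotcC dotc_mull Gs.
    rewrite [dotc x (G *m x)](_ : _ = M)//.
    have -> : a = M * dotc x w - dotc w (G *m x).
      by rewrite /a dotcDl dotcNl dotcZl (dotcC (G *m x)).
    by lra.
  set b := M * sqn w - dotc w (G *m w) in q.
  have b0 : 0 <= b by rewrite subr_ge0 PS.
  (* The minimiser of the quadratic would be [- a / b]; the shift by 1 covers [b = 0]. *)
  have := q (- a / (b + 1)); have b1 : 0 < b + 1 by lra.
  have -> : 2 * (- a / (b + 1)) * a + (- a / (b + 1)) ^+ 2 * b =
    - (a ^+ 2 * ((b + 2) / (b + 1) ^+ 2)) by field; rewrite gt_eqF.
  have k0 : 0 < (b + 2) / (b + 1) ^+ 2 by apply: divr_gt0; [lra|exact: exprn_gt0].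
  rewrite oppr_ge0 (pmulr_lle0 _ k0) => h.
  by apply/eqP; rewrite -sqrf_eq0 eq_le h sqr_ge0.
apply/eigenvalueP; exists c.
  have /eqP := GE (M *: x - G *m x); rewrite -sqnE sqn_eq0 subr_eq0 => /eqP h.
  by apply: (can_inj (@trmxK _ _ _)); rewrite trmx_mul Gs -[c^T]/x -h -linearZ.
by apply/eqP => c0; move: cS'; rewrite /mkset c0 trmx0 sqn0 => /esym/eqP; rewrite oner_eq0.
Qed.

Lemma qform_le n (G : 'M[R]_n) (c : R) (v : 'cV[R]_n) : G^T = G ->
  (forall a, eigenvalue G a -> a <= c) -> dotc v (G *m v) <= c * sqn v.
Proof.
move=> Gs Gc; have [->|v0] := eqVneq v 0.
  by rewrite sqn0 mulr0 dotcE mulmx0 mulmx0 mxE.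
have [M eM hM] := qform_eigen_max Gs v0.
by apply: le_trans (hM v) _; rewrite ler_wpM2r ?sqn_ge0 ?Gc.
Qed.

Lemma qform_ge n (G : 'M[R]_n) (c : R) (v : 'cV[R]_n) : G^T = G ->
  (forall a, eigenvalue G a -> c <= a) -> c * sqn v <= dotc v (G *m v).
Proof.
move=> Gs Gc; have := @qform_le n (- G) (- c) v.
rewrite mulNmx dotcNr mulNr lerN2; apply; first by rewrite linearN/= Gs.
move=> a /eigenvalueP[w wG w0]; rewrite lerNr Gc//; apply/eigenvalueP; exists w => //.
by rewrite scaleNr -wG mulmxN opprK.
Qed.

(** The polynomial [det (x + G)] is monic and has no root on [x >= 0], since a kernel vector would
    contradict positivity of the form. It is positive for large [x], hence at 0 by the intermediate
    value theorem. *)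
Lemma mx_posdef_det_gt0 n (G : 'M[R]_n) :
  (forall v : 'cV[R]_n, v != 0 -> 0 < dotc v (G *m v)) -> 0 < \det G.
Proof.
move=> Gpd.
pose q := char_poly (- G).
have qE x : q.[x] = \det (x%:M + G).
  rewrite /q /char_poly -horner_evalE -det_map_mx; congr (\det _).
  apply/matrixP => i j; rewrite !mxE /= /horner_eval !hornerE.
  by case: eqP => _; rewrite !hornerE ?opprK// mulr0n hornerE opprK.
have nr x : 0 <= x -> q.[x] != 0.
  move=> x0; rewrite qE -unitfE -[_ \is a _]/(_ \in unitmx) -row_free_unit -kermx_eq0.
  apply/eqP/eqP/rowV0P => v /sub_kermxP vG; apply/eqP/negPn/negP => v0.
  have vT0 : v^T != 0 by rewrite -trmx0 (inj_eq (@trmx_inj _ _ _)).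
  have : dotc v^T ((x%:M + G) *m v^T) = 0.
    by rewrite dotcE trmxK mulmxA vG mul0mx mxE.
  rewrite mulmxDl mul_scalar_mx dotcDr dotcZr -sqnE => e.
  have := Gpd _ vT0; have := sqn_ge0 v^T; nra.
have qm : 0 < lead_coef q by rewrite (monicP (char_poly_monic _)) ltr01.
rewrite ltNge; apply/negP => d0.
have [x [x0 qx]] : exists x, 0 <= x /\ 0 <= q.[x].
  have [y hy] := polyrcf.poly_pinfty_gt_lc qm.
  exists (Num.max 0 y); rewrite le_max lexx; split => //.
  by apply: le_trans (ltW qm) (hy _ _); rewrite le_max lexx orbT.
have q0 : q.[0] <= 0 by rewrite qE raddf0 add0r.
have [z /andP[z0 _] /rootP qz] := poly_ivt x0 (introT andP (conj q0 qx)).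
by have := nr z z0; rewrite qz eqxx.
Qed.
End Dot.

(** * Spectra of Gram matrices *)

Section Spectrum.
Context (R : realType).

(** Dividing out one root with its full multiplicity leaves the multiplicities of the other roots
    unchanged. The inequality is strict because [size] is the degree plus one. *)
Lemma sum_mup_lt_size (q : {poly R}) (s : seq R) : q != 0 -> uniq s ->
  (\sum_(x <- s) mup x q < size q)%N.
Proof.
elim: s q => [|x s IH] q q0; first by rewrite big_nil size_poly_gt0.
move=> /= /andP[xs us]; rewrite big_cons.
have dv : ('X - x%:P) ^+ (mup x q) %| q by rewrite -mup_geq.
have qE := divpK dv; set q' := q %/ _ in qE.
have q'0 : q' != 0 by apply: contraNneq q0 => e; rewrite -qE e mul0r.
have X0 : ('X - x%:P) ^+ (mup x q) != 0 by rewrite expf_neq0// polyXsubC_eq0.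
have -> : \sum_(y <- s) mup y q = (\sum_(y <- s) mup y q')%N.
  apply: eq_big_seq => y ys; rewrite -{1}qE mupMl//.
  rewrite /root horner_exp !hornerE expf_neq0// subr_eq0.
  by apply: contraNneq xs => <-.
have -> : size q = (mup x q + size q')%N.
  by rewrite -{1}qE size_mul// size_exp_XsubC addnS addnC.
by rewrite ltn_add2l IH.
Qed.

Lemma mem_eigenvalues_seq m (M : 'M[R]_m) a :
  (a \in eigenvalues_seq M) = eigenvalue M a.
Proof.
have c0 : char_poly M != 0 by rewrite monic_neq0// char_poly_monic.
rewrite eigenvalue_root_char.
have rE : (a \in polyrcf.rootsR (char_poly M)) = root (char_poly M) a.
  by rewrite -(polyrcf.roots_on_rootsR c0 a) in_itv.
apply/flattenP/idP => [[_ /mapP[x xr ->]]|ra].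
  by move: xr; rewrite -(polyrcf.roots_on_rootsR c0 x) in_itv/= mem_nseq => xr /andP[_ /eqP ->].
exists (nseq (mup a (char_poly M)) a); first by apply/mapP; exists a; rewrite ?rE.
by rewrite mem_nseq eqxx andbT -XsubC_dvd// dvdp_XsubCl.
Qed.

Lemma size_eigenvalues_seq m (M : 'M[R]_m) : (size (eigenvalues_seq M) <= m)%N.
Proof.
have c0 : char_poly M != 0 by rewrite monic_neq0// char_poly_monic.
rewrite size_flatten /shape -map_comp sumnE big_map.
under eq_bigr do rewrite /= size_nseq.
rewrite -ltnS -(size_char_poly M).
exact: sum_mup_lt_size c0 (polyrcf.uniq_roots _ _ _).
Qed.

Lemma sorted_eigenvalues_seq m (M : 'M[R]_m) : sorted <=%R (eigenvalues_seq M).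
Proof.
have : sorted <%R (polyrcf.rootsR (char_poly M)) by exact: polyrcf.sorted_roots.
rewrite /eigenvalues_seq; elim: (polyrcf.rootsR _) => //= x s IH.
rewrite (path_sortedE lt_trans) => /andP[/allP xs /IH ss].
rewrite sorted_pairwise ?pairwise_cat; last exact: le_trans.
rewrite -!sorted_pairwise; try exact: le_trans.
rewrite ss andbT; apply/andP; split.
  apply/allrelP => y z; rewrite mem_nseq => /andP[_ /eqP ->].
  by move=> /flattenP[_ /mapP[w ws ->]]; rewrite mem_nseq => /andP[_ /eqP ->]; exact/ltW/xs.
case: (mup _ _) => //= k; apply/(pathP 0) => i; rewrite size_nseq => ik.
by rewrite -[x :: nseq k x]/(nseq k.+1 x) !nth_nseq ik ltnS ltnW.
Qed.

Lemma eigenvalue_le_nu1 m (M : 'M[R]_m) a : eigenvalue M a -> a != 0 ->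
  a <= nu 1 M.
Proof.
rewrite -mem_eigenvalues_seq => aM a0; rewrite /nu.
set z := [seq _ <- _ | _].
have za : a \in z by rewrite mem_filter a0.
have sz : sorted <=%R z by apply: sorted_filter; [exact: le_trans|exact: sorted_eigenvalues_seq].
case: (lastP z) za sz => // z' b; rewrite rev_rcons /= mem_rcons inE.
move=> /predU1P[->//|az]; rewrite -cats1 sorted_pairwise; last exact: le_trans.
rewrite pairwise_cat => /and3P[/allrelP + _ _] => /(_ a b az); apply.
by rewrite inE.
Qed.

(** Since [nu] defaults to 0, positivity up to index [m] forces [m] nonzero eigenvalues. There are
    at most [m] in all, so the filter in [nu] has removed nothing and every eigenvalue is some
    [nu j]. *)
Lemma eigenvalue_ge_nu m (M : 'M[R]_m) c a : 0 < c ->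
  (forall j, (0 < j <= m)%N -> c <= nu j M) -> eigenvalue M a -> c <= a.
Proof.
move=> c0 cnu aM.
have m0 : (0 < m)%N.
  by case: m M cnu aM => // M _ /eigenvalueP[v _]; rewrite thinmx0 eqxx.
set z := [seq x <- eigenvalues_seq M | x != 0].
have sz : (m <= size z)%N.
  rewrite leqNgt; apply/negP => h.
  have := cnu m; rewrite m0 leqnn /nu nth_default ?size_rev -/z; first by rewrite leNgt c0 => /(_ isT).
  by rewrite -ltnS prednK.
have zE : z = eigenvalues_seq M.
  apply/all_filterP; rewrite all_count eqn_leq count_size -size_filter -/z.
  exact: leq_trans (size_eigenvalues_seq M) sz.
have : a \in rev z by rewrite mem_rev zE mem_eigenvalues_seq.
move=> /(nthP 0)[j jz <-]; apply: (cnu j.+1); rewrite ltnS /=.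
by apply: leq_trans jz _; rewrite size_rev zE size_eigenvalues_seq.
Qed.

End Spectrum.

Section Gram.
Context (R : realType) (n p : nat).
Implicit Types (X : 'M[R]_(n, p)) (k : {set 'I_p}).

(** Coefficients of a model are handled as vectors of the full space vanishing off [k], so that
    vectors of different models can be added and subtracted. *)
Definition supported k (v : 'cV[R]_p) := forall i, i \notin k -> v i 0 = 0.

Definition restr_col k (v : 'cV[R]_p) : 'cV[R]_#|k| := \col_j v (enum_val j) 0.

Lemma design_sub_mulE X k v : supported k v -> design_sub X k *m restr_col k v = X *m v.
Proof.
move=> kv; apply/colP => i; rewrite !mxE.
transitivity (\sum_(j in k) X i j * v j 0).
  by rewrite [RHS]big_enum_val; apply: eq_bigr => j _; rewrite !mxE.
rewrite [RHS](bigID (mem k))/= [X in _ + X]big1 ?addr0// => j jk.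
by rewrite kv ?mulr0.
Qed.

Lemma sqn_restr_col k v : supported k v -> sqn (restr_col k v) = sqn v.
Proof.
move=> kv; transitivity (\sum_(j in k) v j 0 ^+ 2).
  by rewrite [RHS]big_enum_val; apply: eq_bigr => j _; rewrite !mxE.
rewrite [RHS](bigID (mem k))/= [X in _ + X]big1 ?addr0// => j jk.
by rewrite kv ?expr0n.
Qed.

Lemma scaled_gram_sym X k : (scaled_gram X k)^T = scaled_gram X k.
Proof. by rewrite linearZ/= trmx_mul trmxK. Qed.

Lemma scaled_gramE X k v :
  dotc v (scaled_gram X k *m v) = n%:R^-1 * sqn (design_sub X k *m v).
Proof. by rewrite -scalemxAl dotcZr -mulmxA sqnE dotc_mull. Qed.

(** With at most [n] columns, [minn n #|k|] is [#|k|], so the bound on [lambda_min] reaches all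
    eigenvalues of the Gram matrix and excludes 0. *)
Lemma design_sqn_ge X k e v : (0 < n)%N -> (#|k| <= n)%N -> 0 < e ->
  e <= lambda_min X k -> supported k v -> n%:R * e * sqn v <= sqn (X *m v).
Proof.
move=> n0 kn e0 eX kv; rewrite -(sqn_restr_col kv) -(design_sub_mulE _ kv).
have n0' : 0 < (n%:R : R) by rewrite ltr0n.
rewrite -mulrA -ler_pdivlMl// -scaled_gramE; apply: qform_ge; first exact: scaled_gram_sym.
move=> a; apply: eigenvalue_ge_nu e0 _ => j /andP[j0 jk].
apply: le_trans eX _; rewrite /lambda_min (minn_idPr kn).
by apply: ge_bigmin_seq => //; rewrite mem_index_iota j0 ltnS.
Qed.

Lemma design_sqn_le X k c v : (0 < n)%N -> 0 <= c ->
  lambda_max X k <= c -> supported k v -> sqn (X *m v) <= n%:R * c * sqn v.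
Proof.
move=> n0 c0 eX kv; rewrite -(sqn_restr_col kv) -(design_sub_mulE _ kv).
have n0' : 0 < (n%:R : R) by rewrite ltr0n.
rewrite -mulrA -ler_pdivrMl// -scaled_gramE; apply: qform_le; first exact: scaled_gram_sym.
move=> a aG; have [->//|a0] := eqVneq a 0.
apply: le_trans (eigenvalue_le_nu1 aG a0) _; apply: le_trans eX.
exact: bigmax_ge_id.
Qed.

(** The sum of squares of the entries of [X] is counted twice: each column contributes at least
    [n e] by the singleton models, each row at most [n / e] by the full model. *)
Lemma design_columns_bound X e : (0 < n)%N -> 0 < e < 1 ->
  (forall k : {set 'I_p}, k != finset.set0 ->
     e <= lambda_min X k /\ lambda_max X k <= e^-1) ->
  p%:R * e ^+ 2 <= n%:R.
Proof.
move=> n0 /andP[e0 e1] eX; have n0' : 0 < (n%:R : R) by rewrite ltr0n.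
have [p0|p0] := eqVneq p 0%N; first by rewrite [in leLHS]p0 mul0r.
have op v : sqn (X *m v) <= n%:R * e^-1 * sqn v.
  have /(_ [set: 'I_p]%SET) [|_ h] := eX.
    by rewrite -card_gt0 cardsT card_ord lt0n.
  by apply: design_sqn_le h _ => //; [rewrite invr_ge0 ltW|move=> i; rewrite inE].
(* The transpose has the same operator norm: with [s = |X^T w|^2 = <w, X X^T w>], Cauchy-Schwarz and
   the bound for [X] give [s^2 <= |w|^2 (n / e) s]. *)
have opT w : sqn (X^T *m w) <= n%:R * e^-1 * sqn w.
  set s := sqn (X^T *m w).
  have sE : s = dotc w (X *m (X^T *m w)) by rewrite /s sqnE dotc_mull trmxK.
  have := dotc_CS w (X *m (X^T *m w)); rewrite -sE => h.
  have := op (X^T *m w); rewrite -/s => h2.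
  have s0 : 0 <= s by exact: sqn_ge0.
  have w0 := sqn_ge0 w.
  have {h2}h : s * s <= s * (n%:R * e^-1 * sqn w).
    rewrite -expr2; apply: le_trans h _.
    apply: le_trans (ler_wpM2l w0 h2) _; rewrite le_eqVlt; apply/orP; left; apply/eqP.
    by clear; ring.
  move: s0; rewrite le_eqVlt => /predU1P[<-|sp]; last by rewrite ler_pM2l in h.
  by rewrite !mulr_ge0// invr_ge0 ltW.
have dE m (i : 'I_m) : sqn (delta_mx i 0 : 'cV[R]_m) = 1.
  rewrite /sqn (bigD1 i)//= mxE !eqxx expr1n big1 ?addr0// => j ji.
  by rewrite mxE (negbTE ji) expr0n.
have cE : \sum_j sqn (X *m delta_mx j 0) = \sum_i sqn (X^T *m delta_mx i 0).
  under eq_bigr do rewrite -colE /sqn.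
  under [RHS]eq_bigr do rewrite -colE /sqn.
  by rewrite exchange_big; apply: eq_bigr => i _; apply: eq_bigr => j _; rewrite !mxE.
have lo : p%:R * (n%:R * e) <= \sum_j sqn (X *m delta_mx j 0).
  rewrite -[p in p%:R]card_ord mulr_natl -sumr_const; apply: ler_sum => j _.
  have /(_ [set j]%SET) [|h _] := eX; first by rewrite -card_gt0 cards1.
  have := @design_sqn_ge X [set j]%SET e (delta_mx j 0) n0.
  rewrite cards1 dE mulr1; apply => //.
  by move=> i; rewrite inE mxE => /negbTE ->.
have hi : \sum_i sqn (X^T *m delta_mx i 0) <= n%:R * (n%:R * e^-1).
  have -> : n%:R * (n%:R * e^-1) = \sum_(i < n) (n%:R * e^-1).
    by rewrite sumr_const card_ord mulr_natl.
  apply: ler_sum => j _.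
  by have := opT (delta_mx j 0); rewrite dE mulr1.
rewrite cE in lo; have := le_trans lo hi.
rewrite mulrCA ler_pM2l// ler_pdivlMr//.
by rewrite -mulrA -expr2.
Qed.

End Gram.

(** Gram-Schmidt, one column at a time. A column already in the span of the others adds no vector to
    [Q], so the columns of [X] may be dependent and [d] is only bounded by [m]. *)
Lemma orthonormal_factor (R : realType) n m (X : 'M[R]_(n, m)) :
  exists d (Q : 'M[R]_(n, d)) (S : 'M[R]_(d, m)),
    [/\ (d <= m)%N, Q^T *m Q = 1%:M & X = Q *m S].
Proof.
elim: m X => [|m IH] X.
  exists 0%N, 0, 0; split => //; first by apply/matrixP; case.
  by apply/matrixP => i; case.
have [d [Q [S [dm QQ XE]]]] := IH (rsubmx (X : 'M[R]_(n, 1 + m))).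
pose x := lsubmx (X : 'M[R]_(n, 1 + m)).
pose v := x - Q *m (Q^T *m x).
have Qv : Q^T *m v = 0 by rewrite mulmxBr !mulmxA QQ mul1mx subrr.
have XX : X = row_mx x (Q *m S) :> 'M[R]_(n, 1 + m) by rewrite -XE hsubmxK.
have [v0|v0] := eqVneq v 0.
  exists d, Q, (row_mx (Q^T *m x) S); split => //; first exact: leqW.
  rewrite (mul_mx_row Q (Q^T *m x) S) XX.
  by move/eqP: v0; rewrite subr_eq0 => /eqP <-.
pose a := Num.sqrt (sqn v).
have a0 : a != 0 by rewrite gt_eqF// sqrtr_gt0 lt_def sqn_eq0 v0 sqn_ge0.
exists (1 + d)%N, (row_mx (a^-1 *: v) Q), (block_mx a%:M 0 (Q^T *m x) S); split => //.
  rewrite tr_row_mx mul_col_row QQ.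
  have -> : (a^-1 *: v)^T = a^-1 *: v^T by rewrite linearZ.
  rewrite -!scalemxAl -!scalemxAr Qv scaler0.
  have -> : v^T *m Q = 0 by rewrite -[LHS]trmxK trmx_mul trmxK Qv trmx0.
  rewrite scaler0 scalerA; have -> : v^T *m v = (a ^+ 2)%:M.
    apply/matrixP => i j; rewrite !ord1 -dotcE -sqnE mxE eqxx mulr1n.
    by rewrite sqr_sqrtr// sqn_ge0.
  rewrite scale_scalar_mx; have -> : a^-1 * a^-1 * a ^+ 2 = 1.
    by rewrite expr2 -mulrA mulKf// mulVf.
  by rewrite -scalar_mx_block.
apply: etrans (esym (mul_row_block (a^-1 *: v) Q a%:M 0 (Q^T *m x) S)).
rewrite mulmx0 add0r XX; congr row_mx.
by rewrite mul_mx_scalar scalerA divff// scale1r /v subrK.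
Qed.

(** The quantity [sqn (Q^T *m e)] is the energy of [e] in the span of [Q]; the cross term with a
    vector of that span sees nothing else of [e]. *)
Lemma dotc_proj_le (R : realType) n d (Q : 'M[R]_(n, d)) (e : 'cV[R]_n) (w : 'cV[R]_d) :
  Q^T *m Q = 1%:M -> dotc e (Q *m w) ^+ 2 <= sqn (Q^T *m e) * sqn (Q *m w).
Proof.
move=> QQ; rewrite [sqn (Q *m w)]sqnE dotc_mull mulmxA QQ mul1mx -sqnE.
by rewrite dotcC dotc_mull dotcC dotc_CS.
Qed.

(** * Integrals *)

Section IntegralMono.
Import HBNNSimple.

(* No measurability is needed: the integral of a nonnegative function is a
   supremum over the simple functions below it. *)
Lemma integral_mono d (T : measurableType d) (R : realType)
    (mu : {measure set T -> \bar R}) (D : set T) (f g : T -> \bar R) :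
  (forall x, D x -> (0 <= f x)%E) -> (forall x, D x -> (f x <= g x)%E) ->
  (\int[mu]_(x in D) f x <= \int[mu]_(x in D) g x)%E.
Proof.
move=> f0 fg; rewrite (integral_mkcond D) (integral_mkcond D g).
have pf x : (0 <= (f \_ D) x)%E by rewrite /patch; case: ifPn => // /set_mem; exact: f0.
have pfg x : ((f \_ D) x <= (g \_ D) x)%E.
  by rewrite /patch; case: ifPn => // /set_mem; exact: fg.
rewrite !ge0_integralTE//; last by move=> x; exact: le_trans (pfg x).
apply: le_ereal_sup => _ [h hf <-].
by exists h => // x; exact: le_trans (hf x) (pfg x).
Qed.

End IntegralMono.

Lemma integral_ge_subset d (T : measurableType d) (R : realType)
    (mu : {measure set T -> \bar R}) (D E : set T) (f : T -> \bar R) (c : \bar R) :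
  measurable E -> E `<=` D -> (0 <= c)%E ->
  (forall x, D x -> (0 <= f x)%E) -> (forall x, E x -> (c <= f x)%E) ->
  (c * mu E <= \int[mu]_(x in D) f x)%E.
Proof.
move=> mE ED c0 f0 cf; rewrite -integral_cst//.
rewrite (integral_mkcond E) (integral_mkcond D); apply: integral_mono => x _.
  by rewrite /patch; case: ifP.
rewrite /patch; case: ifPn => [/set_mem xE|_]; last by case: ifPn => // /set_mem; exact: f0.
by rewrite mem_set; [exact: cf|exact: ED].
Qed.

(** * Gamma and inverse gamma integrals on the half line *)

Section HalfLine.
Context (R : realType).
Notation mu := (@lebesgue_measure R).

(** The fundamental theorem of calculus on compact intervals exhausting the half line, followed by
    monotone convergence. Bounds on the primitive replace its limits at 0 and at infinity. *)
Lemma integral_derive_le (F f : R -> R) (C : R) :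
  (forall x : R, 0 < x -> is_derive x 1 F (f x)) ->
  (forall x : R, 0 < x -> {for x, continuous f}) ->
  (forall x : R, 0 < x -> 0 <= f x) -> (forall x : R, 0 < x -> 0 <= F x <= C) ->
  (\int[mu]_(x in `]0%R, +oo[) (f x)%:E <= C%:E)%E.
Proof.
move=> dF cf f0 FC.
(* The shift by 2 keeps the left endpoint below 1 and the right one above 1 for every [n]. *)
pose D n : set (measurableTypeR R) := `[n.+2%:R^-1, n.+2%:R]%classic.
have n0 n : 0 < (n.+2%:R^-1 : R) by rewrite invr_gt0 ltr0n.
have Dgt n x : D n x -> 0 < x by rewrite /D/= in_itv/= => /andP[+ _]; exact: lt_le_trans (n0 n).
have DU : `]0%R, +oo[%classic = \bigcup_n D n.
  apply/seteqP; split => x /=; rewrite in_itv/= andbT; last first.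
    by move=> [n _ /Dgt].
  move=> x0; exists (Num.bound (Num.max x x^-1)) => //; rewrite /D/= in_itv/=.
  set N := Num.bound _.
  have : Num.max x x^-1 < N.+2%:R.
    have : Num.max x x^-1 < N%:R by apply: archi_boundP; rewrite le_max (ltW x0).
    by move/lt_trans; apply; rewrite ltr_nat.
  rewrite gt_max => /andP[h1 h2]; rewrite (ltW h1) andbT.
  by rewrite -[leRHS]invrK lef_pV2 ?posrE ?ltr0n ?invr_gt0//; exact: ltW.
have ndD : nondecreasing_seq D.
  move=> m n mn; apply/subsetPset => x; rewrite /D/= !in_itv/= => /andP[h1 h2].
  rewrite (le_trans _ h1) ?(le_trans h2)// ?ler_nat//.
  by rewrite lef_pV2 ?posrE ?ltr0n// ler_nat.
have cfD n : {within (D n : set R), continuous f}.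
  by apply: continuous_in_subspaceT => x /set_mem /Dgt; exact: cf.
have ub n : (\int[mu]_(x in D n) (f x)%:E <= C%:E)%E.
  have lt12 : n.+2%:R^-1 < n.+2%:R :> R.
    by rewrite (@lt_trans _ _ 1)// ?invf_lt1 ?ltr0n ?ltr1n.
  have dF0 (x : R) : 0 < x -> F @ x --> F x.
    move=> x0; apply: differentiable_continuous.
    by apply/derivable1_diffP; have [] := dF x x0.
  rewrite (@continuous_FTC2 _ f F)//.
  - have [h1 h2] := (andP (FC _ (n0 n)), andP (FC n.+2%:R (lt_trans (n0 n) lt12))).
    by rewrite -EFinB lee_fin; case: h1 h2 => ? ? []; lra.
  - exact: cfD.
  - split.
    + move=> x; rewrite in_itv/= => /andP[/(lt_trans (n0 n)) x0 _].
      by have [] := dF x x0.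
    + by apply: cvg_at_right_filter; exact: dF0.
    + by apply: cvg_at_left_filter; apply: dF0; exact: lt_trans (n0 n) lt12.
  - move=> x; rewrite in_itv/= => /andP[/(lt_trans (n0 n)) x0 _].
    by rewrite derive1E; have [_ ->] := dF x x0.
have mD i : measurable (D i) by exact: measurable_itv.
have mfD i : measurable_fun (D i) (EFin \o f).
  by apply/measurable_EFinP; apply: (@subspace_continuous_measurable_fun R (D i)); [exact: mD|exact: cfD].
have fD0 i x : D i x -> (0 <= (EFin \o f) x)%E by move=> /Dgt /f0; rewrite lee_fin.
have h := @ge0_nondecreasing_set_cvg_integral _ _ _ D (EFin \o f) mu ndD mD mfD fD0.
rewrite DU -(cvg_lim _ h)//; apply: lime_le; first exact: cvgP h.
by near=> n; exact: ub.
Unshelve. all: by end_near. Qed.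

(** With [y = b x / a] this is [y <= expR y] raised to the power [a]. It is the device by which
    powers of [tau], of the variance and of the coefficients are absorbed by exponentials. *)
Lemma powR_expR_le (a b x : R) : 0 <= a -> 0 < b -> 0 < x ->
  x `^ a * expR (- (b * x)) <= (a / b) `^ a.
Proof.
move=> a0 b0 x0; move: a0; rewrite le_eqVlt => /predU1P[<-|a0].
  by rewrite !powRr0 mul1r -expR0 ler_expR oppr_le0 mulr_ge0// ltW.
have c0 : 0 < a / b by rewrite divr_gt0.
pose y := x / (a / b).
have y0 : 0 < y by rewrite divr_gt0.
have bx : b * x = y * a by rewrite /y; field; rewrite !gt_eqF.
have -> : x `^ a = (a / b) `^ a * y `^ a.
  by rewrite -powRM ?ltW// /y mulrC divfK// gt_eqF.
rewrite expRN ler_pdivrMr ?expR_gt0// ler_wpM2l ?powR_ge0//.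
rewrite bx expRM ge0_ler_powR ?nnegrE ?ltW ?expR_gt0//.
by apply: lt_le_trans (expR_ge1Dx y); lra.
Qed.

(** The log-logistic density, derivative of [1 - (1 + x^a)^-1]. It behaves like [x^(a-1)] at 0 and
    like [x^(-a-1)] at infinity, so a multiple of it dominates both the gamma and the inverse gamma
    integrands. *)
Let cauchy_like (a x : R) := a * x `^ (a - 1) / (1 + x `^ a) ^+ 2.

Let continuous_cauchy_like (a : R) (x : R) : 0 < x ->
  {for x, continuous (cauchy_like a)}.
Proof.
have cp b : 0 < x -> {for x, continuous (@powR R ^~ b)}.
  move=> x0; apply: differentiable_continuous; apply/derivable1_diffP.
  by apply: derivable_powR; rewrite in_itv/= x0.
move=> x0; rewrite /continuous_at /cauchy_like.
apply: cvgM; first by apply: cvgM; [exact: cvg_cst|exact: cp].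
apply: cvgV; first by rewrite expf_neq0// gt_eqF//; have := powR_ge0 x a; lra.
by apply: cvgM; (apply: cvgD; [exact: cvg_cst|exact: cp]).
Qed.

Let integral_cauchy_like (a : R) : 0 < a ->
  (\int[mu]_(x in `]0%R, +oo[) (cauchy_like a x)%:E <= 1%:E)%E.
Proof.
move=> a0.
have p1 x : 0 < 1 + x `^ a by have := powR_ge0 x a; lra.
apply: (@integral_derive_le (fun x => 1 - (1 + x `^ a)^-1)).
- move=> x x0; have nz : 1 + x `^ a != 0 by rewrite gt_eqF.
  have dp := is_derive1_powR a x0.
  have d1 : is_derive x 1 (fun x => 1 + x `^ a) (0 + a * x `^ (a - 1)) by exact: is_deriveD.
  have d2 : is_derive x 1 (fun x => (1 + x `^ a)^-1) (- (1 + x `^ a) ^- 2 *: (0 + a * x `^ (a - 1))).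
    exact: (@is_deriveV R (fun x => 1 + x `^ a) x _ 1 nz d1).
  have d3 : is_derive x 1 (fun x => 1 - (1 + x `^ a)^-1) (0 - (- (1 + x `^ a) ^- 2 *: (0 + a * x `^ (a - 1)))) by exact: is_deriveB.
  by apply: is_derive_eq; rewrite /cauchy_like /GRing.scale/= add0r; field.
- exact: continuous_cauchy_like.
- by move=> x x0; rewrite /cauchy_like divr_ge0 ?mulr_ge0 ?powR_ge0 ?sqr_ge0 ?ltW.
- move=> x x0; rewrite subr_ge0 invf_le1// lerDl powR_ge0/= gerBl invr_ge0 ltW//.
Qed.

Let integral_cauchy_like_cst (a K : R) (f : R -> R) : 0 < a -> 0 <= K ->
  (forall x : R, 0 < x -> 0 <= f x <= K * cauchy_like a x) ->
  (\int[mu]_(x in `]0%R, +oo[) (f x)%:E < +oo)%E.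
Proof.
move=> a0 K0 fK; apply: (@le_lt_trans _ _ K%:E); last exact: ltry.
apply: (@le_trans _ _ (\int[mu]_(x in `]0%R, +oo[) (K%:E * (cauchy_like a x)%:E))%E).
  apply: integral_mono => x /=; rewrite in_itv/= andbT => x0; rewrite lee_fin.
    by have /andP[] := fK x x0.
  by have /andP[] := fK x x0.
rewrite ge0_integralZl_EFin//.
- rewrite -[leRHS]mule1; apply: lee_wpmul2l; first by rewrite lee_fin.
  exact: integral_cauchy_like.
- by move=> x _; rewrite lee_fin; apply: divr_ge0; rewrite ?sqr_ge0// mulr_ge0 ?powR_ge0// ltW.
- apply/measurable_EFinP; apply: open_continuous_measurable_fun => //.
  by move=> x /set_mem/=; rewrite in_itv/= andbT; exact: continuous_cauchy_like.
Qed.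

Let sqr_powR_expR_le (a b x : R) : 0 < a -> 0 < b -> 0 < x ->
  (1 + x `^ a) ^+ 2 * expR (- (b * x)) <= 2 + 2 * (2 * a / b) `^ (2 * a).
Proof.
move=> a0 b0 x0; have h := powR_expR_le (mulr_ge0 (ler0n R 2) (ltW a0)) b0 x0.
have e0 := expR_gt0 (- (b * x)).
have e1 : expR (- (b * x)) <= 1 by rewrite -expR0 ler_expR oppr_le0 mulr_ge0// ltW.
have xE : x `^ (2 * a) = (x `^ a) ^+ 2 by rewrite mulrC powRrM powR_mulrn// powR_ge0.
rewrite xE in h.
have : 0 <= expR (- (b * x)) * (1 - x `^ a) ^+ 2 by rewrite mulr_ge0 ?sqr_ge0// ltW.
lra.
Qed.

Lemma integral_gamma_lty (a : R) : 0 < a ->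
  (\int[mu]_(x in `]0%R, +oo[) (x `^ (a - 1) * expR (- x))%:E < +oo)%E.
Proof.
move=> a0; set K := (2 + 2 * (2 * a / 1) `^ (2 * a)).
have K0 : 0 <= K by rewrite addr_ge0// mulr_ge0// powR_ge0.
apply: (@integral_cauchy_like_cst a (K / a)) => //; first by rewrite divr_ge0// ltW.
move=> x x0; rewrite mulr_ge0 ?powR_ge0 ?expR_ge0//=.
have q1 : 0 < 1 + x `^ a by have := powR_ge0 x a; lra.
have -> : K / a * cauchy_like a x = x `^ (a - 1) * (K / (1 + x `^ a) ^+ 2).
  by rewrite /cauchy_like; field; rewrite !gt_eqF.
rewrite ler_wpM2l ?powR_ge0// ler_pdivlMr ?exprn_gt0// mulrC.
by have := sqr_powR_expR_le a0 ltr01 x0; rewrite mul1r.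
Qed.

(** [Gamma] is a real read off an extended integral, so its positivity requires finiteness as well
    as a lower bound, taken here on [[1, 2]]. *)
Lemma Gamma_gt0 (a : R) : 0 < a -> 0 < Gamma a.
Proof.
move=> a0; apply: fine_gt0; rewrite integral_gamma_lty// andbT.
have m12 : measurable (`[1, 2]%classic : set (measurableTypeR R)) by exact: measurable_itv.
have c0 : 0 < 2^-1 * expR (- 2) :> R by rewrite mulr_gt0 ?expR_gt0.
refine (lt_le_trans _ (@integral_ge_subset _ _ _ mu _ _ _ (2^-1 * expR (- 2))%:E m12 _ _ _ _)).
- have e : mu `[1, 2]%classic = 1%E.
    by rewrite lebesgue_measure_itv/= lte_fin ltr1n/= -EFinD; congr (_%:E); lra.
  by rewrite [X in (_ < _ * X)%E](_ : _ = 1%E) ?mule1 ?lte_fin.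
- by move=> x/=; rewrite !in_itv/= andbT => /andP[h _]; apply: lt_le_trans h.
- by rewrite lee_fin ltW.
- by move=> x _; rewrite lee_fin mulr_ge0 ?powR_ge0 ?expR_ge0.
- move=> x /=; rewrite in_itv/= => /andP[h1 h2]; rewrite lee_fin.
  apply: ler_pM; rewrite ?expR_ge0 ?invr_ge0 ?ler_expR//; last lra.
  apply: (@le_trans _ _ (x `^ (- 1))).
    by rewrite powR_inv1 ?lef_pV2 ?posrE//; lra.
  by rewrite ler_powR//; lra.
Qed.

(** The inversion [x -> 1/x] is done inside the integrand: dividing by the dominating density leaves
    [(1 + u^a)^2 expR (- b u)] at [u = 1/x]. *)
Lemma integral_inv_gamma_lty (a b : R) : 0 < a -> 0 < b ->
  (\int[mu]_(x in `]0%R, +oo[) (x `^ (- (a + 1)) * expR (- (b / x)))%:E < +oo)%E.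
Proof.
move=> a0 b0; set K := (2 + 2 * (2 * a / b) `^ (2 * a)).
have K0 : 0 <= K by rewrite addr_ge0// mulr_ge0// powR_ge0.
apply: (@integral_cauchy_like_cst a (K / a)) => //; first by rewrite divr_ge0// ltW.
move=> x x0; rewrite mulr_ge0 ?powR_ge0 ?expR_ge0//=.
have q0 : 0 < x `^ a by rewrite powR_gt0.
have -> : K / a * cauchy_like a x = x `^ (a - 1) * (K / (1 + x `^ a) ^+ 2).
  by rewrite /cauchy_like; field; rewrite !gt_eqF//; lra.
have -> : x `^ (- (a + 1)) = x `^ (a - 1) * (x `^ a) ^- 2.
  rewrite -powR_mulrn ?powR_ge0// -powRrM -powRN -powRD; last by rewrite (gt_eqF x0) implybT.
  by congr (_ `^ _); lra.
rewrite -mulrA ler_wpM2l ?powR_ge0// ler_pdivlMr ?exprn_gt0//; last lra.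
have := sqr_powR_expR_le a0 b0 (_ : 0 < x^-1); rewrite invr_gt0 => /(_ x0).
apply: le_trans; rewrite le_eqVlt; apply/orP; left; apply/eqP.
have -> : x^-1 `^ a = (x `^ a)^-1.
  by rewrite -[x^-1]powR_inv1 ?ltW// -powRrM mulN1r powRN.
by field; rewrite gt_eqF.
Qed.

End HalfLine.

Lemma measurable_fun_prodr d (T : measurableType d) (R : realType) (I : Type)
    (s : seq I) (h : I -> T -> R) : (forall i, measurable_fun setT (h i)) ->
  measurable_fun setT (fun x => \prod_(i <- s) h i x).
Proof.
move=> mh; elim: s => [|i s IH].
  by under eq_fun do rewrite big_nil; exact: measurable_cst.
by under eq_fun do rewrite big_cons; exact: measurable_funM.
Qed.

Lemma measurable_fun_sumr d (T : measurableType d) (R : realType) (I : Type)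
    (s : seq I) (h : I -> T -> R) : (forall i, measurable_fun setT (h i)) ->
  measurable_fun setT (fun x => \sum_(i <- s) h i x).
Proof.
move=> mh; elim: s => [|i s IH].
  by under eq_fun do rewrite big_nil; exact: measurable_cst.
by under eq_fun do rewrite big_cons; exact: measurable_funD.
Qed.

(** * Passing from measurable sets to nonnegative functions by the layer-cake formula *)

Section LayerCake.
Context (R : realType).
Notation mu := (@lebesgue_measure R).

Let integral_indic_itv (y c : R) : 0 <= y -> 0 <= c ->
  (\int[mu]_s (c * \1_(`[0%R, y[%classic : set R) s)%:E = (c * y)%:E)%E.
Proof.
move=> y0 c0.
under eq_integral do rewrite EFinM.
rewrite ge0_integralZl_EFin//.
- rewrite integral_indic//= setIT.
  have e : (mu `[0%R, y[%classic = y%:E)%E.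
    rewrite lebesgue_measure_itv/= lte_fin; case: ltrP => [_|h].
      by rewrite oppr0 adde0.
    by congr EFin; apply/eqP; rewrite eq_le y0 h.
  by rewrite [X in (_ * X)%E](_ : _ = y%:E).
- by apply/measurable_EFinP; apply: measurable_indic; exact: measurable_itv.
Qed.

Let integral_layer d (T : measurableType d) (m : {sigma_finite_measure set T -> \bar R})
    (H : T -> R) (X : T -> R) (f : R -> R) :
  measurable_fun setT H -> (forall x, 0 <= H x) -> measurable_fun setT X ->
  measurable_fun setT f -> (forall x, 0 <= f x) ->
  (\int[m]_x (H x * f (X x))%:E =
   \int[mu]_s \int[m]_x (H x * \1_[set y : R | (0 <= s) && (s < f y)] (X x))%:E)%E.
Proof.
move=> mH H0 mX mf f0.
pose E : set (T * R) := [set z | (0 <= z.2) && (z.2 < f (X z.1))].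
have mE : measurable E.
  rewrite (_ : E = setT `&` (fun z : T * R => (0 <= z.2) && (z.2 < f (X z.1))) @^-1` [set true]).
    apply: measurable_and => //.
      by apply: measurable_fun_ler => //; exact: measurable_snd.
    apply: measurable_fun_ltr; first exact: measurable_snd.
    by apply: (measurableT_comp mf); apply: (measurableT_comp mX); exact: measurable_fst.
  by rewrite setTI.
pose F (z : T * R) : \bar R := (H z.1 * \1_E z)%:E.
have mF : measurable_fun setT F.
  apply/measurable_EFinP; apply: measurable_funM; last exact: measurable_indic.
  by apply: (measurableT_comp mH); exact: measurable_fst.
have F0 z : (0 <= F z)%E by rewrite lee_fin mulr_ge0.
transitivity (\int[m]_x \int[mu]_y F (x, y))%E.
  apply: eq_integral => x _; rewrite -integral_indic_itv//; exact: eq_integral.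
apply: etrans (fubini_tonelli (m1 := m) (m2 := mu) F mF F0) _.
apply: eq_integral => s _; apply: eq_integral => x _; rewrite /F/=.
congr (EFin (_ * _)); rewrite !indicE; congr (nat_of_bool _)%:R.
Qed.

(** Both integrals are integrals over [s] of the level sets where [f] exceeds [s], and the
    hypothesis compares those. It is applied with [H] a density, to identify the law of a noise
    entry, and with [H] a product of other factors, to exploit independence. *)
Lemma integral_transfer d d' (T : measurableType d) (T' : measurableType d')
    (m : {sigma_finite_measure set T -> \bar R})
    (m' : {sigma_finite_measure set T' -> \bar R})
    (H : T -> R) (X : T -> R) (X' : T' -> R) (K : R) (f : R -> R) :
  measurable_fun setT H -> (forall x, 0 <= H x) ->
  measurable_fun setT X -> measurable_fun setT X' -> 0 <= K ->
  (forall A, measurable A ->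
     \int[m]_x (H x * \1_A (X x))%:E = K%:E * m' (X' @^-1` A))%E ->
  measurable_fun setT f -> (forall x, 0 <= f x) ->
  (\int[m]_x (H x * f (X x))%:E = K%:E * \int[m']_x (f (X' x))%:E)%E.
Proof.
move=> mH H0 mX mX' K0 hA mf f0; rewrite integral_layer//.
have -> : (\int[m']_x (f (X' x))%:E = \int[m']_x (1 * f (X' x))%:E)%E.
  by apply: eq_integral => x _; rewrite mul1r.
rewrite (@integral_layer _ T' m' (fun=> 1) X' f)//.
have mA (s : R) : measurable [set y : R | (0 <= s) && (s < f y)].
  rewrite (_ : [set _ | _] = setT `&` (fun y => (0 <= s) && (s < f y)) @^-1` [set true]).
    apply: measurable_and => //.
    by apply: measurable_fun_ltr => //; exact: measurable_cst.
  by rewrite setTI.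
have e s : (\int[m']_x (1 * \1_[set y : R | (0 <= s) && (s < f y)] (X' x))%:E
   = m' (X' @^-1` [set y : R | ((0 <= s) && (s < f y))%R]))%E.
  rewrite (eq_integral (fun x => (\1_(X' @^-1` [set y : R | ((0 <= s) && (s < f y))%R]) x)%:E)).
    rewrite integral_indic ?setIT//.
    by rewrite -[X in measurable X]setTI; exact: mX'.
  by move=> x _; rewrite mul1r.
under eq_integral do rewrite hA//.
under [in RHS]eq_integral do rewrite e.
rewrite ge0_integralZl_EFin//.
have mE : measurable [set z : T' * R | (0 <= z.2) && (z.2 < f (X' z.1))].
  rewrite (_ : [set _ | _] = setT `&` (fun z : T' * R => (0 <= z.2) && (z.2 < f (X' z.1))) @^-1` [set true]).
    apply: measurable_and => //.
      by apply: measurable_fun_ler => //; exact: measurable_snd.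
    apply: measurable_fun_ltr; first exact: measurable_snd.
    by apply: (measurableT_comp mf); apply: (measurableT_comp mX'); exact: measurable_fst.
  by rewrite setTI.
have := @measurable_fun_ysection _ _ _ _ _ m' _ mE.
by apply: eq_measurable_fun => s _; congr (m' _); apply/seteqP; split => x; rewrite /ysection/= ?inE//= => h; rewrite inE.
Qed.

End LayerCake.

(** * Expectation of a product of independent factors *)

Section Independence.
Context (R : realType) (d : measure_display) (T : measurableType d).
Context (P : probability T R).

Let p (A : set T) : R := fine (P A).

Let pE A : measurable A -> P A = (p A)%:E.
Proof. by move=> mA; rewrite fineK// fin_num_measure. Qed.

(** Independence is stated for events, that is for products of indicators. The indicators are
    replaced by the functions [f i] one index at a time. *)
Lemma expectation_prod_indep (I : finType) (Z : I -> {RV P >-> R}) (f : I -> R -> R) (c : I -> R) :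
  mutually_independent Z -> (forall i, measurable_fun setT (f i)) ->
  (forall i x, 0 <= f i x) ->
  (forall i, \int[P]_w (f i (Z i w))%:E = (c i)%:E)%E ->
  (\int[P]_w (\prod_i f i (Z i w))%:E = (\prod_i c i)%:E)%E.
Proof.
move=> iZ mf f0 cE.
have c0 i : 0 <= c i by rewrite -lee_fin -cE; apply: integral_ge0 => w _; rewrite lee_fin.
(* The hybrid product: indices in [s] already carry [f i], the others still carry the indicator of
   [B i]; [e] is the corresponding product of expectations. *)
pose g (s : seq I) B i : R -> R := if i \in s then f i else \1_(B i).
pose e (s : seq I) B i : R := if i \in s then c i else p (Z i @^-1` B i).
have mZ i B : measurable B -> measurable (Z i @^-1` B).
  by move=> mB; rewrite -[X in measurable X]setTI; exact: (measurable_funP (Z i)).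
suff H s : uniq s -> forall B : I -> set R, (forall i, measurable (B i)) ->
    (\int[P]_w (\prod_i g s B i (Z i w))%:E = (\prod_i e s B i)%:E)%E.
  have := H (enum I) (enum_uniq _) (fun=> setT) (fun=> measurableT).
  rewrite (eq_integral (fun w => (\prod_i f i (Z i w))%:E)) => [->|w _].
    by congr EFin; apply: eq_bigr => i _; rewrite /e mem_enum.
  by congr EFin; apply: eq_bigr => i _; rewrite /g mem_enum.
elim: s => [_ B mB|j s IH /= /andP[js us] B mB].
  have -> : (\prod_i e [::] B i)%:E = (\prod_(i in finset.setT) P (Z i @^-1` B i))%E.
    rewrite (big_morph _ (@EFinM R) erefl); apply: eq_big => [i|i _].
      by rewrite finset.in_setT.
    by rewrite pE//; exact: mZ.
  rewrite -(iZ finset.setT B mB).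
  set A := [set w | _].
  have mA : measurable A.
    rewrite (_ : A = \bigcap_(i in [set: I]) (Z i @^-1` B i)).
      by apply: fin_bigcap_measurable => // i _; exact: mZ.
    apply/seteqP; split => w /= h i; first by move=> _; apply: h; rewrite finset.in_setT.
    by move=> _; exact: h.
  rewrite -(setIT A) -integral_indic//; apply: eq_integral => w _; congr EFin.
  rewrite /g/= indicE; case: (boolP (w \in A)) => [/set_mem wA|wA].
    by rewrite big1// => i _; rewrite indicE mem_set//; apply: wA; rewrite finset.in_setT.
  have [i iB] : exists i, ~ B i (Z i w).
    apply: contrapT => /forallNP h; move/negP: wA; apply; apply/mem_set => i _.
    by have := h i; rewrite notK.
  by rewrite (bigD1 i)//= indicE memNset// mul0r.
pose H w := \prod_(i | i != j) g s B i (Z i w).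
pose K := \prod_(i | i != j) e s B i.
have gE i : i != j -> g (j :: s) B i = g s B i.
  by move=> ij; rewrite /g inE (negbTE ij).
have eE i : i != j -> e (j :: s) B i = e s B i.
  by move=> ij; rewrite /e inE (negbTE ij).
rewrite (eq_integral (fun w => (H w * f j (Z j w))%:E)); last first.
  move=> w _; rewrite (bigD1 j)//= mulrC; congr (EFin (_ * _)).
    by apply: eq_bigr => i ij; rewrite gE.
  by rewrite /g mem_head.
rewrite (bigD1 j)//= {1}/e mem_head mulrC.
rewrite (eq_bigr (e s B)); last by move=> i ij; rewrite eE.
have mg B' i : (forall k, measurable (B' k)) -> measurable_fun setT (g s B' i).
  by move=> mB'; rewrite /g; case: ifP => // _; exact: measurable_indic.
rewrite -/K EFinM -cE; apply: integral_transfer => //.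
- rewrite /H; under eq_fun do rewrite -big_filter.
  by apply: measurable_fun_prodr => i; apply: measurableT_comp => //; exact: mg.
- move=> w; apply: prodr_ge0 => i _; rewrite /g; case: ifP => _; first exact: f0.
  by rewrite indicE ler0n.
- by apply: prodr_ge0 => i _; rewrite /e; case: ifP => // _; exact: fine_ge0.
(* The induction hypothesis with [A] placed at index [j] integrates the remaining factors over the
   event that [Z j] lies in [A], which is what [integral_transfer] asks for. *)
- move=> A mA; pose B' i := if i == j then A else B i.
  have mB' i : measurable (B' i) by rewrite /B'; case: ifP.
  have := IH us B' mB'; rewrite (bigD1 j)//= {1}/e (negbTE js) /B' eqxx -/B'.
  rewrite (eq_bigr (e s B)); last by move=> i ij; rewrite /e /B' (negbTE ij).
  rewrite -/K mulrC EFinM -pE; last exact: mZ.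
  move=> <-; apply: eq_integral => w _; congr EFin.
  rewrite [RHS](bigD1 j)//= mulrC; congr (_ * _); first by rewrite /g (negbTE js) /B' eqxx.
  by apply: eq_bigr => i ij; rewrite /g /B' (negbTE ij).
Qed.

End Independence.

(** * Gaussian noise *)

Section LebesgueTuple.
Context (R : realType).
Notation mu := (@lebesgue_measure R).

Lemma integral_lebesgue_tuple_prod k (f : 'I_k -> R -> R) (c : 'I_k -> R) :
  (forall i, measurable_fun setT (f i)) -> (forall i x, 0 <= f i x) ->
  (forall i, \int[mu]_x (f i x)%:E = (c i)%:E)%E ->
  (\int[@lebesgue_tuple R k]_b (\prod_i f i (tnth b i))%:E = (\prod_i c i)%:E)%E.
Proof.
elim: k f c => [|k IH] f c mf f0 cE.
  have h := @integral_dirac _ (0.-tuple R) [tuple] R setT measurableT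
    (fun b => (\prod_i f i (tnth b i))%:E).
  apply: etrans (h _) _; last by rewrite diracT mul1e !big_ord0.
  by under eq_fun do rewrite big_ord0; exact: measurable_cst.
have mcons : measurable_fun setT (@cons_pair R k).
  by apply: measurable_cons; [exact: measurable_fst|exact: measurable_snd].
have mprod m (g : 'I_m -> R -> R) : (forall i, measurable_fun setT (g i)) ->
    measurable_fun setT (fun b : m.-tuple R => (\prod_i g i (tnth b i))%:E).
  move=> mg; apply/measurable_EFinP; apply: measurable_fun_prodr => i.
  by apply: measurableT_comp => //; exact: measurable_tnth.
have p0 m (g : 'I_m -> R -> R) b : (forall i x, 0 <= g i x) ->
    (0 <= (\prod_i g i (tnth b i))%:E)%E.
  by move=> g0; rewrite lee_fin; apply: prodr_ge0.
pose m2 : {measure set (measurableTypeR R * k.-tuple R) -> \bar R} :=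
  (mu \x @lebesgue_tuple R k)%E.
have h := @ge0_integral_pushforward _ _ (measurableTypeR R * k.-tuple R)%type
  (k.+1.-tuple R) R _ mcons m2 setT (fun b => (\prod_i f i (tnth b i))%:E)
  measurableT (mprod _ _ mf) (fun b _ => p0 _ f b f0).
apply: etrans h _; rewrite preimage_setT.
pose F (z : R * k.-tuple R) : \bar R :=
  (f ord0 z.1 * \prod_i f (lift ord0 i) (tnth z.2 i))%:E.
rewrite (_ : _ \o _ = F); last first.
  apply/funext => z; rewrite /F/= big_ord_recl; congr (EFin (_ * _)).
  by apply: eq_bigr => i _; rewrite tnthS.
rewrite fubini_tonelli1.
- rewrite /fubini_F/F/=.
  have IHc := IH (fun i => f (lift ord0 i)) (fun i => c (lift ord0 i)) (fun i => mf _)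
     (fun i => f0 _) (fun i => cE _).
  under eq_integral => x _.
    under eq_integral do rewrite EFinM.
    rewrite ge0_integralZl_EFin//; last 2 first.
    - by move=> b _; exact: (p0 _ (fun i => f (lift ord0 i))).
    - exact: (mprod _ (fun i => f (lift ord0 i))).
    rewrite IHc -EFinM mulrC EFinM; over.
  rewrite ge0_integralZl_EFin//.
  + by rewrite cE -EFinM big_ord_recl mulrC.
  + by move=> x _; rewrite lee_fin.
  + by apply/measurable_EFinP; exact: (mf ord0).
  + by apply: prodr_ge0 => i _; rewrite -lee_fin -cE; apply: integral_ge0 => x _; rewrite lee_fin.
- apply/measurable_EFinP; apply: measurable_funM.
    by apply: measurableT_comp => //; exact: measurable_fst.
  apply: measurable_fun_prodr => i; apply: measurableT_comp => //.
  by apply: (measurableT_comp (measurable_tnth i)); exact: measurable_snd.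
- by move=> z; rewrite lee_fin mulr_ge0//; apply: prodr_ge0.
Qed.

Lemma normal_pdf_expR (m s x : R) : 0 < s ->
  normal_pdf m s x = normal_peak s * expR (- (x - m) ^+ 2 / (s ^+ 2 *+ 2)).
Proof. by move=> s0; rewrite normal_pdfE// gt_eqF. Qed.

Lemma measurable_expR_sqr (a m : R) :
  measurable_fun setT (fun x : R => expR (- (a * (x - m) ^+ 2))).
Proof.
apply: measurableT_comp; first exact: measurable_expR.
apply: measurableT_comp => //; apply: measurable_funM; first exact: measurable_cst.
by apply: measurable_funX; apply: measurable_funB => //; exact: measurable_cst.
Qed.

Lemma measurable_expR_quad (c s : R) :
  measurable_fun setT (fun x : R => expR (c * x ^+ 2 / s)).
Proof.
apply: measurableT_comp; first exact: measurable_expR.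
apply: measurable_funM; last exact: measurable_cst.
apply: measurable_funM; first exact: measurable_cst.
by apply: measurable_funX.
Qed.

Lemma measurable_expR_lin (c : R) : measurable_fun setT (fun x : R => expR (c * x)).
Proof.
apply: measurableT_comp; first exact: measurable_expR.
by apply: measurable_funM; first exact: measurable_cst.
Qed.

Lemma integral_expR_sqr (a m : R) : 0 < a ->
  (\int[mu]_x (expR (- (a * (x - m) ^+ 2)))%:E = (Num.sqrt (pi / a))%:E)%E.
Proof.
move=> a0; have pi0 := pi_gt0 R; pose s := Num.sqrt ((2 * a)^-1).
have a20 : 0 < (2 * a)^-1 by rewrite invr_gt0 mulr_gt0.
have s0 : s != 0 by rewrite gt_eqF// sqrtr_gt0.
have sE : s ^+ 2 = (2 * a)^-1 by rewrite sqr_sqrtr// ltW.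
have pE x : expR (- (a * (x - m) ^+ 2)) = Num.sqrt (pi / a) * normal_pdf m s x.
  rewrite normal_pdfE// /normal_peak /normal_fun sE.
  rewrite (_ : (2 * a)^-1 * pi *+ 2 = pi / a); last by field; rewrite gt_eqF.
  rewrite mulVKf; last by rewrite gt_eqF// sqrtr_gt0 divr_gt0.
  by congr expR; field; rewrite gt_eqF.
under eq_integral do rewrite pE EFinM.
rewrite ge0_integralZl_EFin//.
- by rewrite integral_normal_pdf mule1.
- by move=> x _; rewrite lee_fin normal_pdf_ge0.
- by apply/measurable_EFinP; exact: measurable_normal_pdf.
Qed.

Lemma integral_normal_expR_sqr (s c : R) : 0 < s -> c < 2^-1 ->
  (\int[mu]_x (normal_pdf 0 s x * expR (c * x ^+ 2 / s ^+ 2))%:E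
   = ((Num.sqrt (1 - 2 * c))^-1)%:E)%E.
Proof.
move=> s0 c1; have pi0 := pi_gt0 R.
pose a := (1 - 2 * c) / (2 * s ^+ 2).
have s20 : 0 < s ^+ 2 by rewrite exprn_gt0.
have a0 : 0 < a by rewrite divr_gt0 ?mulr_gt0//; lra.
have pE x : normal_pdf 0 s x * expR (c * x ^+ 2 / s ^+ 2) =
    normal_peak s * expR (- (a * (x - 0) ^+ 2)).
  rewrite normal_pdf_expR// -[LHS]mulrA -expRD; congr (_ * expR _).
  by rewrite /a; field; rewrite gt_eqF.
under eq_integral do rewrite pE EFinM.
rewrite ge0_integralZl_EFin ?normal_peak_ge0//.
- rewrite integral_expR_sqr// -EFinM; congr EFin.
  have h : 0 < s ^+ 2 * pi *+ 2 by rewrite mulrn_wgt0// mulr_gt0.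
  have d0 : 0 < 1 - 2 * c by lra.
  have -> : pi / a = (s ^+ 2 * pi *+ 2) * (1 - 2 * c)^-1 by rewrite /a; field; rewrite !gt_eqF.
  rewrite sqrtrM ?ltW// mulrA /normal_peak mulVf ?gt_eqF ?sqrtr_gt0// mul1r.
  by rewrite sqrtrV// ltW.
- by apply/measurable_EFinP; exact: measurable_expR_sqr.
Qed.

Lemma integral_normal_expR (s z : R) : 0 < s ->
  (\int[mu]_x (normal_pdf 0 s x * expR (z * x))%:E
   = (expR (s ^+ 2 * z ^+ 2 / 2))%:E)%E.
Proof.
move=> s0; have s20 : 0 < s ^+ 2 by rewrite exprn_gt0.
have pE x : normal_pdf 0 s x * expR (z * x) =
    expR (s ^+ 2 * z ^+ 2 / 2) * normal_pdf (s ^+ 2 * z) s x.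
  rewrite !normal_pdf_expR// -[LHS]mulrA [RHS]mulrCA -!expRD; congr (_ * expR _).
  by field; rewrite gt_eqF.
under eq_integral do rewrite pE EFinM.
rewrite ge0_integralZl_EFin ?expR_ge0//.
- by rewrite integral_normal_pdf mule1.
- by move=> x _; rewrite lee_fin normal_pdf_ge0.
- by apply/measurable_EFinP; exact: measurable_normal_pdf.
Qed.

End LebesgueTuple.

Section GaussianNoise.
Context (R : realType) (d : measure_display) (T : measurableType d).
Context (P : probability T R) (n : nat) (Z : 'I_n -> {RV P >-> R}) (s : R).
Hypotheses (s0 : 0 < s) (iidZ : iid_normal Z s).
Notation mu := (@lebesgue_measure R).

Definition noise_vec (w : T) : 'cV[R]_n := \col_i Z i w.

Lemma noise_expectation i (f : R -> R) : measurable_fun setT f -> (forall x, 0 <= f x) ->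
  (\int[P]_w (f (Z i w))%:E = \int[mu]_x (normal_pdf 0 s x * f x)%:E)%E.
Proof.
move=> mf f0.
have := @integral_transfer R _ _ _ _ mu P (normal_pdf 0 s) id (Z i) 1 f.
rewrite mul1e => -> //.
- exact: measurable_normal_pdf.
- by move=> x; exact: normal_pdf_ge0.
- move=> A mA; rewrite mul1e; have [_ /(_ i A mA)] := iidZ.
  move=> h; apply: etrans _ (esym h); rewrite /normal_prob [RHS]integral_mkcond.
  apply: eq_integral => x _; rewrite /patch indicE; case: ifPn => _; first by rewrite mulr1.
  by rewrite mulr0.
Qed.

Lemma noise_expectation_prod (f : 'I_n -> R -> R) (c : 'I_n -> R) :
  (forall i, measurable_fun setT (f i)) -> (forall i x, 0 <= f i x) ->
  (forall i, \int[mu]_x (normal_pdf 0 s x * f i x)%:E = (c i)%:E)%E ->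
  (\int[P]_w (\prod_i f i (Z i w))%:E = (\prod_i c i)%:E)%E.
Proof.
move=> mf f0 cE; apply: expectation_prod_indep => //; first by case: iidZ.
by move=> i; rewrite noise_expectation.
Qed.

Lemma markov_exp (X : T -> R) (M x : R) : measurable_fun setT X ->
  (\int[P]_w (expR (X w))%:E <= M%:E)%E ->
  (P [set w | (x < X w)%R] <= (M * expR (- x))%:E)%E.
Proof.
move=> mX hM.
have mE : measurable [set w | x < X w].
  by rewrite -[X in measurable X]setTI; exact: (measurable_fun_ltr (measurable_cst x) mX).
have := @integral_ge_subset _ _ _ P setT _ (fun w => (expR (X w))%:E) (expR x)%:E mE.
have e0 := expR_gt0 x.
move=> /(_ (@subsetT _ _)) h.
have {}h : ((expR x)%:E * P [set w | (x < X w)%R] <= M%:E)%E.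
  apply: le_trans hM; apply: h.
  - by rewrite lee_fin ltW.
  - by move=> w _; rewrite lee_fin expR_ge0.
  - by move=> w /= /ltW; rewrite lee_fin ler_expR.
have fP : P [set w | x < X w] \is a fin_num by exact: fin_num_measure.
move: h; rewrite -(fineK fP) -EFinM !lee_fin => h.
by rewrite expRN ler_pdivlMr// mulrC.
Qed.

Lemma measurable_noise_dot (v : 'cV[R]_n) : measurable_fun setT (fun w => dotc v (noise_vec w)).
Proof.
apply: measurable_fun_sumr => i; apply: measurable_funM; first exact: measurable_cst.
by rewrite (_ : (fun _ => _) = Z i)//; apply/funext => w; rewrite mxE.
Qed.

Lemma measurable_noise_sqn : measurable_fun setT (fun w => sqn (noise_vec w)).
Proof.
apply: measurable_fun_sumr => i; apply: measurable_funX.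
by rewrite (_ : (fun _ => _) = Z i)//; apply/funext => w; rewrite mxE.
Qed.

Lemma noise_sqn_mgf (c : R) : c < 2^-1 ->
  (\int[P]_w (expR (c * sqn (noise_vec w) / s ^+ 2))%:E
   = ((Num.sqrt (1 - 2 * c)) ^- n)%:E)%E.
Proof.
move=> c1.
under eq_integral => w _.
  rewrite (_ : expR _ = \prod_i expR (c * Z i w ^+ 2 / s ^+ 2)); first over.
  rewrite -expR_sum mulr_sumr mulr_suml; congr expR.
  by apply: eq_bigr => i _; rewrite mxE.
rewrite (@noise_expectation_prod (fun i x => expR (c * x ^+ 2 / s ^+ 2))
  (fun=> (Num.sqrt (1 - 2 * c))^-1)).
- by rewrite prodr_const card_ord exprVn.
- by move=> i; exact: measurable_expR_quad.
- by move=> i x; exact: expR_ge0.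
- by move=> i; exact: integral_normal_expR_sqr.
Qed.

Lemma noise_dot_mgf (v : 'cV[R]_n) :
  (\int[P]_w (expR (dotc v (noise_vec w)))%:E = (expR (s ^+ 2 * sqn v / 2))%:E)%E.
Proof.
under eq_integral => w _.
  rewrite (_ : expR _ = \prod_i expR (v i 0 * Z i w)); first over.
  by rewrite -expR_sum; congr expR; apply: eq_bigr => i _; rewrite mxE.
rewrite (@noise_expectation_prod (fun i x => expR (v i 0 * x))
  (fun i => expR (s ^+ 2 * v i 0 ^+ 2 / 2))).
- by rewrite -expR_sum mulr_sumr mulr_suml.
- by move=> i; exact: measurable_expR_lin.
- by move=> i x; exact: expR_ge0.
- by move=> i; exact: integral_normal_expR.
Qed.

(* Linearising the square, [exp (c y^2)] is the mean of [exp (sqrt (2 c) y z)]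
   over a standard normal [z], so no rotation invariance is needed. *)
Lemma noise_proj_mgf m (Q : 'M[R]_(n, m)) (c : R) : Q^T *m Q = 1%:M ->
  0 <= c -> c < 2^-1 ->
  (\int[P]_w (expR (c * sqn (Q^T *m noise_vec w) / s ^+ 2))%:E
   = ((Num.sqrt (1 - 2 * c)) ^- m)%:E)%E.
Proof.
(* This [a] makes [(a y)^2 / 2 = c y^2 / s^2], the exponent produced by averaging [expR (a y z)]
   over [z]. Integrating the noise first gives [s^2 a^2 |Q z|^2 / 2 = c |z|^2] instead, because [Q]
   preserves norms. *)
move=> QQ c0 c1; pose a := Num.sqrt (2 * c) / s.
have aE : a ^+ 2 * s ^+ 2 = 2 * c.
  by rewrite exprMn exprVn sqr_sqrtr ?mulr_ge0// divfK// expf_neq0// gt_eqF.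
pose y w j := (Q^T *m noise_vec w) j 0.
pose zv (z : m.-tuple R) : 'cV[R]_m := \col_j tnth z j.
pose F (x : T * m.-tuple R) : \bar R :=
  (\prod_j (normal_pdf 0 1 (tnth x.2 j) * expR (a * y x.1 j * tnth x.2 j)))%:E.
have my j : measurable_fun setT (fun w => y w j).
  rewrite (_ : (fun _ => _) = (fun w => dotc (col j Q) (noise_vec w))).
    exact: measurable_noise_dot.
  by apply/funext => w; rewrite /y mxE; apply: eq_bigr => i _; rewrite !mxE.
have mF : measurable_fun setT F.
  apply/measurable_EFinP; apply: measurable_fun_prodr => j.
  have mt : measurable_fun setT (fun x : T * m.-tuple R => tnth x.2 j).
    by apply: (measurableT_comp (measurable_tnth j)); exact: measurable_snd.
  apply: measurable_funM.
    by apply: measurableT_comp => //; exact: measurable_normal_pdf.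
  apply: measurableT_comp; first exact: measurable_expR.
  apply: measurable_funM => //; apply: measurable_funM => //.
  by apply: (measurableT_comp (my j)); exact: measurable_fst.
have F0 x : (0 <= F x)%E.
  by rewrite lee_fin; apply: prodr_ge0 => j _; rewrite mulr_ge0 ?normal_pdf_ge0 ?expR_ge0.
transitivity (\int[P]_w \int[@lebesgue_tuple R m]_z F (w, z))%E.
  apply: eq_integral => w _; rewrite /F/=.
  rewrite (@integral_lebesgue_tuple_prod R m
    (fun j x => normal_pdf 0 1 x * expR (a * y w j * x))
    (fun j => expR (1 ^+ 2 * (a * y w j) ^+ 2 / 2))).
  - congr EFin; rewrite -expR_sum; congr expR.
    rewrite /sqn mulr_sumr mulr_suml; apply: eq_bigr => j _.
    rewrite exprMn expr1n mul1r -/(y w j).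
    have -> : c = a ^+ 2 * s ^+ 2 / 2 by rewrite aE mulrC mulKf.
    by field; rewrite gt_eqF.
  - move=> j; apply: measurable_funM; first exact: measurable_normal_pdf.
    exact: measurable_expR_lin.
  - by move=> j x; rewrite mulr_ge0 ?normal_pdf_ge0 ?expR_ge0.
  - by move=> j; exact: integral_normal_expR.
apply: etrans (fubini_tonelli (m1 := P) (m2 := @lebesgue_tuple R m) F mF F0) _.
transitivity (\int[@lebesgue_tuple R m]_z
   (\prod_j (normal_pdf 0 1 (tnth z j) * expR (c * tnth z j ^+ 2 / 1 ^+ 2)))%:E)%E.
  apply: eq_integral => z _; rewrite /F/=.
  under eq_integral => w _.
    rewrite big_split/= -expR_sum.
    rewrite (_ : \sum_j _ = dotc (a *: (Q *m zv z)) (noise_vec w)); last first.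
      rewrite dotcZl dotc_mull dotcC mulr_sumr; apply: eq_bigr => j _.
      by rewrite /y !mxE mulrA.
    rewrite EFinM; over.
  rewrite ge0_integralZl_EFin//.
  - rewrite noise_dot_mgf -EFinM; congr EFin.
    rewrite big_split/=; congr (_ * _); rewrite -expR_sum; congr expR.
    rewrite sqnZ [sqn (Q *m _)]sqnE dotc_mull mulmxA QQ mul1mx -sqnE.
    have -> : s ^+ 2 * (a ^+ 2 * sqn (zv z)) / 2 = c * sqn (zv z).
      by rewrite mulrA [s ^+ 2 * _]mulrC aE; field.
    by rewrite /sqn mulr_sumr; apply: eq_bigr => j _; rewrite mxE expr1n divr1.
  - apply/measurable_EFinP; apply: measurableT_comp; first exact: measurable_expR.
    exact: measurable_noise_dot.
  - by apply: prodr_ge0 => j _; exact: normal_pdf_ge0.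
rewrite (@integral_lebesgue_tuple_prod R m
    (fun j x => normal_pdf 0 1 x * expR (c * x ^+ 2 / 1 ^+ 2))
    (fun=> (Num.sqrt (1 - 2 * c))^-1)).
- by rewrite prodr_const card_ord exprVn.
- move=> j; apply: measurable_funM; first exact: measurable_normal_pdf.
  exact: measurable_expR_quad.
- by move=> j x; rewrite mulr_ge0 ?normal_pdf_ge0 ?expR_ge0.
- by move=> j; exact: integral_normal_expR_sqr.
Qed.

End GaussianNoise.

(** * The pMOM density *)

Section Extension.
Context (R : realType) (n p : nat).
Implicit Types (X : 'M[R]_(n, p)) (A : 'M[R]_p) (k : {set 'I_p}).

(** The sum has at most one term: it inverts [enum_val] without a proof that [i] belongs to [k], and
    gives 0 off [k]. *)
Definition ext_col k (v : 'cV[R]_#|k|) : 'cV[R]_p :=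
  \col_i \sum_(j | enum_val j == i) v j 0.

Lemma ext_col_enum_val k (v : 'cV[R]_#|k|) j : ext_col v (enum_val j) 0 = v j 0.
Proof.
rewrite mxE (big_pred1 j)// => l.
by apply/eqP/eqP => [/enum_val_inj|->].
Qed.

Lemma ext_col_supported k (v : 'cV[R]_#|k|) : supported k (ext_col v).
Proof.
move=> i ik; rewrite mxE big_pred0// => j; apply/negbTE; apply: contra ik => /eqP <-.
exact: enum_valP.
Qed.

Lemma ext_colK k (v : 'cV[R]_#|k|) : restr_col k (ext_col v) = v.
Proof. by apply/colP => j; rewrite mxE ext_col_enum_val. Qed.

Lemma sqn_ext_col k (v : 'cV[R]_#|k|) : sqn (ext_col v) = sqn v.
Proof. by rewrite -(sqn_restr_col (@ext_col_supported k v)) ext_colK. Qed.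

Lemma design_sub_ext X k v : design_sub X k *m v = X *m @ext_col k v.
Proof. by rewrite -(design_sub_mulE X (@ext_col_supported k v)) ext_colK. Qed.

Lemma principal_sub_qform A k v :
  dotc v (principal_sub A k *m v) = dotc (@ext_col k v) (A *m ext_col v).
Proof.
set w := ext_col v; have wE j : v j 0 = w (enum_val j) 0 by rewrite ext_col_enum_val.
have kw : supported k w by exact: ext_col_supported.
clearbody w.
have sumE (F : 'I_p -> R) : (forall i, i \notin k -> F i = 0) ->
    \sum_(j < #|k|) F (enum_val j) = \sum_i F i.
  move=> Fk; rewrite [RHS](bigID (mem k))/= [X in _ + X]big1 ?addr0//.
  by rewrite [RHS]big_enum_val.
rewrite /dotc -(sumE (fun i => w i 0 * (A *m w) i 0)); last first.
  by move=> i ik; rewrite kw// mul0r.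
apply: eq_bigr => j _; rewrite wE !mxE; congr (_ * _).
rewrite -(sumE (fun l => A (enum_val j) l * w l 0)); last first.
  by move=> i ik; rewrite kw// mulr0.
by apply: eq_bigr => l _; rewrite wE !mxE.
Qed.

End Extension.

Lemma integral_lebesgue_tuple_box (R : realType) m (l u : 'I_m -> R) (c : R) (f : m.-tuple R -> R) :
  (forall i, l i <= u i) -> 0 <= c -> (forall b : m.-tuple R, 0 <= f b) ->
  (forall b : m.-tuple R, (forall i, l i <= tnth b i <= u i) -> c <= f b) ->
  ((c * \prod_i (u i - l i))%:E <= \int[@lebesgue_tuple R m]_b (f b)%:E)%E.
Proof.
move=> lu c0 f0 cf.
pose g i x : R := \1_(`[l i, u i]%classic : set R) x.
have gE : (\int[@lebesgue_tuple R m]_b (\prod_i g i (tnth b i))%:E = (\prod_i (u i - l i))%:E)%E.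
  apply: integral_lebesgue_tuple_prod => [i|i x|i].
  - by apply: measurable_indic; exact: measurable_itv.
  - by rewrite /g indicE ler0n.
  - rewrite integral_indic//= setIT.
    have e : @lebesgue_measure R `[l i, u i]%classic = (u i - l i)%:E.
      rewrite lebesgue_measure_itv/= lte_fin; case: ltrP => [//|h].
      by congr EFin; have := lu i; lra.
    exact: e.
have mg : measurable_fun setT (fun b : m.-tuple R => \prod_i g i (tnth b i)).
  apply: measurable_fun_prodr => i; apply: measurableT_comp; last exact: measurable_tnth.
  by apply: measurable_indic; exact: measurable_itv.
have g0 (b : m.-tuple R) : 0 <= \prod_i g i (tnth b i) by apply: prodr_ge0 => i _; rewrite /g indicE ler0n.
rewrite EFinM -gE -ge0_integralZl_EFin//; first last.
- exact/measurable_EFinP.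
- by move=> b _; rewrite lee_fin.
apply: integral_mono => b _; rewrite -?EFinM lee_fin ?mulr_ge0//.
have [h|h] := pselect (forall i, l i <= tnth b i <= u i).
  apply: le_trans (cf b h); rewrite ler_piMr//.
  rewrite big1// => i _; rewrite /g indicE mem_set//=.
  by have := h i; rewrite in_itv.
have [i hi] : exists i, ~ (l i <= tnth b i <= u i) by exact/existsNP.
by rewrite (bigD1 i)//= /g indicE memNset ?mul0r ?mulr0//=.
Qed.

Section PmomConst.
Context (R : realType) (p : nat) (A : 'M[R]_p) (a1 a2 : R) (r : nat).
Hypotheses (a1_gt0 : 0 < a1) (a2_gt0 : 0 < a2) (r_gt0 : (0 < r)%N).
Hypothesis hA : forall w : 'cV[R]_p, a1 * sqn w <= dotc w (A *m w) <= a2 * sqn w.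
Context (k : {set 'I_p}).
Notation mu := (@lebesgue_measure R).
Implicit Type b : #|k|.-tuple R.

Definition prior_qform b : R :=
  ((col_of_tuple b)^T *m principal_sub A k *m col_of_tuple b) 0 0.

Lemma prior_qformE b : prior_qform b =
  dotc (col_of_tuple b) (principal_sub A k *m col_of_tuple b).
Proof. by rewrite dotcE mulmxA. Qed.

Lemma sqn_col_of_tuple m (b : m.-tuple R) : sqn (col_of_tuple b) = \sum_j tnth b j ^+ 2.
Proof. by apply: eq_bigr => j _; rewrite mxE. Qed.

Lemma prior_qform_bounds b :
  a1 * \sum_j tnth b j ^+ 2 <= prior_qform b <= a2 * \sum_j tnth b j ^+ 2.
Proof.
by rewrite prior_qformE principal_sub_qform -sqn_col_of_tuple -sqn_ext_col hA.
Qed.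

Lemma det_principal_sub_gt0 : 0 < \det (principal_sub A k).
Proof.
apply: mx_posdef_det_gt0 => v v0; rewrite principal_sub_qform.
have /andP[h _] := hA (ext_col v); apply: lt_le_trans h.
by rewrite mulr_gt0// sqn_ext_col lt_def sqn_eq0 v0 sqn_ge0.
Qed.

Lemma measurable_prior_qform : measurable_fun setT prior_qform.
Proof.
have -> : prior_qform = fun b => \sum_i tnth b i * \sum_j principal_sub A k i j * tnth b j.
  apply/funext => b; rewrite prior_qformE; apply: eq_bigr => i _; rewrite !mxE.
  by congr (_ * _); apply: eq_bigr => j _; rewrite !mxE.
apply: measurable_fun_sumr => i; apply: measurable_funM; first exact: measurable_tnth.
apply: measurable_fun_sumr => j; apply: measurable_funM; first exact: measurable_cst.
exact: measurable_tnth.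
Qed.

(** The kernel at [v = 1] without its power of [2 pi] and its determinant, two constants that cancel
    against the normalising integral. *)
Definition pmom_shape b : R :=
  expR (- (prior_qform b / 2)) * \prod_(i < #|k|) tnth b i ^+ (2 * r).

Definition pmom_mass : R := \int[@lebesgue_tuple R #|k|]_b pmom_shape b.

Lemma prod_pow_even_ge0 m (b : m.-tuple R) : 0 <= \prod_(i < m) tnth b i ^+ (2 * r).
Proof. by apply: prodr_ge0 => i _; rewrite exprM exprn_ge0// sqr_ge0. Qed.

Lemma pmom_shape_ge0 b : 0 <= pmom_shape b.
Proof. by rewrite mulr_ge0 ?expR_ge0 ?prod_pow_even_ge0. Qed.

Lemma measurable_prod_pow m :
  measurable_fun setT (fun b : m.-tuple R => \prod_(i < m) tnth b i ^+ (2 * r)).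
Proof.
apply: measurable_fun_prodr => i; apply: measurable_funX.
exact: measurable_tnth.
Qed.

Lemma measurable_pmom_shape : measurable_fun setT pmom_shape.
Proof.
apply: measurable_funM; last exact: measurable_prod_pow.
apply: measurableT_comp; first exact: measurable_expR.
apply: measurableT_comp => //; apply: measurable_funM; last exact: measurable_cst.
exact: measurable_prior_qform.
Qed.

Lemma pow_even_le_expR (x s : R) : 0 < s ->
  x ^+ (2 * r) <= (r%:R / s) ^+ r * expR (s * x ^+ 2).
Proof.
move=> s0; have [->|x0] := eqVneq x 0.
  rewrite expr0n muln_eq0/= gtn_eqF// mulr_ge0 ?expR_ge0// exprn_ge0//.
  by rewrite divr_ge0// ltW.
have x20 : 0 < x ^+ 2 by rewrite exprn_even_gt0.
have := @powR_expR_le R r%:R s (x ^+ 2) (ler0n _ _) s0 x20.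
have rs0 : 0 <= r%:R / s by rewrite divr_ge0// ltW.
rewrite (powR_mulrn _ rs0) (powR_mulrn _ (ltW x20)) expRN ler_pdivrMr ?expR_gt0//.
by rewrite exprM.
Qed.

(** Cost per coordinate of the box [[1, 2]], where the quadratic form is at most [4 a2] per
    coordinate and the monomial is at least 1. *)
Definition pmom_lo : R := expR (- (2 * a2)).
Definition pmom_hi : R := (r%:R / (a1 / 4)) ^+ r * Num.sqrt (pi / (a1 / 4)).

(** The form contributes at least [a1 / 2] times each square. Half of this absorbs [x^(2r)] and the
    other half stays as an integrable Gaussian, hence the two occurrences of [a1 / 4] in
    [pmom_hi]. *)
Lemma pmom_mass_ub :
  (\int[@lebesgue_tuple R #|k|]_b (pmom_shape b)%:E <= (pmom_hi ^+ #|k|)%:E)%E.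
Proof.
have a40 : 0 < a1 / 4 by rewrite divr_gt0.
pose f (i : 'I_#|k|) (x : R) := (r%:R / (a1 / 4)) ^+ r * expR (- (a1 / 4 * (x - 0) ^+ 2)).
apply: (@le_trans _ _ (\int[@lebesgue_tuple R #|k|]_b (\prod_i f i (tnth b i))%:E)%E).
  apply: integral_mono => b _; rewrite lee_fin ?pmom_shape_ge0//.
  have -> : \prod_i f i (tnth b i) = expR (- (a1 / 2 * \sum_i tnth b i ^+ 2)) *
     \prod_i ((r%:R / (a1 / 4)) ^+ r * expR (a1 / 4 * tnth b i ^+ 2)).
    rewrite mulr_sumr -sumrN expR_sum -big_split/=; apply: eq_bigr => i _.
    by rewrite /f subr0 [RHS]mulrCA -expRD; congr (_ * expR _); field.
  rewrite ler_pM ?expR_ge0 ?prod_pow_even_ge0//.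
    by rewrite ler_expR lerN2; have /andP[h _] := prior_qform_bounds b; lra.
  apply: ler_prod => i _; rewrite pow_even_le_expR// andbT.
  by rewrite exprM exprn_ge0// sqr_ge0.
rewrite (@integral_lebesgue_tuple_prod R _ f (fun=> pmom_hi)).
- by rewrite prodr_const card_ord.
- move=> i; apply: measurable_funM; first exact: measurable_cst.
  exact: measurable_expR_sqr.
- by move=> i x; rewrite mulr_ge0 ?expR_ge0// exprn_ge0// divr_ge0// ltW.
- move=> i; under eq_integral do rewrite EFinM.
  rewrite ge0_integralZl_EFin//.
  + by rewrite integral_expR_sqr// -EFinM.
  + by apply/measurable_EFinP; exact: measurable_expR_sqr.
  + by rewrite exprn_ge0// divr_ge0// ltW.
Qed.

Lemma pmom_mass_fin :
  (\int[@lebesgue_tuple R #|k|]_b (pmom_shape b)%:E = pmom_mass%:E)%E.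
Proof.
rewrite /pmom_mass /Rintegral fineK// ge0_fin_numE.
  exact: le_lt_trans pmom_mass_ub (ltry _).
by apply: integral_ge0 => b _; rewrite lee_fin pmom_shape_ge0.
Qed.

Lemma pmom_mass_bounds : pmom_lo ^+ #|k| <= pmom_mass <= pmom_hi ^+ #|k|.
Proof.
rewrite -!lee_fin -pmom_mass_fin pmom_mass_ub andbT.
have := @integral_lebesgue_tuple_box R #|k| (fun=> 1) (fun=> 2) (pmom_lo ^+ #|k|) pmom_shape.
rewrite (_ : \prod_i (2 - 1) = 1 :> R); last by rewrite big1// => i _; lra.
rewrite mulr1; apply.
- by move=> i; lra.
- by rewrite exprn_ge0// expR_ge0.
- exact: pmom_shape_ge0.
move=> b hb; rewrite -[leLHS]mulr1 ler_pM ?exprn_ge0 ?expR_ge0//.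
  rewrite /pmom_lo -expRM_natl ler_expR mulrN lerN2.
  have /andP[_ h] := prior_qform_bounds b.
  have : \sum_i tnth b i ^+ 2 <= #|k|%:R * 4.
    rewrite mulr_natl -[X in _ *+ X]card_ord -sumr_const; apply: ler_sum => i _.
    by have /andP[] := hb i; nra.
  move=> h2; have := ler_wpM2l (ltW a2_gt0) h2; lra.
apply: (@le_trans _ _ (\prod_(i < #|k|) 1)); first by rewrite big1.
apply: ler_prod => i _; rewrite ler01/=; apply: exprn_ege1.
by have /andP[] := hb i.
Qed.

Lemma pmom_mass_gt0 : 0 < pmom_mass.
Proof.
by have /andP[h _] := pmom_mass_bounds; apply: lt_le_trans h; rewrite exprn_gt0 ?expR_gt0.
Qed.

(** The factor [c0] occurs in the kernel and in its normalising integral. What remains of the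
    constant is [pmom_mass], which lies between two geometric sequences in [#|k|]; the determinant
    must be nonzero for the cancellation. *)
Lemma pmom_pdfE tau s2 b : pmom_pdf r A tau s2 b =
  pmom_mass^-1 * (tau * s2) `^ (- (r * #|k|)%:R - #|k|%:R / 2)
  * expR (- (prior_qform b / (2 * (tau * s2)))) * \prod_(i < #|k|) tnth b i ^+ (2 * r).
Proof.
set c0 := (2 * pi) `^ (- (#|k|%:R / 2)) * Num.sqrt (\det (principal_sub A k)).
have c0_gt0 : 0 < c0.
  by rewrite mulr_gt0 ?powR_gt0 ?mulr_gt0 ?pi_gt0// sqrtr_gt0 det_principal_sub_gt0.
have cE : pmom_const r A k = (c0 * pmom_mass)^-1.
  congr (_^-1); rewrite /Rintegral.
  rewrite (_ : (fun b : #|k|.-tuple R => _) = (fun b => (c0%:E * (pmom_shape b)%:E)%E)).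
    rewrite ge0_integralZl_EFin ?ltW//; first by rewrite pmom_mass_fin.
      by move=> b' _; rewrite lee_fin pmom_shape_ge0.
    by apply/measurable_EFinP; exact: measurable_pmom_shape.
  apply/funext => b'; rewrite -EFinM; congr EFin.
  by rewrite /pmom_kernel powR1 /pmom_shape /c0 /prior_qform !mulr1; ring.
rewrite /pmom_pdf cE /pmom_kernel -/(prior_qform b).
have := pmom_mass_gt0; set M := pmom_mass => M0; rewrite /c0 in c0_gt0 *.
set u := (2 * pi) `^ _ in c0_gt0 *; set v := Num.sqrt _ in c0_gt0 *.
have uv : u * v != 0 by rewrite gt_eqF.
have u0 : u != 0 by apply: contra_neq uv => ->; rewrite mul0r.
have v0 : v != 0 by apply: contra_neq uv => ->; rewrite mulr0.
by field; rewrite u0 v0 gt_eqF.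
Qed.

End PmomConst.

Lemma pmom_pdf_ge0 (R : realType) (p : nat) (A : 'M[R]_p) (a1 a2 : R) (r : nat)
    (k : {set 'I_p}) tau s2 b : 0 < a1 -> 0 < a2 -> (0 < r)%N ->
  (forall w : 'cV[R]_p, a1 * sqn w <= dotc w (A *m w) <= a2 * sqn w) ->
  0 <= pmom_pdf (k := k) r A tau s2 b.
Proof.
move=> a10 a20 r0 hA; rewrite (pmom_pdfE a10 a20 r0 hA).
rewrite !mulr_ge0 ?powR_ge0 ?expR_ge0 ?prod_pow_even_ge0// invr_ge0 ltW//.
exact: pmom_mass_gt0 a10 a20 r0 hA k.
Qed.

(** Inversion is written as [x] times a real power of [x^2]; this formula also takes the value 0 at
    0. *)
Lemma measurable_inv (R : realType) : measurable_fun setT (fun x : R => x^-1).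
Proof.
have -> : (fun x : R => x^-1) = (fun x => x * (x ^+ 2) `^ (-1)).
  apply/funext => x; rewrite powR_inv1 ?sqr_ge0// expr2.
  by have [->|x0] := eqVneq x 0; [rewrite invr0 mul0r|rewrite invfM mulrA divff ?mul1r].
apply: measurable_funM => //; apply: (measurableT_comp (measurable_powR (-1))).
exact: measurable_funX.
Qed.

Section MarginalPieces.
Context (R : realType).
Implicit Types (a s x z : R).
Notation mu := (@lebesgue_measure R).

Lemma sqrt_expN z n : 0 < z -> (Num.sqrt z) ^- n = expR (- (n%:R / 2 * ln z)).
Proof.
move=> z0; rewrite expRN; congr (_^-1); rewrite -{1}(lnK z0) -powR12_sqrt ?expR_ge0//.
by rewrite -expRM -expRM_natl; congr expR; field.
Qed.

Lemma likelihoodE n p (X : 'M[R]_(n, p)) (k : {set 'I_p}) y (b : #|k|.-tuple R) s2 : 0 < s2 ->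
  likelihood X y b s2 = expR (- (n%:R / 2 * ln (2 * pi * s2))
    - sqn (y - design_sub X k *m col_of_tuple b) / (2 * s2)).
Proof.
move=> s0; have q0 : 0 < Num.sqrt s2 by rewrite sqrtr_gt0.
have z0 : 0 < 2 * pi * s2 by rewrite !mulr_gt0 ?pi_gt0.
rewrite /likelihood; under eq_bigr do rewrite normal_pdf_expR//.
rewrite big_split/= prodr_const card_ord -expR_sum expRD -sqrt_expN//.
rewrite /normal_peak sqr_sqrtr ?ltW// exprVn; congr (_ ^- _ * expR _).
  by congr Num.sqrt; ring.
rewrite -mulNr -sumrN mulr_suml; apply: eq_bigr => i _.
by rewrite !mxE mulr_natl.
Qed.

Lemma ln_leB1 z : 0 < z -> ln z <= z - 1.
Proof.
by move=> z0; have := @le_ln1Dx R (z - 1); rewrite addrCA subrr addr0; apply; lra.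
Qed.

(** The Gaussian log-likelihood with residual sum of squares [s], maximised over the variance; the
    maximum is at [s / n]. *)
Definition log_peak n s : R := - (n%:R / 2 * (ln (2 * pi) + ln (s / n%:R) + 1)).

Lemma gauss_sup n s x : (0 < n)%N -> 0 < s -> 0 < x ->
  - (n%:R / 2 * ln (2 * pi * x)) - s / (2 * x) <= log_peak n s.
Proof.
move=> n0 s0 x0; have n0' : 0 < (n%:R : R) by rewrite ltr0n.
have p0 : 0 < 2 * pi :> R by rewrite mulr_gt0 ?pi_gt0.
have z0 : 0 < s / n%:R by rewrite divr_gt0.
have h : ln (s / n%:R) - ln x <= s / n%:R / x - 1.
  by rewrite -ln_div ?posrE//; apply: ln_leB1; rewrite divr_gt0.
rewrite /log_peak (lnM p0 x0).
have -> : s / (2 * x) = n%:R / 2 * (s / n%:R / x) by field; rewrite !gt_eqF.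
have : n%:R / 2 * (ln (s / n%:R) - ln x) <= n%:R / 2 * (s / n%:R / x - 1).
  by rewrite ler_wpM2l// divr_ge0.
by lra.
Qed.

(** The square of [x] is at most four times the larger of [(x - m)^2] and [m^2]. The power of
    [x - m] then goes into the exponential, so the monomial of the prior costs part of a Gaussian
    centred at [m]. *)
Lemma pow_shift_le (r : nat) (x m s : R) : (0 < r)%N -> 0 < s ->
  x ^+ (2 * r) <= 4 ^+ r * ((r%:R / s) ^+ r + m ^+ (2 * r)) * expR (s * (x - m) ^+ 2).
Proof.
move=> r0 s0; set u := x - m.
have e1 : 1 <= expR (s * u ^+ 2) by rewrite -expR0 ler_expR mulr_ge0 ?sqr_ge0// ltW.
have u0 := pow_even_le_expR r0 u s0.
have h : x ^+ (2 * r) <= 4 ^+ r * (u ^+ (2 * r) + m ^+ (2 * r)).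
  rewrite !exprM; set v := u ^+ 2; set w := m ^+ 2.
  have v0 : 0 <= v by exact: sqr_ge0.
  have w0 : 0 <= w by exact: sqr_ge0.
  have x20 := sqr_ge0 x.
  have xvw : x ^+ 2 <= 2 * v + 2 * w.
    by rewrite /v /w /u; have := sqr_ge0 (x - 2 * m); lra.
  have [vw|/ltW wv] := lerP v w.
    apply: (@le_trans _ _ ((4 * w) ^+ r)).
      by apply: lerXn2r; rewrite ?nnegrE; lra.
    by rewrite exprMn ler_wpM2l ?exprn_ge0// lerDr exprn_ge0.
  apply: (@le_trans _ _ ((4 * v) ^+ r)).
    by apply: lerXn2r; rewrite ?nnegrE; lra.
  by rewrite exprMn ler_wpM2l ?exprn_ge0// lerDl exprn_ge0.
apply: le_trans h _; rewrite -mulrA ler_wpM2l ?exprn_ge0// mulrDl lerD//.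
by rewrite ler_peMr// exprM exprn_ge0// sqr_ge0.
Qed.

Lemma invX_le_expR (r : nat) (w x : R) : 0 < w -> 0 < x ->
  x ^- r <= (r%:R / w) ^+ r * expR (w / x).
Proof.
move=> w0 x0; have xi : 0 < x^-1 by rewrite invr_gt0.
have := @powR_expR_le R r%:R w x^-1 (ler0n _ _) w0 xi.
have rw0 : 0 <= r%:R / w by rewrite divr_ge0// ltW.
by rewrite (powR_mulrn _ rw0) (powR_mulrn _ (ltW xi)) expRN ler_pdivrMr ?expR_gt0// exprVn.
Qed.

(** The left side arises as the supremum over [tau] of a negative power times part of the hyperprior
    exponential. It is the origin of both [n^-((r+1/2) m)] and [m^((r+1/2) m)]. *)
Lemma powR_self_le (h : R) (m N n : nat) (c : R) : 0 < h -> 0 < c -> (m <= N)%N -> (0 < n)%N ->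
  (c * (h * m%:R) / n%:R) `^ (h * m%:R) <=
  expR (h * (m%:R * ln m%:R + m%:R * `|ln (c * h)| - m%:R * ln n%:R)).
Proof.
move=> h0 c0 mN n0; have n0' : 0 < (n%:R : R) by rewrite ltr0n.
case: m mN => [|m] mN; first by rewrite !mul0r addr0 subr0 mulr0 powRr0 expR0.
have m0 : 0 < (m.+1%:R : R) by rewrite ltr0n.
have b0 : 0 < c * (h * m.+1%:R) / n%:R by rewrite divr_gt0 ?mulr_gt0.
rewrite /powR gt_eqF// ler_expR -[leLHS]mulrA ler_wpM2l ?(ltW h0)//.
have -> : c * (h * m.+1%:R) / n%:R = (c * h) * m.+1%:R / n%:R by ring.
rewrite ln_div ?posrE ?mulr_gt0// (@lnM _ (c * h)) ?posrE ?mulr_gt0//.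
have := ler_norm (ln (c * h)) => q.
have : m.+1%:R * ln (c * h) <= m.+1%:R * `|ln (c * h)| by rewrite ler_wpM2l// ltW.
by lra.
Qed.

End MarginalPieces.

(** * Bounds on the marginal density *)

Section InvGammaIntegral.
Context (R : realType).
Notation mu := (@lebesgue_measure R).

Definition inv_gamma_int (a b : R) : R :=
  fine (\int[mu]_(x in `]0%R, +oo[) (x `^ (- (a + 1)) * expR (- (b / x)))%:E)%E.

Lemma inv_gamma_intE a b : 0 < a -> 0 < b ->
  (\int[mu]_(x in `]0%R, +oo[) (x `^ (- (a + 1)) * expR (- (b / x)))%:E
   = (inv_gamma_int a b)%:E)%E.
Proof.
move=> a0 b0; rewrite /inv_gamma_int fineK// ge0_fin_numE.
  exact: integral_inv_gamma_lty.
by apply: integral_ge0 => x _; rewrite lee_fin mulr_ge0 ?powR_ge0 ?expR_ge0.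
Qed.

Lemma inv_gamma_int_ge0 a b : 0 <= inv_gamma_int a b.
Proof.
by apply: fine_ge0; apply: integral_ge0 => x _; rewrite lee_fin mulr_ge0 ?powR_ge0 ?expR_ge0.
Qed.

Lemma integral_inv_gammaZ a b c : 0 < a -> 0 < b -> 0 <= c ->
  (\int[mu]_(x in `]0%R, +oo[) (c * (x `^ (- (a + 1)) * expR (- (b / x))))%:E
   = (c * inv_gamma_int a b)%:E)%E.
Proof.
move=> a0 b0 c0; under eq_integral do rewrite EFinM.
rewrite ge0_integralZl_EFin//.
- by rewrite inv_gamma_intE.
- by move=> x _; rewrite lee_fin mulr_ge0 ?powR_ge0 ?expR_ge0.
- apply/measurable_EFinP; apply: measurable_funTS; apply: measurable_funM.
    exact: measurable_powR.
  apply: measurableT_comp; first exact: measurable_expR.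
  apply: measurableT_comp => //; apply: measurable_funM; first exact: measurable_cst.
  exact: measurable_inv.
Qed.

End InvGammaIntegral.

(** * Upper bound, given a coordinatewise lower bound [key] on the residual *)

Section MarginalUpper.
Context (R : realType) (a1 a2 alpha1 alpha2 M : R) (r t0 : nat).
Hypotheses (a1_gt0 : 0 < a1) (a2_gt0 : 0 < a2) (r_gt0 : (0 < r)%N).
Hypotheses (alpha1_gt0 : 0 < alpha1) (alpha2_gt0 : 0 < alpha2) (M_ge0 : 0 <= M).
Notation mu := (@lebesgue_measure R).

Let h : R := r%:R + 2^-1.
(** The share of the inverse gamma rate granted to each nonzero centre; at most [t0] of them use at
    most [alpha2 / 2] in total. The successor avoids a division by 0. *)
Let w : R := alpha2 / (2 * t0.+1%:R).
Let D : R := 4 ^+ r * ((4 * r%:R) ^+ r + M ^+ (2 * r) * (r%:R / w) ^+ r).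
Let D1 : R := D * Num.sqrt (4 * pi) / pmom_lo a2.
Definition marginal_ub_rate : R := ln D1 + h * `|ln (8 * h)| + h * t0%:R.
Definition marginal_ub_cst : R := (Gamma (2^-1) )^-1 * expR (2 / 5 * ln (16 / 5) - 2^-1 * ln 2)
  * inv_gamma_int (10^-1) (8^-1)
  * (alpha2 `^ alpha1 / Gamma alpha1 * inv_gamma_int alpha1 (alpha2 / 2)).

Let w_gt0 : 0 < w. Proof. by rewrite divr_gt0 ?mulr_gt0// ltr0n. Qed.
Let h_gt0 : 0 < h. Proof. by rewrite addr_gt0 ?invr_gt0// ltr0n. Qed.
Let r1 : 1 <= r%:R :> R. Proof. by rewrite ler1n. Qed.
Let Mr_ge0 : 0 <= M ^+ (2 * r) * (r%:R / w) ^+ r.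
Proof. by rewrite mulr_ge0 ?exprn_ge0// divr_ge0// ltW. Qed.
Let D_gt0 : 0 < D.
Proof.
have r4 : 0 < 4 * r%:R :> R by have := r1; lra.
by rewrite mulr_gt0 ?exprn_gt0// ltr_wpDr// exprn_gt0.
Qed.
Let D1_gt0 : 0 < D1.
Proof. by rewrite divr_gt0 ?expR_gt0// mulr_gt0// sqrtr_gt0 mulr_gt0// pi_gt0. Qed.

Context (n p : nat) (X : 'M[R]_(n, p)) (A : 'M[R]_p) (k : {set 'I_p}) (y : 'cV[R]_n).
Hypothesis n_gt0 : (0 < n)%N.
Hypothesis hA : forall v : 'cV[R]_p, a1 * sqn v <= dotc v (A *m v) <= a2 * sqn v.
Context (m_ : 'I_#|k| -> R) (S kap : R).
Hypotheses (S_gt0 : 0 < S) (kap_ge1 : 1 <= kap).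
Hypothesis m_le : forall j, `|m_ j| <= M.
Hypothesis m_supp : (#|[set j | m_ j != 0%R]%SET| <= t0)%N.
Hypothesis key : forall b : #|k|.-tuple R,
  S + kap * \sum_j (tnth b j - m_ j) ^+ 2
  <= sqn (y - design_sub X k *m col_of_tuple b).

Let K : nat := #|k|.
Let m : nat := #|[set j | m_ j == 0%R]%SET|.
Let t' : nat := #|[set j | m_ j != 0%R]%SET|.

Let Kmt : K = (t' + m)%N.
Proof.
rewrite /K -[LHS]card_ord -cardsT -(finset.cardsID [set j | m_ j != 0%R]%SET).
rewrite finset.setTI; congr addn; congr (#|pred_of_set _|).
by apply/setP => j; rewrite !finset.inE negbK andbT.
Qed.

Let expnt : R := - (r * #|k|)%:R - #|k|%:R / 2.
Let expntE : expnt = - (h * K%:R).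
Proof. by rewrite /expnt /h /K natrM; field. Qed.

Let Q : R := D1 ^+ K * ((Num.sqrt kap) ^- K * kap ^- (r * m)) * expR (log_peak n S).

Let Q0 : 0 <= Q.
Proof.
have kap0 : 0 <= kap by exact: le_trans ler01 kap_ge1.
apply: mulr_ge0; last exact: expR_ge0.
apply: mulr_ge0; first by apply/exprn_ge0/ltW.
by apply: mulr_ge0; rewrite invr_ge0 exprn_ge0 ?sqrtr_ge0.
Qed.

Let ev0 (x : R) : 0 <= x ^+ (2 * r).
Proof. by rewrite exprM exprn_ge0// sqr_ge0. Qed.

(* A zero centre gains the nonlocal factor [kap ^- r]; at a nonzero centre the
   surplus [s2 ^- r] is at most [expR (w / s2)] up to a constant, which the inverse
   gamma prior of the variance absorbs since there are at most [t0] such centres. *)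
Let factor_ub s2 (x : R) : 0 < s2 -> `|x| <= M ->
  s2 `^ (- h) * (4 ^+ r * ((r%:R / (kap / (4 * s2))) ^+ r + x ^+ (2 * r))
    * Num.sqrt (pi / (kap / (4 * s2))))
  <= D * Num.sqrt (4 * pi) * (Num.sqrt kap)^-1
     * (if x == 0 then kap ^- r else expR (w / s2)).
Proof.
move=> s20 xM; have kap0 : 0 < kap by exact: lt_le_trans ltr01 kap_ge1.
have pi0 := pi_gt0 R.
have q0 : 0 < Num.sqrt s2 by rewrite sqrtr_gt0.
have kq0 : 0 < Num.sqrt kap by rewrite sqrtr_gt0.
have s2h : s2 `^ (- h) = s2 ^- r * (Num.sqrt s2)^-1.
  rewrite powRN /h powRD ?(gt_eqF s20) ?implybT// powR_mulrn ?(ltW s20)//.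
  by rewrite powR12_sqrt ?(ltW s20)// invfM.
have sq : Num.sqrt (pi / (kap / (4 * s2))) = Num.sqrt (4 * pi) * Num.sqrt s2 / Num.sqrt kap.
  rewrite -sqrtrM ?mulr_ge0 ?pi_ge0// -sqrtrV ?(ltW kap0)// -sqrtrM; last first.
    by rewrite !mulr_ge0 ?pi_ge0// ltW.
  by congr Num.sqrt; field; rewrite !gt_eqF.
have e1 : (r%:R / (kap / (4 * s2))) ^+ r = (4 * r%:R / kap) ^+ r * s2 ^+ r.
  by rewrite -exprMn; congr (_ ^+ r); field; rewrite !gt_eqF.
have sr0 : 0 < s2 ^+ r by rewrite exprn_gt0.
rewrite s2h sq e1.
have -> : s2 ^- r / Num.sqrt s2 * (4 ^+ r * ((4 * r%:R / kap) ^+ r * s2 ^+ r + x ^+ (2 * r)) *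
   (Num.sqrt (4 * pi) * Num.sqrt s2 / Num.sqrt kap)) =
   4 ^+ r * ((4 * r%:R / kap) ^+ r + x ^+ (2 * r) * s2 ^- r) * (Num.sqrt (4 * pi) / Num.sqrt kap).
  by field; rewrite !gt_eqF.
have -> (z : R) : D * Num.sqrt (4 * pi) / Num.sqrt kap * z =
  D * z * (Num.sqrt (4 * pi) / Num.sqrt kap) by ring.
rewrite ler_wpM2r ?divr_ge0 ?sqrtr_ge0// /D -[leRHS]mulrA ler_wpM2l ?exprn_ge0//.
have k4 : (4 * r%:R / kap) ^+ r = (4 * r%:R) ^+ r * kap ^- r by rewrite exprMn exprVn.
have kr0 : 0 < kap ^- r by rewrite invr_gt0 exprn_gt0.
case: eqP => [->|_].
  rewrite expr0n muln_eq0/= gtn_eqF// mul0r addr0 k4 ler_wpM2r ?(ltW kr0)//.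
  by rewrite lerDl.
have ew : 1 <= expR (w / s2) by rewrite -expR0 ler_expR divr_ge0 ?(ltW w_gt0) ?(ltW s20).
rewrite [leRHS]mulrDl lerD//.
  rewrite k4 ler_wpM2l ?exprn_ge0 ?mulr_ge0//; apply: le_trans ew.
  by rewrite invf_le1 ?exprn_gt0// exprn_ege1.
rewrite -mulrA ler_pM ?invr_ge0 ?(ltW sr0)//.
- have -> : x ^+ (2 * r) = `|x| ^+ (2 * r) by rewrite !exprM real_normK ?num_real.
  by rewrite lerXn2r ?nnegrE.
- exact: invX_le_expR.
Qed.

Let prod_factor_ub s2 : 0 < s2 ->
  s2 `^ expnt * \prod_j (4 ^+ r * ((r%:R / (kap / (4 * s2))) ^+ r + m_ j ^+ (2 * r))
    * Num.sqrt (pi / (kap / (4 * s2))))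
  <= (D * Num.sqrt (4 * pi)) ^+ K * ((Num.sqrt kap) ^- K * kap ^- (r * m))
    * expR (alpha2 / 2 / s2).
Proof.
move=> s20; have kap0 : 0 < kap by exact: lt_le_trans ltr01 kap_ge1.
have -> : s2 `^ expnt = \prod_(j < #|k|) s2 `^ (- h).
  by rewrite prodr_const card_ord expntE -powR_mulrn ?powR_ge0// -powRrM mulNr.
rewrite -big_split/=.
apply: (@le_trans _ _ (\prod_(j < #|k|) (D * Num.sqrt (4 * pi) * (Num.sqrt kap)^-1
     * (if m_ j == 0 then kap ^- r else expR (w / s2))))).
  apply: ler_prod => j _; rewrite factor_ub// andbT.
  rewrite mulr_ge0 ?powR_ge0// mulr_ge0 ?sqrtr_ge0// mulr_ge0 ?exprn_ge0//.
  rewrite addr_ge0 ?ev0// exprn_ge0// divr_ge0// divr_ge0 ?(ltW kap0)// mulr_ge0//.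
  exact: ltW.
rewrite big_split/= prodr_const card_ord.
have -> : \prod_(j < #|k|) (if m_ j == 0 then kap ^- r else expR (w / s2)) =
    kap ^- (r * m) * expR (w / s2) ^+ t'.
  rewrite (bigID (fun j => m_ j == 0))/=; congr (_ * _).
    rewrite (eq_bigr (fun=> kap ^- r)); last by move=> j ->.
    rewrite prodr_const -exprVn -exprM -exprVn; congr (_ ^+ (r * _)).
    by apply: eq_card => j; rewrite finset.inE.
  rewrite (eq_bigr (fun=> expR (w / s2))); last by move=> j /negbTE ->.
  rewrite prodr_const; congr (_ ^+ _).
  by apply: eq_card => j; rewrite finset.inE.
rewrite exprMn exprVn -/K.
set C1 := _ ^+ K; set C2 := _ ^- K; set C3 := kap ^- _.
rewrite -[leLHS]mulrA (mulrA C2) (mulrA C1) ler_wpM2l//.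
  apply: mulr_ge0; first by apply/exprn_ge0/mulr_ge0; [exact: ltW|exact: sqrtr_ge0].
  by apply: mulr_ge0; rewrite invr_ge0 exprn_ge0 ?sqrtr_ge0 ?(ltW kap0).
rewrite -expRM_natl ler_expR.
have -> : alpha2 / 2 / s2 = t0.+1%:R * (w / s2).
  by rewrite /w; field; rewrite !gt_eqF// ltr0n.
have ws0 : 0 <= w / s2 by apply: divr_ge0; exact: ltW.
rewrite (ler_wpM2r ws0)// ler_nat.
exact: leq_trans m_supp (leqnSn _).
Qed.

Let integrand_ge0 (b : #|k|.-tuple R) tau s2 d1 d2 : 0 < s2 -> 0 <= d1 -> 0 <= d2 ->
  0 <= likelihood X y b s2 * pmom_pdf r A tau s2 b * d1 * d2.
Proof.
move=> s20 d10 d20; apply: mulr_ge0 => //; apply: mulr_ge0 => //; apply: mulr_ge0.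
  by rewrite likelihoodE// expR_ge0.
exact: (pmom_pdf_ge0 _ _ _ a1_gt0 a2_gt0 r_gt0 hA).
Qed.

(** By [key] the likelihood is at most its peak times Gaussians of rate [2 s] around the centres,
    with [s = kap / (4 s2)]. One half of the rate absorbs the monomial of the prior, the other half
    is integrated; the Gaussian factor of the prior is bounded by 1. *)
Let inner_ub tau s2 d1 d2 : 0 < tau -> 0 < s2 -> 0 <= d1 -> 0 <= d2 ->
  (\int[@lebesgue_tuple R #|k|]_b
     (likelihood X y b s2 * pmom_pdf r A tau s2 b * d1 * d2)%:E
   <= (Q * (tau `^ expnt * expR (alpha2 / 2 / s2)) * d1 * d2)%:E)%E.
Proof.
move=> tau0 s20 d10 d20; have kap0 : 0 < kap by exact: lt_le_trans ltr01 kap_ge1.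
set s := kap / (4 * s2).
have s0 : 0 < s by rewrite divr_gt0 ?mulr_gt0.
pose H j := 4 ^+ r * ((r%:R / s) ^+ r + m_ j ^+ (2 * r)).
have H0 j : 0 <= H j.
  by rewrite mulr_ge0 ?exprn_ge0// addr_ge0 ?ev0// exprn_ge0// divr_ge0// ltW.
pose f (j : 'I_#|k|) (x : R) := H j * expR (- (s * (x - m_ j) ^+ 2)).
pose E0 := pmom_lo a2 ^- K * (tau * s2) `^ expnt * expR (log_peak n S) * d1 * d2.
have lo0 : 0 < pmom_lo a2 by exact: expR_gt0.
have E00 : 0 <= E0 by rewrite !mulr_ge0 ?powR_ge0 ?expR_ge0// invr_ge0 exprn_ge0// ltW.
have f0 j x : 0 <= f j x by rewrite mulr_ge0 ?expR_ge0.
have mf j : measurable_fun setT (f j).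
  by apply: measurable_funM; [exact: measurable_cst|exact: measurable_expR_sqr].
apply: (@le_trans _ _ (\int[@lebesgue_tuple R #|k|]_b (E0%:E * (\prod_j f j (tnth b j))%:E))%E).
  apply: integral_mono => b _.
    by rewrite lee_fin integrand_ge0.
  rewrite -EFinM lee_fin.
  have mass := pmom_mass_gt0 a1_gt0 a2_gt0 r_gt0 hA k.
  have /andP[massl _] := pmom_mass_bounds a1_gt0 a2_gt0 r_gt0 hA k.
  have L : likelihood X y b s2 <= expR (log_peak n S) * \prod_j expR (- (2 * s * (tnth b j - m_ j) ^+ 2)).
    rewrite likelihoodE// -expR_sum -expRD ler_expR.
    apply: (@le_trans _ _ (- (n%:R / 2 * ln (2 * pi * s2)) - S / (2 * s2)
        - kap / (2 * s2) * \sum_j (tnth b j - m_ j) ^+ 2)).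
      rewrite -addrA lerD2l -opprD lerN2 mulrAC -mulrDl ler_wpM2r ?invr_ge0 ?mulr_ge0 ?(ltW s20)//.
    rewrite lerD ?gauss_sup// sumrN lerN2 -mulr_sumr le_eqVlt; apply/orP; left; apply/eqP.
    by congr (_ * _); rewrite /s; field; rewrite gt_eqF.
  have Pm : pmom_pdf r A tau s2 b <= pmom_lo a2 ^- K * (tau * s2) `^ expnt * \prod_j (H j * expR (s * (tnth b j - m_ j) ^+ 2)).
    rewrite (pmom_pdfE a1_gt0 a2_gt0 r_gt0 hA) -/expnt -!mulrA.
    rewrite ler_pM ?invr_ge0 ?(ltW mass) ?mulr_ge0 ?powR_ge0 ?expR_ge0 ?prod_pow_even_ge0//.
      by rewrite lef_pV2 ?posrE ?exprn_gt0.
    rewrite ler_wpM2l ?powR_ge0//.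
    apply: (@le_trans _ _ (1 * \prod_(i < #|k|) tnth b i ^+ (2 * r))).
      rewrite ler_wpM2r ?prod_pow_even_ge0// -expR0 ler_expR oppr_le0.
      have /andP[qb _] := prior_qform_bounds hA b.
      apply: divr_ge0; last by rewrite !mulr_ge0// ltW.
      apply: le_trans qb; rewrite mulr_ge0 ?(ltW a1_gt0)//.
      by apply: sumr_ge0 => i _; exact: sqr_ge0.
    rewrite mul1r; apply: ler_prod => j _; rewrite pow_shift_le// andbT.
    by rewrite exprM exprn_ge0// sqr_ge0.
  apply: (@le_trans _ _ ((expR (log_peak n S) * \prod_j expR (- (2 * s * (tnth b j - m_ j) ^+ 2)))
    * (pmom_lo a2 ^- K * (tau * s2) `^ expnt * \prod_j (H j * expR (s * (tnth b j - m_ j) ^+ 2))) * d1 * d2)).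
    rewrite ler_wpM2r// ler_wpM2r// ler_pM//; first by rewrite likelihoodE// expR_ge0.
    exact: (pmom_pdf_ge0 _ _ _ a1_gt0 a2_gt0 r_gt0 hA).
  have -> : \prod_j f j (tnth b j) = \prod_j expR (- (2 * s * (tnth b j - m_ j) ^+ 2)) *
     \prod_j (H j * expR (s * (tnth b j - m_ j) ^+ 2)).
    rewrite -big_split/=; apply: eq_bigr => j _; rewrite /f [RHS]mulrCA -expRD.
    by congr (_ * expR _); ring.
  by rewrite /E0 le_eqVlt; apply/orP; left; apply/eqP; ring.
rewrite ge0_integralZl_EFin//; last 2 first.
- by move=> b _; rewrite lee_fin; apply: prodr_ge0.
- apply/measurable_EFinP; apply: measurable_fun_prodr => j.
  by apply: measurableT_comp => //; exact: measurable_tnth.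
rewrite (@integral_lebesgue_tuple_prod R _ f (fun j => H j * Num.sqrt (pi / s)))//; last first.
  move=> j; under eq_integral do rewrite EFinM.
  rewrite ge0_integralZl_EFin//; last by apply/measurable_EFinP; exact: measurable_expR_sqr.
  by rewrite integral_expR_sqr// -EFinM.
rewrite -EFinM lee_fin /E0 (powRM _ (ltW tau0) (ltW s20)).
have := prod_factor_ub s20; rewrite -/s; set Pr := \prod_j _ => hp.
have -> : pmom_lo a2 ^- K * (tau `^ expnt * s2 `^ expnt) * expR (log_peak n S) * d1 * d2 * Pr
  = pmom_lo a2 ^- K * (s2 `^ expnt * Pr) * (tau `^ expnt * expR (log_peak n S) * d1 * d2) by ring.
have -> : Q * (tau `^ expnt * expR (alpha2 / 2 / s2)) * d1 * d2 =
  pmom_lo a2 ^- K * ((D * Num.sqrt (4 * pi)) ^+ K * ((Num.sqrt kap) ^- K * kap ^- (r * m))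
    * expR (alpha2 / 2 / s2)) * (tau `^ expnt * expR (log_peak n S) * d1 * d2).
  by rewrite /Q /D1 [(_ / _) ^+ K]exprMn exprVn; ring.
rewrite ler_wpM2r ?mulr_ge0 ?powR_ge0 ?expR_ge0// ler_wpM2l// invr_ge0 exprn_ge0//.
exact: ltW.
Qed.

(** The marginal before [fine] is applied. Bounds are proved at this level because [fine] sends an
    infinite integral to 0 and is not monotone. *)
Definition marginal_integral : \bar R :=
  (\int[mu]_(tau in `]0%R, +oo[) \int[mu]_(s2 in `]0%R, +oo[)
     \int[@lebesgue_tuple R #|k|]_b
          (likelihood X y b s2 * pmom_pdf r A tau s2 b
           * inv_gamma_pdf (1 / 2) (n%:R / 2) tau
           * inv_gamma_pdf alpha1 alpha2 s2)%:E)%E.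

Let ig_ge0 : 0 <= alpha2 `^ alpha1 / Gamma alpha1.
Proof. by rewrite divr_ge0 ?powR_ge0// ltW// Gamma_gt0. Qed.

Let G1 : R := alpha2 `^ alpha1 / Gamma alpha1 * inv_gamma_int alpha1 (alpha2 / 2).

Let inv_gamma_pdf_ge0 (a b x : R) : 0 < a -> 0 <= inv_gamma_pdf a b x.
Proof.
by move=> a0; rewrite /inv_gamma_pdf !mulr_ge0 ?powR_ge0 ?expR_ge0// invr_ge0 ltW// Gamma_gt0.
Qed.

(** The surplus [expR (alpha2 / 2 / s2)] left by the nonzero centres uses half of the rate of the
    inverse gamma prior; the other half keeps the integral over the variance finite. *)
Let middle_ub tau : 0 < tau ->
  (\int[mu]_(s2 in `]0%R, +oo[) \int[@lebesgue_tuple R #|k|]_b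
          (likelihood X y b s2 * pmom_pdf r A tau s2 b
           * inv_gamma_pdf (1 / 2) (n%:R / 2) tau
           * inv_gamma_pdf alpha1 alpha2 s2)%:E
   <= (Q * G1 * (tau `^ expnt * inv_gamma_pdf (1 / 2) (n%:R / 2) tau))%:E)%E.
Proof.
move=> tau0; set d1 := inv_gamma_pdf _ _ tau.
have d10 : 0 <= d1 by apply: inv_gamma_pdf_ge0; rewrite divr_gt0.
pose c := Q * tau `^ expnt * d1 * (alpha2 `^ alpha1 / Gamma alpha1).
have c0 : 0 <= c.
  apply: mulr_ge0; last exact: ig_ge0.
  by apply: mulr_ge0 => //; apply: mulr_ge0 => //; exact: powR_ge0.
have := @integral_inv_gammaZ R alpha1 (alpha2 / 2) c alpha1_gt0 _ c0.
rewrite divr_gt0// => /(_ isT) cE.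
apply: (@le_trans _ _ (c * inv_gamma_int alpha1 (alpha2 / 2))%:E); last first.
  by rewrite lee_fin /c /G1 le_eqVlt; apply/orP; left; apply/eqP; ring.
rewrite -cE; apply: integral_mono => s2 /=; rewrite in_itv/= andbT => s20.
  by apply: integral_ge0 => b _; rewrite lee_fin integrand_ge0// inv_gamma_pdf_ge0.
have d20 : 0 <= inv_gamma_pdf alpha1 alpha2 s2 by exact: inv_gamma_pdf_ge0.
apply: le_trans (inner_ub tau0 s20 d10 d20) _; rewrite lee_fin /c /inv_gamma_pdf.
have -> : expR (- (alpha2 / 2 / s2)) = expR (alpha2 / 2 / s2) * expR (- (alpha2 / s2)).
  by rewrite -expRD; congr expR; field; rewrite gt_eqF.
by rewrite le_eqVlt; apply/orP; left; apply/eqP; ring.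
Qed.

(** The factor [expR (- n / (2 tau))] is cut into four equal parts: one for the power from the [t']
    nonzero centres, one for the [m] zero centres, one for the power 2/5, and one for the final
    integral. Treating [t'] and [m] apart yields [m ln m] instead of [K ln K]. *)
Let tau_ub tau : 0 < tau ->
  tau `^ expnt * inv_gamma_pdf (1 / 2) (n%:R / 2) tau <=
  (Gamma (2^-1))^-1 * expR (2 / 5 * ln (16 / 5) - 2^-1 * ln 2)
  * expR (h * (t'%:R * ln t'%:R + t'%:R * `|ln (8 * h)| - t'%:R * ln n%:R))
  * expR (h * (m%:R * ln m%:R + m%:R * `|ln (8 * h)| - m%:R * ln n%:R))
  * expR (ln n%:R / 10)
  * (tau `^ (- (10^-1 + 1)) * expR (- (8^-1 / tau))).
Proof.
move=> tau0; have n0 : 0 < (n%:R : R) by rewrite ltr0n.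
have n1 : 1 <= (n%:R : R) by rewrite ler1n.
have ti : 0 < tau^-1 by rewrite invr_gt0.
have n8 : 0 < n%:R / 8 :> R by rewrite divr_gt0.
have B (j : nat) : tau^-1 `^ (h * j%:R) * expR (- (n%:R / 8 * tau^-1)) <=
    expR (h * (j%:R * ln j%:R + j%:R * `|ln (8 * h)| - j%:R * ln n%:R)).
  apply: le_trans (powR_expR_le _ n8 ti) _; first by rewrite mulr_ge0// ltW.
  apply: le_trans (@powR_self_le R h j j n 8 h_gt0 _ (leqnn _) n_gt0) => //.
  by rewrite le_eqVlt; apply/orP; left; apply/eqP; congr (_ `^ _); field; rewrite gt_eqF.
(* Writing [tau^-(3/2)] as [tau^-(2/5) * tau^-(11/10)] keeps the remaining integral
   over [tau] finite, uniformly in [n], at the price of a factor [n^(1/10)]. *)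
have B2 : (n%:R / 2) `^ (2^-1) * (tau^-1 `^ (2 / 5) * expR (- (n%:R / 8 * tau^-1))) <=
    expR (2 / 5 * ln (16 / 5) - 2^-1 * ln 2) * expR (ln n%:R / 10).
  apply: (@le_trans _ _ ((n%:R / 2) `^ (2^-1) * (2 / 5 / (n%:R / 8)) `^ (2 / 5))).
    by rewrite ler_wpM2l ?powR_ge0// powR_expR_le// divr_ge0.
  have -> : 2 / 5 / (n%:R / 8) = 16 / 5 / n%:R :> R by field; rewrite gt_eqF.
  rewrite /powR !gt_eqF ?divr_gt0// -!expRD ler_expR !ln_div ?posrE ?divr_gt0//.
  by lra.
have ptau (x : R) : tau `^ (- x) = tau^-1 `^ x.
  by rewrite -[tau^-1]powR_inv1 ?(ltW tau0)// -powRrM mulN1r.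
have tn0 : tau^-1 != 0 by rewrite gt_eqF.
have -> : tau `^ expnt * inv_gamma_pdf (1 / 2) (n%:R / 2) tau =
  (Gamma (2^-1))^-1 * ((n%:R / 2) `^ (2^-1) * (tau^-1 `^ (2 / 5) * expR (- (n%:R / 8 * tau^-1))))
  * (tau^-1 `^ (h * t'%:R) * expR (- (n%:R / 8 * tau^-1)))
  * (tau^-1 `^ (h * m%:R) * expR (- (n%:R / 8 * tau^-1)))
  * (tau `^ (- (10^-1 + 1)) * expR (- (n%:R / 8 * tau^-1))).
  rewrite /inv_gamma_pdf expntE !ptau.
  have e1 : tau^-1 `^ (h * K%:R) * tau^-1 `^ (1 / 2 + 1) =
    tau^-1 `^ (2 / 5) * tau^-1 `^ (h * t'%:R) * tau^-1 `^ (h * m%:R) * tau^-1 `^ (10^-1 + 1).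
    rewrite -!powRD ?tn0 ?implybT//; congr (_ `^ _).
    by rewrite Kmt natrD; field.
  have e2 : expR (- (n%:R / 2 / tau)) = expR (- (n%:R / 8 * tau^-1)) ^+ 4.
    by rewrite -expRM_natl; congr expR; field; rewrite gt_eqF.
  rewrite e2 div1r mulrA [X in X * _ = _](_ : _ =
    (tau^-1 `^ (h * K%:R) * tau^-1 `^ (1 / 2 + 1)) * ((n%:R / 2) `^ 2^-1 / Gamma 2^-1)); last first.
    by rewrite div1r; ring.
  by rewrite e1; ring.
have G0 : 0 <= (Gamma (2^-1 : R))^-1 by rewrite invr_ge0 ltW// Gamma_gt0.
apply: (@le_trans _ _ ((Gamma (2^-1))^-1 *
   (expR (2 / 5 * ln (16 / 5) - 2^-1 * ln 2) * expR (ln n%:R / 10))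
  * expR (h * (t'%:R * ln t'%:R + t'%:R * `|ln (8 * h)| - t'%:R * ln n%:R))
  * expR (h * (m%:R * ln m%:R + m%:R * `|ln (8 * h)| - m%:R * ln n%:R))
  * (tau `^ (- (10^-1 + 1)) * expR (- (8^-1 / tau))))); last first.
  by rewrite le_eqVlt; apply/orP; left; apply/eqP; ring.
have e0 x := expR_ge0 x : 0 <= expR x :> R.
have p0 := @powR_ge0 R.
have e8 : expR (- (n%:R / 8 * tau^-1)) <= expR (- (8^-1 / tau)).
  by rewrite ler_expR lerN2 ler_wpM2r ?(ltW ti)//; lra.
apply: ler_pM; rewrite ?mulr_ge0//; last by rewrite ler_wpM2l.
apply: ler_pM; rewrite ?mulr_ge0//.
by apply: ler_pM; rewrite ?mulr_ge0// ler_wpM2l.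
Qed.

Lemma marginal_integral_ub : (marginal_integral <=
  (marginal_ub_cst * expR (marginal_ub_rate * K%:R - (K%:R / 2 + (r * m)%:R) * ln kap
    - h * (K%:R * ln n%:R) + h * (m%:R * ln m%:R) + ln n%:R / 10
    + log_peak n S))%:E)%E.
Proof.
have n0 : 0 < (n%:R : R) by rewrite ltr0n.
have kap0 : 0 < kap by exact: lt_le_trans ltr01 kap_ge1.
have G10 : 0 <= G1.
  by apply: mulr_ge0; [exact: ig_ge0|exact: inv_gamma_int_ge0].
have g0 : 0 <= (Gamma (2^-1 : R))^-1 by rewrite invr_ge0 ltW// Gamma_gt0.
pose c := Q * G1 * ((Gamma (2^-1))^-1 * expR (2 / 5 * ln (16 / 5) - 2^-1 * ln 2)
  * expR (h * (t'%:R * ln t'%:R + t'%:R * `|ln (8 * h)| - t'%:R * ln n%:R))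
  * expR (h * (m%:R * ln m%:R + m%:R * `|ln (8 * h)| - m%:R * ln n%:R))
  * expR (ln n%:R / 10)).
have c0 : 0 <= c.
  apply: mulr_ge0; first exact: mulr_ge0.
  apply: mulr_ge0; last exact: expR_ge0.
  apply: mulr_ge0; last exact: expR_ge0.
  apply: mulr_ge0; last exact: expR_ge0.
  by apply: mulr_ge0; last exact: expR_ge0.
apply: (@le_trans _ _ (c * inv_gamma_int (10^-1) (8^-1))%:E).
  rewrite -integral_inv_gammaZ ?invr_gt0//.
  apply: integral_mono => tau /=; rewrite in_itv/= andbT => tau0.
    apply: integral_ge0 => s2 /=; rewrite in_itv/= andbT => s20.
    by apply: integral_ge0 => b _; rewrite lee_fin integrand_ge0 ?inv_gamma_pdf_ge0 ?divr_gt0.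
  apply: le_trans (middle_ub tau0) _; rewrite lee_fin /c -[leRHS]mulrA.
  by apply: ler_wpM2l; [exact: mulr_ge0|exact: tau_ub].
rewrite lee_fin.
have QE : Q = expR (K%:R * ln D1 - (K%:R / 2 + (r * m)%:R) * ln kap + log_peak n S).
  rewrite /Q sqrt_expN// -exprVn -{1}(lnK D1_gt0) -expRM_natl.
  rewrite -{2}(lnK kap0) -expRN -expRM_natl -!expRD; congr expR; ring.
(* The number of nonzero centres is bounded by [t0], so their entropy term is linear in [K] and
   joins the exponential rate. *)
have tt : t'%:R * ln t'%:R <= K%:R * t0%:R :> R.
  have [->|t'0] := posnP t'; first by rewrite mul0r mulr_ge0.
  have t0' : 0 < t'%:R :> R by rewrite ltr0n.
  have := ln_leB1 t0' => l1.
  have tK : t'%:R <= K%:R :> R by rewrite ler_nat Kmt leq_addr.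
  have tt0 : t'%:R <= t0%:R :> R by rewrite ler_nat.
  have : t'%:R * ln t'%:R <= t'%:R * t0%:R :> R by rewrite ler_wpM2l//; lra.
  have : t'%:R * t0%:R <= K%:R * t0%:R :> R by rewrite ler_wpM2r//.
  by lra.
have -> : c * inv_gamma_int (10^-1) (8^-1) = marginal_ub_cst * (Q
  * expR (h * (t'%:R * ln t'%:R + t'%:R * `|ln (8 * h)| - t'%:R * ln n%:R))
  * expR (h * (m%:R * ln m%:R + m%:R * `|ln (8 * h)| - m%:R * ln n%:R))
  * expR (ln n%:R / 10)) by rewrite /c /marginal_ub_cst /G1; ring.
have c20 : 0 <= marginal_ub_cst.
  apply: mulr_ge0 => //; apply: mulr_ge0; last exact: inv_gamma_int_ge0.
  by apply: mulr_ge0; last exact: expR_ge0.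
rewrite ler_wpM2l// QE -!expRD ler_expR /marginal_ub_rate.
have KE : K%:R = t'%:R + m%:R :> R by rewrite Kmt natrD.
have : h * (t'%:R * ln t'%:R) <= h * (K%:R * t0%:R) by rewrite ler_wpM2l// ltW.
set KK := K%:R in KE *; rewrite -/KK.
have -> : h * (KK * ln n%:R) = h * (t'%:R * ln n%:R) + h * (m%:R * ln n%:R) by rewrite KE; ring.
have : (h * `|ln (8 * h)|) * KK = h * (t'%:R * `|ln (8 * h)|) + h * (m%:R * `|ln (8 * h)|).
  by rewrite KE; ring.
by lra.
Qed.

End MarginalUpper.

(** * Lower bound, by restriction to a small box *)

Section MarginalLower.
Context (R : realType) (a1 a2 alpha1 alpha2 M rho sig2 : R) (r : nat).
Hypotheses (a1_gt0 : 0 < a1) (a2_gt0 : 0 < a2) (r_gt0 : (0 < r)%N).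
Hypotheses (alpha1_gt0 : 0 < alpha1) (alpha2_gt0 : 0 < alpha2) (M_ge0 : 0 <= M).
Hypotheses (rho_gt0 : 0 < rho) (sig2_gt0 : 0 < sig2).
Notation mu := (@lebesgue_measure R).

Let h : R := r%:R + 2^-1.

Definition marginal_lb_cst (K : nat) : R :=
  expR (- 2^-1) * ((pmom_hi a1 r) ^- K * expR (- (h * K%:R * ln (8 * sig2)))
   * expR (- (a2 * (K%:R * (M + 1) ^+ 2) / sig2)) * ((rho / 2) ^+ (2 * r)) ^+ K)
  * ((Gamma (2^-1))^-1 * expR (- 2^-1) * expR (- (2 * ln 2)))
  * (alpha2 `^ alpha1 / Gamma alpha1 * (4 * sig2) `^ (- (alpha1 + 1))
     * expR (- (2 * alpha2 / sig2))) * (sig2 / 2).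

Lemma marginal_lb_cst_gt0 K : 0 < marginal_lb_cst K.
Proof.
have pi0 := pi_gt0 R.
have hi0 : 0 < pmom_hi a1 r.
  by rewrite mulr_gt0 ?exprn_gt0 ?sqrtr_gt0 ?divr_gt0// ltr0n.
have G1 := @Gamma_gt0 R 2^-1; have G2 := Gamma_gt0 alpha1_gt0.
have r2 : 0 < rho / 2 by rewrite divr_gt0.
have s4 : 0 < 4 * sig2 by rewrite mulr_gt0.
have A0 : 0 < (pmom_hi a1 r) ^- K by rewrite invr_gt0 exprn_gt0.
have A1 : 0 < ((rho / 2) ^+ (2 * r)) ^+ K by rewrite !exprn_gt0.
have A2 : 0 < (Gamma (2^-1 : R))^-1 by rewrite invr_gt0 G1// invr_gt0.
have A3 : 0 < alpha2 `^ alpha1 / Gamma alpha1 by rewrite divr_gt0// powR_gt0.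
have A4 : 0 < (4 * sig2) `^ (- (alpha1 + 1)) by rewrite powR_gt0.
have A5 : 0 < sig2 / 2 by rewrite divr_gt0.
have e0 x := expR_gt0 x : 0 < expR x :> R.
by rewrite /marginal_lb_cst; repeat (assumption || apply: e0 || apply: mulr_gt0).
Qed.

Context (n p : nat) (X : 'M[R]_(n, p)) (A : 'M[R]_p) (k : {set 'I_p}) (y : 'cV[R]_n).
Hypothesis n_gt0 : (0 < n)%N.
Hypothesis hA : forall v : 'cV[R]_p, a1 * sqn v <= dotc v (A *m v) <= a2 * sqn v.
Context (m_ l u : 'I_#|k| -> R) (sh E c' : R).
Hypotheses (E0 : E = sh * n%:R) (E_ge : sig2 / 2 <= sh) (E_le : sh <= 2 * sig2).
Hypothesis c'_ge0 : 0 <= c'.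
Hypothesis m_le : forall j, rho <= `|m_ j| <= M.
Hypothesis lu : forall j, l j <= m_ j <= u j /\ u j - l j = (Num.sqrt n%:R)^-1.
Hypothesis box_small : (Num.sqrt n%:R)^-1 <= Num.min 1 (rho / 2).
Hypothesis key : forall b : #|k|.-tuple R, (forall j, l j <= tnth b j <= u j) ->
  sqn (y - design_sub X k *m col_of_tuple b) <= E + c'.

Let K : nat := #|k|.
Let expnt : R := - (r * #|k|)%:R - #|k|%:R / 2.
Let expntE : expnt = - (h * K%:R).
Proof. by rewrite /expnt /h /K natrM; field. Qed.

Let n0 : 0 < (n%:R : R). Proof. by rewrite ltr0n. Qed.
Let n1 : 1 <= (n%:R : R). Proof. by rewrite ler1n. Qed.
Let sh0 : 0 < sh. Proof. by apply: lt_le_trans E_ge; rewrite divr_gt0. Qed.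
Let shE : E / n%:R = sh. Proof. by rewrite E0 mulfK// gt_eqF. Qed.

Let box_entry (b : #|k|.-tuple R) j : l j <= tnth b j <= u j ->
  rho / 2 <= `|tnth b j| <= M + 1.
Proof.
move=> /andP[lb bu]; have [/andP[lm mu_] ul] := lu j.
move: box_small; rewrite le_min => /andP[h1 h2].
have /andP[mr mM] := m_le j.
have d : `|tnth b j - m_ j| <= (Num.sqrt n%:R)^-1.
  by rewrite ler_norml; apply/andP; split; lra.
have d1 := ler_normB (tnth b j) (tnth b j - m_ j).
have d2 := ler_normD (m_ j) (tnth b j - m_ j).
rewrite subKr in d1; rewrite addrC subrK in d2.
by apply/andP; split; lra.
Qed.

(** Enlarging the variance by the factor [1 + 1/n] beyond its optimum [sh] costs
    [n / 2 * ln (1 + 1/n) <= 1/2], the origin of [expR (- 2^-1)]. The excess [c'] of the residual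
    costs [c' / (2 sh) <= c' / sig2]. *)
Let lik_lb (b : #|k|.-tuple R) s2 : sh <= s2 <= sh * (1 + n%:R^-1) ->
  (forall j, l j <= tnth b j <= u j) ->
  expR (- 2^-1) * expR (log_peak n E - c' / sig2) <= likelihood X y b s2.
Proof.
move=> /andP[s1 s3] hb; have s20 : 0 < s2 by exact: lt_le_trans s1.
rewrite likelihoodE// -expRD ler_expR.
have p0 : 0 < 2 * pi :> R by rewrite mulr_gt0 ?pi_gt0.
have ni : 0 < (n%:R^-1 : R) by rewrite invr_gt0.
have ni1 : 0 < 1 + n%:R^-1 :> R by rewrite addr_gt0.
have l1 : ln s2 <= ln sh + n%:R^-1.
  apply: (@le_trans _ _ (ln (sh * (1 + n%:R^-1)))).
    by rewrite ler_ln ?posrE//; exact: mulr_gt0.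
  rewrite lnM ?posrE// lerD2l; apply: le_trans (ln_leB1 ni1) _.
  by rewrite addrAC subrr add0r.
have e1 : (E + c') / (2 * s2) <= n%:R / 2 + c' / sig2.
  apply: (@le_trans _ _ ((E + c') / (2 * sh))).
    apply: ler_wpM2l; first by rewrite addr_ge0// E0 mulr_ge0// ltW.
    by rewrite lef_pV2 ?posrE ?mulr_gt0//; lra.
  have -> : (E + c') / (2 * sh) = n%:R / 2 + c' * (2 * sh)^-1.
    by rewrite E0; field; rewrite gt_eqF.
  rewrite lerD2l ler_wpM2l// lef_pV2 ?posrE ?mulr_gt0//.
  by have := E_ge; lra.
have q1 : sqn (y - design_sub X k *m col_of_tuple b) / (2 * s2) <= (E + c') / (2 * s2).
  by rewrite ler_wpM2r ?key// invr_ge0 mulr_ge0// ltW.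
rewrite /log_peak shE (lnM p0 s20).
have l2 : n%:R / 2 * ln s2 <= n%:R / 2 * (ln sh + n%:R^-1).
  by rewrite ler_wpM2l// divr_ge0// ltW.
have l3 : n%:R / 2 * (ln sh + n%:R^-1) = n%:R / 2 * ln sh + 2^-1.
  by field; rewrite gt_eqF.
by lra.
Qed.

Let pmom_lb (b : #|k|.-tuple R) tau s2 : n%:R <= tau <= 2 * n%:R ->
  sh <= s2 <= sh * (1 + n%:R^-1) -> (forall j, l j <= tnth b j <= u j) ->
  ((pmom_hi a1 r) ^- K * expR (- (h * K%:R * ln (8 * sig2)))
   * expR (- (a2 * (K%:R * (M + 1) ^+ 2) / sig2)) * ((rho / 2) ^+ (2 * r)) ^+ K)
  * expR (- (h * K%:R * ln n%:R)) <= pmom_pdf r A tau s2 b.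
Proof.
move=> /andP[t1 t2] /andP[s1 s3] hb.
have s20 : 0 < s2 by exact: lt_le_trans s1.
have t0 : 0 < tau by exact: lt_le_trans t1.
have ni1 : n%:R^-1 <= 1 :> R by rewrite invf_le1.
have ss4 : s2 <= 4 * sig2.
  have : sh * (1 + n%:R^-1) <= sh * 2 by rewrite ler_wpM2l ?(ltW sh0)//; lra.
  by have := E_le; lra.
have v1 : tau * s2 <= 8 * sig2 * n%:R.
  have -> : 8 * sig2 * n%:R = (2 * n%:R) * (4 * sig2) by ring.
  by rewrite ler_pM// ltW.
have v2 : sig2 / 2 <= tau * s2.
  apply: (@le_trans _ _ (1 * sh)); first by rewrite mul1r; exact: E_ge.
  by rewrite ler_pM ?(ltW sh0)//; apply: le_trans t1.
have v0 : 0 < tau * s2 by rewrite mulr_gt0.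
rewrite (pmom_pdfE a1_gt0 a2_gt0 r_gt0 hA) -/expnt.
have mass := pmom_mass_gt0 a1_gt0 a2_gt0 r_gt0 hA k.
have /andP[_ massh] := pmom_mass_bounds a1_gt0 a2_gt0 r_gt0 hA k.
have f1 : (pmom_hi a1 r) ^- K <= (pmom_mass A r k)^-1.
  by rewrite lef_pV2 ?posrE// (lt_le_trans mass).
have f2 : expR (- (h * K%:R * ln (8 * sig2))) * expR (- (h * K%:R * ln n%:R)) <= (tau * s2) `^ expnt.
  rewrite /powR (gt_eqF v0) -expRD ler_expR expntE.
  have hK : 0 <= h * K%:R by rewrite mulr_ge0// addr_ge0.
  have : ln (tau * s2) <= ln (8 * sig2) + ln n%:R.
    by rewrite -lnM ?posrE ?mulr_gt0// ler_ln ?posrE ?mulr_gt0.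
  by move/(ler_wpM2l hK); lra.
have f3 : expR (- (a2 * (K%:R * (M + 1) ^+ 2) / sig2)) <= expR (- (prior_qform A b / (2 * (tau * s2)))).
  rewrite ler_expR lerN2.
  have /andP[q1 q2] := prior_qform_bounds hA b.
  have q3 : prior_qform A b <= a2 * (K%:R * (M + 1) ^+ 2).
    apply: le_trans q2 _; rewrite ler_wpM2l ?(ltW a2_gt0)//.
    rewrite mulr_natl -[X in _ *+ X]card_ord -sumr_const; apply: ler_sum => j _.
    have /andP[_ bj] := box_entry (hb j).
    by rewrite -real_normK ?num_real// lerXn2r ?nnegrE ?addr_ge0.
  apply: (@le_trans _ _ (a2 * (K%:R * (M + 1) ^+ 2) / (2 * (tau * s2)))).
    by rewrite ler_wpM2r// invr_ge0 mulr_ge0// ltW.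
  rewrite ler_wpM2l//.
    by rewrite mulr_ge0 ?(ltW a2_gt0)// mulr_ge0// sqr_ge0.
  by rewrite lef_pV2 ?posrE ?mulr_gt0//; lra.
have f4 : ((rho / 2) ^+ (2 * r)) ^+ K <= \prod_(i < #|k|) tnth b i ^+ (2 * r).
  rewrite -[X in _ ^+ X]card_ord -prodr_const; apply: ler_prod => j _.
  have r20 : 0 <= rho / 2 by rewrite divr_ge0// ltW.
  rewrite exprn_ge0//=; have /andP[bj _] := box_entry (hb j).
  rewrite !exprM lerXn2r ?nnegrE ?sqr_ge0//.
  by rewrite -[leRHS]real_normK ?num_real// lerXn2r ?nnegrE.
set hi := _ ^- K in f1 *; set e1 := expR _ in f2 *; set e2 := expR (- (h * K%:R * ln n%:R)) in f2 *.
set e3 := expR _ in f3 *; set e4 := _ ^+ K in f4 *.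
have hi0 : 0 <= hi by rewrite invr_ge0 exprn_ge0// mulr_ge0 ?sqrtr_ge0// exprn_ge0// !divr_ge0// ltW.
have e40 : 0 <= e4 by rewrite exprn_ge0// exprn_ge0// divr_ge0// ltW.
have -> : hi * e1 * e3 * e4 * e2 = hi * (e1 * e2) * e3 * e4 by ring.
have e12 : 0 <= e1 * e2 by rewrite mulr_ge0 ?expR_ge0.
apply: ler_pM => //; first by rewrite mulr_ge0 ?expR_ge0// mulr_ge0.
apply: ler_pM; rewrite ?mulr_ge0 ?expR_ge0//.
exact: ler_pM.
Qed.

Let ig1_lb (tau : R) : n%:R <= tau <= 2 * n%:R ->
  (Gamma (2^-1))^-1 * expR (- 2^-1) * expR (- (2 * ln 2)) * expR (- ln n%:R)
  <= inv_gamma_pdf (1 / 2) (n%:R / 2) tau.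
Proof.
move=> /andP[t1 t2]; have t0 : 0 < tau by exact: lt_le_trans t1.
have G0 : 0 <= (Gamma (2^-1 : R))^-1 by rewrite invr_ge0 ltW// Gamma_gt0.
rewrite /inv_gamma_pdf div1r.
have -> : (n%:R / 2) `^ 2^-1 / Gamma 2^-1 * tau `^ (- (2^-1 + 1)) * expR (- (n%:R / 2 / tau))
  = (Gamma 2^-1)^-1 * (((n%:R / 2) `^ 2^-1 * tau `^ (- (2^-1 + 1))) * expR (- (n%:R / 2 / tau))) by ring.
rewrite -!mulrA ler_wpM2l// -!expRD.
rewrite /powR !gt_eqF ?divr_gt0// -!expRD ler_expR.
have l1 : ln tau <= ln 2 + ln n%:R.
  by rewrite -lnM ?posrE// ler_ln ?posrE ?mulr_gt0.
rewrite ln_div ?posrE//.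
have e : n%:R / 2 / tau <= 2^-1.
  by rewrite ler_pdivrMr//; lra.
by lra.
Qed.

Let ig2_lb (s2 : R) : sh <= s2 <= sh * (1 + n%:R^-1) ->
  alpha2 `^ alpha1 / Gamma alpha1 * (4 * sig2) `^ (- (alpha1 + 1))
     * expR (- (2 * alpha2 / sig2)) <= inv_gamma_pdf alpha1 alpha2 s2.
Proof.
move=> /andP[s1 s3]; have s20 : 0 < s2 by exact: lt_le_trans s1.
have ni1 : n%:R^-1 <= 1 :> R by rewrite invf_le1.
have ss4 : s2 <= 4 * sig2.
  have : sh * (1 + n%:R^-1) <= sh * 2 by rewrite ler_wpM2l ?(ltW sh0)//; lra.
  by have := E_le; lra.
have ig : 0 <= alpha2 `^ alpha1 / Gamma alpha1.
  by rewrite divr_ge0 ?powR_ge0// ltW// Gamma_gt0.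
rewrite /inv_gamma_pdf; apply: ler_pM; rewrite ?expR_ge0//.
  by apply: mulr_ge0 => //; exact: powR_ge0.
  rewrite ler_wpM2l// /powR !gt_eqF// ?mulr_gt0// ler_expR.
  have : ln s2 <= ln (4 * sig2) by rewrite ler_ln ?posrE ?mulr_gt0.
  have a10 : 0 <= alpha1 + 1 by rewrite addr_ge0// ltW.
  by move/(ler_wpM2l a10); lra.
rewrite ler_expR lerN2.
have -> : 2 * alpha2 / sig2 = alpha2 / (sig2 / 2) by field; rewrite gt_eqF.
rewrite ler_wpM2l ?(ltW alpha2_gt0)// lef_pV2 ?posrE ?divr_gt0//.
by apply: le_trans s1; exact: E_ge.
Qed.

Let igp_ge0 (a b x : R) : 0 < a -> 0 <= inv_gamma_pdf a b x.
Proof.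
by move=> a0; rewrite /inv_gamma_pdf !mulr_ge0 ?powR_ge0 ?expR_ge0// invr_ge0 ltW// Gamma_gt0.
Qed.

(** The box is [tau] in [[n, 2n]], the variance in [[sh, sh (1 + 1/n)]] and each coefficient in an
    interval of length [n^(-1/2)]. The length [n] for [tau] offsets the size [n^-1] of its density
    there, the variance interval costs [n^-1], and each coefficient costs [n^(-1/2)] by its length
    and [n^-(r+1/2)] by the prior scale. *)
Lemma marginal_integral_lb :
  ((marginal_lb_cst K * expR (log_peak n E - c' / sig2 - (r%:R + 1) * K%:R * ln n%:R - ln n%:R))%:E
   <= marginal_integral alpha1 alpha2 r X A k y)%E.
Proof.
pose c1 := expR (- 2^-1) * expR (log_peak n E - c' / sig2).
pose c2 := ((pmom_hi a1 r) ^- K * expR (- (h * K%:R * ln (8 * sig2)))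
   * expR (- (a2 * (K%:R * (M + 1) ^+ 2) / sig2)) * ((rho / 2) ^+ (2 * r)) ^+ K)
  * expR (- (h * K%:R * ln n%:R)).
pose c3 : R := (Gamma (2^-1))^-1 * expR (- 2^-1) * expR (- (2 * ln 2)) * expR (- ln n%:R).
pose c4 := alpha2 `^ alpha1 / Gamma alpha1 * (4 * sig2) `^ (- (alpha1 + 1))
     * expR (- (2 * alpha2 / sig2)).
have c10 : 0 <= c1 by rewrite mulr_ge0 ?expR_ge0.
have c20 : 0 <= c2.
  rewrite mulr_ge0 ?expR_ge0// mulr_ge0 ?exprn_ge0 ?divr_ge0 ?(ltW rho_gt0)//.
  rewrite mulr_ge0 ?expR_ge0// mulr_ge0 ?expR_ge0// invr_ge0 exprn_ge0//.
  by rewrite mulr_ge0 ?sqrtr_ge0// exprn_ge0// !divr_ge0// ltW.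
have c30 : 0 <= c3 by rewrite !mulr_ge0 ?expR_ge0// invr_ge0 ltW// Gamma_gt0.
have c40 : 0 <= c4 by rewrite !mulr_ge0 ?expR_ge0 ?powR_ge0// invr_ge0 ltW// Gamma_gt0.
pose L : R := (Num.sqrt n%:R) ^- K.
have L0 : 0 <= L by rewrite invr_ge0 exprn_ge0// sqrtr_ge0.
have int0 (b : #|k|.-tuple R) (tau s2 : R) : 0 < s2 ->
  0 <= likelihood X y b s2 * pmom_pdf r A tau s2 b
           * inv_gamma_pdf (1 / 2) (n%:R / 2) tau * inv_gamma_pdf alpha1 alpha2 s2.
  move=> s20; apply: mulr_ge0; last exact: igp_ge0.
  apply: mulr_ge0; last by apply: igp_ge0; rewrite divr_gt0.
  apply: mulr_ge0; first by rewrite likelihoodE// expR_ge0.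
  exact: (pmom_pdf_ge0 _ _ _ a1_gt0 a2_gt0 r_gt0 hA).
have inner (tau s2 : R) : n%:R <= tau <= 2 * n%:R -> sh <= s2 <= sh * (1 + n%:R^-1) ->
  ((c1 * c2 * c3 * c4 * L)%:E <= \int[@lebesgue_tuple R #|k|]_b
          (likelihood X y b s2 * pmom_pdf r A tau s2 b
           * inv_gamma_pdf (1 / 2) (n%:R / 2) tau
           * inv_gamma_pdf alpha1 alpha2 s2)%:E)%E.
  move=> ht hs.
  have s20 : 0 < s2 by have /andP[s1 _] := hs; exact: lt_le_trans s1.
  have -> : L = \prod_j (u j - l j).
    rewrite (eq_bigr (fun=> (Num.sqrt n%:R)^-1)); last by move=> j _; have [_ ->] := lu j.
    by rewrite prodr_const card_ord exprVn.
  apply: integral_lebesgue_tuple_box.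
  - by move=> j; have [/andP[h1 h2] _] := lu j; exact: le_trans h2.
  - by rewrite mulr_ge0// mulr_ge0// mulr_ge0.
  - by move=> b; exact: int0.
  move=> b hb; apply: ler_pM => //; [by rewrite mulr_ge0// mulr_ge0| |exact: ig2_lb].
  apply: ler_pM => //; [by rewrite mulr_ge0| |exact: ig1_lb].
  by apply: ler_pM => //; [exact: lik_lb|exact: pmom_lb].
have shn : sh <= sh * (1 + n%:R^-1).
  by rewrite ler_peMr ?(ltW sh0)// lerDl invr_ge0 ltW.
have C0 : 0 <= c1 * c2 * c3 * c4 * L by rewrite mulr_ge0// mulr_ge0// mulr_ge0// mulr_ge0.
have itv (x z : R) : x <= z -> mu `[x, z]%classic = (z - x)%:E.
  move=> xz; rewrite lebesgue_measure_itv/= lte_fin; case: ltrP => [//|h'].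
  by congr EFin; lra.
have mid (tau : R) : n%:R <= tau <= 2 * n%:R ->
  ((c1 * c2 * c3 * c4 * L * (sh / n%:R))%:E <=
   \int[mu]_(s2 in `]0%R, +oo[) \int[@lebesgue_tuple R #|k|]_b
          (likelihood X y b s2 * pmom_pdf r A tau s2 b
           * inv_gamma_pdf (1 / 2) (n%:R / 2) tau
           * inv_gamma_pdf alpha1 alpha2 s2)%:E)%E.
  move=> ht; have m12 : measurable (`[sh, sh * (1 + n%:R^-1)]%classic : set (measurableTypeR R)).
    exact: measurable_itv.
  have e : mu `[sh, sh * (1 + n%:R^-1)]%classic = (sh / n%:R)%:E.
    by rewrite itv//; congr EFin; ring.
  rewrite EFinM -[X in (_ * X <= _)%E]e.
  apply: (@integral_ge_subset _ _ _ mu _ _ _ (c1 * c2 * c3 * c4 * L)%:E m12).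
  - by move=> x/=; rewrite !in_itv/= andbT => /andP[h1 _]; exact: lt_le_trans h1.
  - by rewrite lee_fin.
  - move=> s2 /=; rewrite in_itv/= andbT => s20; apply: integral_ge0 => b _.
    by rewrite lee_fin int0.
  - by move=> s2 /=; rewrite in_itv/= => hs; exact: inner.
have D0 : 0 <= c1 * c2 * c3 * c4 * L * (sh / n%:R).
  by rewrite mulr_ge0// divr_ge0// ltW.
apply: (@le_trans _ _ ((c1 * c2 * c3 * c4 * L * (sh / n%:R))%:E * n%:R%:E)%E); last first.
  have m12 : measurable (`[n%:R, 2 * n%:R]%classic : set (measurableTypeR R)).
    exact: measurable_itv.
  have e : mu `[n%:R, 2 * n%:R]%classic = n%:R%:E.
    by rewrite itv; [congr EFin; ring|rewrite ler_peMl// ?(ltW n0)// ler1n].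
  rewrite -[X in (_ * X <= _)%E]e.
  apply: (@integral_ge_subset _ _ _ mu _ _ _ (c1 * c2 * c3 * c4 * L * (sh / n%:R))%:E m12).
  - by move=> x/=; rewrite !in_itv/= andbT => /andP[h1 _]; exact: lt_le_trans h1.
  - by rewrite lee_fin.
  - move=> tau /=; rewrite in_itv/= andbT => tau0.
    apply: integral_ge0 => s2 /=; rewrite in_itv/= andbT => s20; apply: integral_ge0 => b _.
    by rewrite lee_fin int0.
  - by move=> tau /=; rewrite in_itv/= => ht; exact: mid.
rewrite -EFinM lee_fin.
have LE : L = expR (- (K%:R / 2 * ln n%:R)) by rewrite /L sqrt_expN.
have nE : expR (- ln n%:R) = (n%:R : R)^-1 by rewrite expRN lnK.
set F := c1 * c2 * c3 * c4 * L.
have -> : F * (sh / n%:R) * n%:R = F * sh by field; rewrite gt_eqF.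
apply: (@le_trans _ _ (F * (sig2 / 2))); last by rewrite ler_wpM2l//; exact: E_ge.
rewrite /F LE /c1 /c2 /c3 /marginal_lb_cst -/c4 -/K.
set X1 := expR (- 2^-1); set X2 := _ ^- K; set X3 := expR (- (h * K%:R * ln (8 * sig2))).
have -> : expR (log_peak n E - c' / sig2 - (r%:R + 1) * K%:R * ln n%:R - ln n%:R) =
  expR (log_peak n E - c' / sig2) * expR (- (h * K%:R * ln n%:R)) * expR (- ln n%:R) * expR (- (K%:R / 2 * ln n%:R)).
  by rewrite -!expRD; congr expR; rewrite /h; field; rewrite gt_eqF.
by rewrite le_eqVlt; apply/orP; left; apply/eqP; ring.
Qed.

End MarginalLower.

(** * Measurability of the marginal density in the data *)

Section Measurability.
Context (R : realType) (n p : nat) (X : 'M[R]_(n, p)) (A : 'M[R]_p) (k : {set 'I_p}).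
Context (r : nat) (alpha1 alpha2 : R).
Hypotheses (alpha1_gt0 : 0 < alpha1) (alpha2_gt0 : 0 < alpha2).
Hypothesis pmom_ge0 : forall tau s2 b, 0 <= pmom_pdf (k := k) r A tau s2 b.
Context (d : measure_display) (T : measurableType d) (y : T -> 'cV[R]_n).
Hypothesis my : forall i, measurable_fun setT (fun w => y w i 0).
Notation mu := (@lebesgue_measure R).

Let Z := (T * R * R * #|k|.-tuple R)%type.
Let tau_ (z : Z) : R := z.1.1.2.
Let s2_ (z : Z) : R := z.1.2.
Let b_ (z : Z) : #|k|.-tuple R := z.2.
Let w_ (z : Z) : T := z.1.1.1.

Let mtau : measurable_fun setT tau_.
Proof.
apply: (measurableT_comp (@measurable_snd _ _ T R)).
by apply: (measurableT_comp (@measurable_fst _ _ (T * R)%type R)); exact: measurable_fst.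
Qed.
Let ms2 : measurable_fun setT s2_.
Proof. by apply: (measurableT_comp (@measurable_snd _ _ (T * R)%type R)); exact: measurable_fst. Qed.
Let mb : measurable_fun setT b_.
Proof. exact: measurable_snd. Qed.
Let mw : measurable_fun setT w_.
Proof.
apply: (measurableT_comp (@measurable_fst _ _ T R)).
by apply: (measurableT_comp (@measurable_fst _ _ (T * R)%type R)); exact: measurable_fst.
Qed.

Let mexp (f : Z -> R) : measurable_fun setT f -> measurable_fun setT (fun z => expR (f z)).
Proof. by move=> mf; apply: measurableT_comp mf; exact: measurable_expR. Qed.
Let mopp (f : Z -> R) : measurable_fun setT f -> measurable_fun setT (fun z => - f z).
Proof. by move=> mf; apply: measurableT_comp. Qed.
Let mcst (c : R) : measurable_fun setT (fun _ : Z => c).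
Proof. exact: measurable_cst. Qed.
Let minv (f : Z -> R) : measurable_fun setT f -> measurable_fun setT (fun z => (f z)^-1).
Proof. by move=> mf; exact: (measurableT_comp (@measurable_inv R) mf). Qed.
Let mpow (f : Z -> R) a : measurable_fun setT f -> measurable_fun setT (fun z => f z `^ a).
Proof. by move=> mf; exact: (measurableT_comp (@measurable_powR R a) mf). Qed.

Let ig (a c x : R) : R := c `^ a / Gamma a * x `^ (- (a + 1)) * expR (- (c / x)).

(** The half lines become indicators, so that the marginal is an iterated integral over full spaces
    and Tonelli gives measurability three times. The likelihood appears in the closed form that is
    valid for a positive variance. *)
Let G (z : Z) : R :=
  \1_(`]0, +oo[%classic : set R) (tau_ z) * \1_(`]0, +oo[%classic : set R) (s2_ z) *
  (expR (- (n%:R / 2 * ln (2 * pi * s2_ z))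
    - sqn (y (w_ z) - design_sub X k *m col_of_tuple (b_ z)) / (2 * s2_ z))
   * pmom_pdf r A (tau_ z) (s2_ z) (b_ z)
   * inv_gamma_pdf (1 / 2) (n%:R / 2) (tau_ z)
   * inv_gamma_pdf alpha1 alpha2 (s2_ z)).

Let mG : measurable_fun setT (fun z => (G z)%:E).
Proof.
have mi : measurable_fun setT (\1_(`]0, +oo[%classic : set R) : R -> R).
  by apply: measurable_indic; exact: measurable_itv.
have mbj j : measurable_fun setT (fun z => tnth (b_ z) j).
  by apply: (measurableT_comp (measurable_tnth j)).
apply/measurable_EFinP; apply: measurable_funM.
  by apply: measurable_funM; [apply: (measurableT_comp mi)|apply: (measurableT_comp mi)].
apply: measurable_funM; last first.
  apply: measurable_funM; first by apply: measurable_funM; [exact: mcst|exact: mpow].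
  by apply: mexp; apply: mopp; apply: measurable_funM; [exact: mcst|exact: minv].
apply: measurable_funM; last first.
  apply: measurable_funM; first by apply: measurable_funM; [exact: mcst|exact: mpow].
  by apply: mexp; apply: mopp; apply: measurable_funM; [exact: mcst|exact: minv].
apply: measurable_funM.
  apply: mexp; apply: measurable_funB.
    apply: mopp; apply: measurable_funM; first exact: mcst.
    apply: measurableT_comp; first exact: measurable_ln.
    by apply: measurable_funM; [exact: mcst|exact: ms2].
  apply: measurable_funM; last first.
    by apply: minv; apply: measurable_funM; [exact: mcst|exact: ms2].
  apply: measurable_fun_sumr => i; apply: measurable_funX.
  rewrite (_ : (fun _ => _) = (fun z => y (w_ z) i 0 - \sum_j design_sub X k i j * tnth (b_ z) j)).
    apply: measurable_funB; first by apply: (measurableT_comp (my i)).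
    by apply: measurable_fun_sumr => j; apply: measurable_funM; [exact: mcst|exact: mbj].
  by apply/funext => z; rewrite !mxE; congr (_ - _); apply: eq_bigr => j _; rewrite !mxE.
have mts : measurable_fun setT (fun z => tau_ z * s2_ z).
  by apply: measurable_funM; [exact: mtau|exact: ms2].
apply: measurable_funM; first exact: mcst.
apply: measurable_funM; last exact: (measurableT_comp (@measurable_prod_pow R r #|k|) mb).
apply: measurable_funM.
  apply: measurable_funM; last exact: mcst.
  by apply: measurable_funM; [exact: mcst|exact: mpow].
apply: mexp; apply: mopp; apply: measurable_funM.
  exact: (measurableT_comp (@measurable_prior_qform R p A k) mb).
by apply: minv; apply: measurable_funM; [exact: mcst|exact: mts].
Qed.

Let igp_ge0 (a b x : R) : 0 < a -> 0 <= inv_gamma_pdf a b x.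
Proof.
by move=> a0; rewrite /inv_gamma_pdf !mulr_ge0 ?powR_ge0 ?expR_ge0// invr_ge0 ltW// Gamma_gt0.
Qed.

Let G0 z : (0 <= (G z)%:E)%E.
Proof.
rewrite lee_fin; apply: mulr_ge0; first by rewrite mulr_ge0// indicE.
apply: mulr_ge0; last exact: igp_ge0.
apply: mulr_ge0; last by apply: igp_ge0; rewrite divr_gt0.
by apply: mulr_ge0; [exact: expR_ge0|exact: pmom_ge0].
Qed.

Let F1 (x : T * R * R) : \bar R := (\int[@lebesgue_tuple R #|k|]_b (G (x, b))%:E)%E.
Let F2 (x : T * R) : \bar R := (\int[mu]_s2 F1 (x, s2))%E.
Let F3 (x : T) : \bar R := (\int[mu]_tau F2 (x, tau))%E.

Let mF1 : measurable_fun setT F1.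
Proof. exact: (measurable_fun_fubini_tonelli_F (m2 := @lebesgue_tuple R #|k|) _ mG G0). Qed.
Let F10 x : (0 <= F1 x)%E. Proof. by apply: integral_ge0 => b _; exact: G0. Qed.
Let mF2 : measurable_fun setT F2.
Proof. exact: (measurable_fun_fubini_tonelli_F (m2 := mu) _ mF1 F10). Qed.
Let F20 x : (0 <= F2 x)%E. Proof. by apply: integral_ge0 => b _; exact: F10. Qed.
Let mF3 : measurable_fun setT F3.
Proof. exact: (measurable_fun_fubini_tonelli_F (m2 := mu) _ mF2 F20). Qed.

Let F3E w : marginal_integral alpha1 alpha2 r X A k (y w) = F3 w.
Proof.
rewrite /marginal_integral integral_mkcond; apply: eq_integral => tau _.
rewrite /F2 /patch; case: ifPn => [tau0|tau0].
  rewrite integral_mkcond; apply: eq_integral => s2 _; rewrite /F1 /patch.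
  case: ifPn => [s20|s20].
    apply: eq_integral => b _; congr EFin; rewrite /G /tau_ /s2_ /b_ /w_/= !indicE tau0 s20 !mul1r.
    move: s20 => /set_mem/=; rewrite in_itv/= andbT => s20.
    by rewrite likelihoodE.
  rewrite [RHS]integral0_eq// => b _; rewrite /G /tau_ /s2_ /b_ /w_/= !indicE (negbTE s20).
  by rewrite mulr0 mul0r.
rewrite [RHS]integral0_eq// => s2 _; rewrite /F1 integral0_eq// => b _.
by rewrite /G /tau_ /s2_ /b_ /w_/= !indicE (negbTE tau0) !mul0r.
Qed.

Lemma measurable_marginal :
  measurable_fun setT (fun w => marginal r alpha1 alpha2 X A (y w) k).
Proof.
have -> : (fun w => marginal r alpha1 alpha2 X A (y w) k) = fine \o F3.
  by apply/funext => w /=; rewrite -F3E.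
by apply: measurableT_comp => //; exact: fine_measurable.
Qed.

End Measurability.

(** * Deterministic bounds on the residual sum of squares *)

Section KeyInequalities.
Context (R : realType) (n p : nat) (X : 'M[R]_(n, p)) (B : 'cV[R]_p) (e : 'cV[R]_n) (ep : R).
Hypotheses (n_gt0 : (0 < n)%N) (ep_gt0 : 0 < ep).

Lemma residual_ext (k : {set 'I_p}) (b : #|k|.-tuple R) :
  X *m B + e - design_sub X k *m col_of_tuple b
  = e - X *m (ext_col (col_of_tuple b) - B).
Proof. by rewrite design_sub_ext mulmxBr opprB addrA (addrC e). Qed.

Lemma sqn_ext_sub (k : {set 'I_p}) (b : #|k|.-tuple R) :
  sqn (ext_col (col_of_tuple b) - B) =
  \sum_j (tnth b j - B (enum_val j) 0) ^+ 2 + \sum_(i | i \notin k) B i 0 ^+ 2.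
Proof.
rewrite /sqn (bigID (mem k))/=; congr (_ + _).
  rewrite big_enum_val; apply: eq_bigr => j _.
  by rewrite [X in X ^+ 2]mxE ext_col_enum_val !mxE.
apply: eq_bigr => i ik; rewrite [X in X ^+ 2]mxE ext_col_supported// add0r mxE.
by rewrite sqrrN.
Qed.

(** The residual is [e - X v] with [v] supported in [k] and the true support. The cross term is
    bounded by [q / (1 - th)] plus the share [1 - th] of [|X v|^2]. The remaining share is at least
    [th n ep |v|^2], and [|v|^2] splits into the deviations on [k] and the true coefficients that
    [k] misses. *)
Lemma residual_lower_bound (k : {set 'I_p}) (q th D : R) (b : #|k|.-tuple R) :
  0 < th < 1 -> 0 <= q ->
  (forall v, supported (k :|: [set i | B i 0 != 0%R])%SET v ->
     dotc e (X *m v) ^+ 2 <= q * sqn (X *m v) /\ n%:R * ep * sqn v <= sqn (X *m v)) ->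
  D <= \sum_(i | i \notin k) B i 0 ^+ 2 ->
  sqn e - q / (1 - th) + th * (n%:R * ep) * D
   + th * (n%:R * ep) * \sum_j (tnth b j - B (enum_val j) 0) ^+ 2
  <= sqn (X *m B + e - design_sub X k *m col_of_tuple b).
Proof.
move=> /andP[th0 th1] q0 hv hD; rewrite residual_ext.
set v := ext_col _ - B.
have sv : supported (k :|: [set i | B i 0 != 0%R])%SET v.
  move=> i; rewrite finset.inE negb_or => /andP[ik]; rewrite finset.inE negbK => /eqP Bi.
  by rewrite mxE ext_col_supported// mxE Bi subr0.
have [h1 h2] := hv v sv.
rewrite sqnB; set s := sqn (X *m v) in h1 h2 *; set dd := dotc e _ in h1 *.
have s0 : 0 <= s by exact: sqn_ge0.
have n0 : 0 < n%:R * ep by rewrite mulr_gt0 ?ltr0n.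
have tt : 0 < 1 - th by lra.
(* Arithmetic-geometric mean: [z] and [z2] have product [q s], so
   [(2 dd)^2 <= 4 z z2 <= (z + z2)^2]. *)
have cross : 2 * dd <= q / (1 - th) + (1 - th) * s.
  set z := q / (1 - th); set z2 := (1 - th) * s.
  have z0 : 0 <= z by rewrite divr_ge0// ltW.
  have z20 : 0 <= z2 by rewrite mulr_ge0// ltW.
  have zz : z * z2 = q * s by rewrite /z /z2; field; rewrite gt_eqF.
  rewrite -zz in h1.
  case: (lerP dd 0) => [dd0|dd0]; first lra.
  have w1 : 0 <= 2 * dd by lra.
  have w2 : 0 <= z + z2 by lra.
  rewrite -(@ler_pXn2r _ 2)//; have := sqr_ge0 (z - z2); lra.
have hD2 : th * (n%:R * ep) * D <= th * (n%:R * ep) * \sum_(i | i \notin k) B i 0 ^+ 2.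
  by rewrite ler_wpM2l// mulr_ge0 ?ltW.
have hs : th * (n%:R * ep * sqn v) <= th * s by rewrite ler_wpM2l// ltW.
rewrite sqn_ext_sub in hs; lra.
Qed.

(* The side on which the box extends follows the sign of [X^T e], which makes the
   cross term of the residual nonpositive. *)
Definition box_lo (j : 'I_#|[set i | B i 0 != 0%R]%SET|) : R :=
  let i := enum_val j in
  B i 0 - (if 0 <= (X^T *m e) i 0 then 0 else (Num.sqrt n%:R)^-1).

(** The cross term only decreases the residual on this box, so the excess over [sqn e] is [|X v|^2],
    with [|v|^2] at most the support size divided by [n]. *)
Lemma residual_upper_bound (b : #|[set i | B i 0 != 0%R]%SET|.-tuple R) :
  (forall v : 'cV_p, sqn (X *m v) <= n%:R / ep * sqn v) ->
  (forall j, box_lo j <= tnth b j <= box_lo j + (Num.sqrt n%:R)^-1) ->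
  sqn (X *m B + e - design_sub X [set i | B i 0 != 0%R]%SET *m col_of_tuple b)
  <= sqn e + #|[set i | B i 0 != 0%R]%SET|%:R / ep.
Proof.
move=> hX hb; rewrite residual_ext; set v := _ - B.
have n0 : 0 < (n%:R : R) by rewrite ltr0n.
have q0 : 0 < (Num.sqrt n%:R)^-1 :> R by rewrite invr_gt0 sqrtr_gt0.
have vE (i : 'I_p) : i \notin [set i | B i 0 != 0%R]%SET -> v i 0 = 0.
  move=> iB; rewrite mxE ext_col_supported// mxE.
  by move: iB; rewrite finset.inE negbK => /eqP ->; rewrite subr0.
have dot0 : 0 <= dotc e (X *m v).
  rewrite dotcC dotc_mull dotcC /dotc (bigID (mem [set i | B i 0 != 0%R]%SET))/=.
  rewrite [X in _ + X]big1 ?addr0 => [|i iB]; last by rewrite vE// mulr0.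
  rewrite big_enum_val; apply: sumr_ge0 => j _.
  rewrite [v _ _]mxE ext_col_enum_val !mxE.
  have := hb j; rewrite /box_lo mxE; case: ifPn => [h|]; last rewrite -ltNge => h.
    by rewrite subr0 => /andP[h1 _]; rewrite mulr_ge0// subr_ge0.
  move=> /andP[_ h2]; rewrite mulr_le0// ?(ltW h)// subr_le0.
  by apply: le_trans h2 _; rewrite subrK.
rewrite sqnB.
have sv : sqn v <= #|[set i | B i 0 != 0%R]%SET|%:R / n%:R.
  rewrite sqn_ext_sub [X in _ + X]big1 ?addr0 => [|i]; last first.
    by rewrite finset.inE negbK => /eqP ->; rewrite expr0n.
  rewrite -[X in X%:R / _]card_ord mulr_natl -sumr_const; apply: ler_sum => j _.
  have -> : n%:R^-1 = (Num.sqrt n%:R)^-1 ^+ 2 :> R by rewrite exprVn sqr_sqrtr// ltW.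
  rewrite -real_normK ?num_real// lerXn2r ?nnegrE ?normr_ge0 ?(ltW q0)//.
  have := hb j; rewrite /box_lo ler_norml; case: ifP => _ /andP[h1 h2];
    by apply/andP; split; lra.
have := hX v; have : n%:R / ep * sqn v <= n%:R / ep * (#|[set i | B i 0 != 0%R]%SET|%:R / n%:R).
  by rewrite ler_wpM2l// divr_ge0// ltW.
have -> : n%:R / ep * (#|[set i | B i 0 != 0%R]%SET|%:R / n%:R) = #|[set i | B i 0 != 0%R]%SET|%:R / ep.
  by field; rewrite !gt_eqF.
by lra.
Qed.

Lemma box_lo_bounds j :
  box_lo j <= B (enum_val j) 0 <= box_lo j + (Num.sqrt n%:R)^-1.
Proof.
have q0 : 0 <= (Num.sqrt n%:R)^-1 :> R by rewrite invr_ge0 sqrtr_ge0.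
by rewrite /box_lo; case: ifP => _; apply/andP; split; lra.
Qed.

End KeyInequalities.

(** This fixes the order of quantifiers: the constants depend on the hyperparameters, [M] and [t0]
    but not on the sample size, the design or the model. Absolute values make them nonnegative. *)
Lemma marginal_ub_ex (R : realType) (a1 a2 alpha1 alpha2 M : R) (r t0 : nat) :
  0 < a1 -> 0 < a2 -> (0 < r)%N -> 0 < alpha1 -> 0 < alpha2 -> 0 <= M ->
  exists C c : R, [/\ 0 <= C, 0 <= c &
  forall n p (X : 'M[R]_(n, p)) (A : 'M[R]_p) (k : {set 'I_p}) (y : 'cV[R]_n)
    (m_ : 'I_#|k| -> R) (S kap : R), (0 < n)%N ->
   (forall v : 'cV[R]_p, a1 * sqn v <= dotc v (A *m v) <= a2 * sqn v) ->
   0 < S -> 1 <= kap -> (forall j, `|m_ j| <= M) ->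
   (#|[set j | m_ j != 0%R]%SET| <= t0)%N ->
   (forall b : #|k|.-tuple R, S + kap * \sum_j (tnth b j - m_ j) ^+ 2
      <= sqn (y - design_sub X k *m col_of_tuple b)) ->
   (marginal_integral alpha1 alpha2 r X A k y <=
    (C * expR (c * #|k|%:R
     - (#|k|%:R / 2 + (r * #|[set j | m_ j == 0%R]%SET|)%:R) * ln kap
     - (r%:R + 2^-1) * (#|k|%:R * ln n%:R)
     + (r%:R + 2^-1) * (#|[set j | m_ j == 0%R]%SET|%:R * ln #|[set j | m_ j == 0%R]%SET|%:R)
     + ln n%:R / 10 + log_peak n S))%:E)%E].
Proof.
move=> a10 a20 r0 al1 al2 M0.
exists `|marginal_ub_cst alpha1 alpha2|, `|marginal_ub_rate a2 alpha2 M r t0|.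
split=> // n p X A k y m_ S kap n0 hA S0 kap1 mM mt key.
apply: le_trans (marginal_integral_ub a10 a20 r0 al1 al2 M0 n0 hA S0 kap1 mM mt key) _.
rewrite lee_fin; apply: le_trans (ler_wpM2r (expR_ge0 _) (ler_norm _)) _.
by rewrite ler_wpM2l// ler_expR -!addrA lerD2r ler_wpM2r// ler_norm.
Qed.

(** * Ratios of marginal densities *)

Lemma card_enum_val_set (I : finType) (k : {set I}) (Pr : pred I) :
  #|[set j : 'I_#|k| | Pr (enum_val j)]%SET| = #|[set i in k | Pr i]%SET|.
Proof.
rewrite -sum1_card -[RHS]sum1_card (eq_bigl (fun j => Pr (enum_val j))); last first.
  by move=> j; rewrite finset.inE.
rewrite [RHS](eq_bigl (fun i => (i \in k) && Pr i)); last by move=> i; rewrite finset.inE.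
by rewrite big_mkcond [RHS]big_mkcondr/= [RHS]big_enum_val.
Qed.

Section MarginalRatio.
Context (R : realType) (a1 a2 alpha1 alpha2 M rho s : R) (r t0 : nat).
Hypotheses (a1_gt0 : 0 < a1) (a2_gt0 : 0 < a2) (r_gt0 : (0 < r)%N).
Hypotheses (alpha1_gt0 : 0 < alpha1) (alpha2_gt0 : 0 < alpha2) (M_ge0 : 0 <= M).
Hypotheses (rho_gt0 : 0 < rho) (s_gt0 : 0 < s).

Lemma marginal_lb_uniform : exists2 c : R, 0 < c &
  forall K, (K <= t0)%N -> c <= marginal_lb_cst a1 a2 alpha1 alpha2 M rho s r K.
Proof.
have pos K : 0 < marginal_lb_cst a1 a2 alpha1 alpha2 M rho s r K.
  exact: marginal_lb_cst_gt0.
elim: t0 => [|m [c c0 hc]].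
  exists (marginal_lb_cst a1 a2 alpha1 alpha2 M rho s r 0); first exact: pos.
  by move=> K; rewrite leqn0 => /eqP ->.
exists (Num.min c (marginal_lb_cst a1 a2 alpha1 alpha2 M rho s r m.+1)).
  by rewrite lt_min c0 pos.
move=> K; rewrite leq_eqVlt => /predU1P[->|]; first by rewrite ge_min lexx orbT.
by rewrite ltnS => /hc h; rewrite ge_min h.
Qed.

Lemma marginal_integral_ge0 n p (X : 'M[R]_(n, p)) (A : 'M[R]_p) (y : 'cV[R]_n) k : (0 < n)%N ->
  (forall v : 'cV[R]_p, a1 * sqn v <= dotc v (A *m v) <= a2 * sqn v) ->
  (0 <= marginal_integral alpha1 alpha2 r X A k y)%E.
Proof.
move=> n0 hA; have n0' : 0 < (n%:R : R) by rewrite ltr0n.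
apply: integral_ge0 => tau _; apply: integral_ge0 => s2 /=; rewrite in_itv/= andbT => s20.
apply: integral_ge0 => b _; rewrite lee_fin.
have igp (a b' x : R) : 0 < a -> 0 <= inv_gamma_pdf a b' x.
  by move=> a0; rewrite /inv_gamma_pdf !mulr_ge0 ?powR_ge0 ?expR_ge0// invr_ge0 ltW// Gamma_gt0.
apply: mulr_ge0; last exact: igp.
apply: mulr_ge0; last by apply: igp; rewrite divr_gt0.
apply: mulr_ge0; first by rewrite likelihoodE// expR_ge0.
exact: (pmom_pdf_ge0 _ _ _ a1_gt0 a2_gt0 r_gt0 hA).
Qed.

Lemma marginal_ge0 n p (X : 'M[R]_(n, p)) (A : 'M[R]_p) (y : 'cV[R]_n) k : (0 < n)%N ->
  (forall v : 'cV[R]_p, a1 * sqn v <= dotc v (A *m v) <= a2 * sqn v) ->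
  0 <= marginal r alpha1 alpha2 X A y k.
Proof. by move=> n0 hA; exact: fine_ge0 (marginal_integral_ge0 X y k n0 hA). Qed.

Definition ratio_exponent (c ep th E S : R) (n tK T m : nat) : R :=
  (c + (r%:R + 1) * - ln (th * ep)) * (T + m)%:R
  + (r%:R + 1) * (tK%:R - T%:R) * ln n%:R
  - (2 * r%:R + 1) * (m%:R * ln n%:R) + (r%:R + 2^-1) * (m%:R * ln m%:R)
  + 11 / 10 * ln n%:R + tK%:R / (ep * s) + n%:R / 2 * ((E - S) / S).

Lemma marginal_ratio_ex : exists C c : R, [/\ 0 <= C, 0 <= c &
  forall n p (X : 'M[R]_(n, p)) (A : 'M[R]_p) (B : 'cV[R]_p) (e : 'cV[R]_n)
    (ep th q D : R) (k : {set 'I_p}),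
  let tm := [set i | B i 0 != 0%R]%SET in
  let y := X *m B + e in
  let S := sqn e - q / (1 - th) + th * (n%:R * ep) * D in
  (0 < n)%N -> (Num.sqrt n%:R)^-1 <= Num.min 1 (rho / 2) ->
  0 < ep < 1 -> 0 < th < 1 -> 1 <= th * (n%:R * ep) -> 0 <= q ->
  (forall v : 'cV[R]_p, a1 * sqn v <= dotc v (A *m v) <= a2 * sqn v) ->
  (forall v : 'cV[R]_p, sqn (X *m v) <= n%:R / ep * sqn v) ->
  (forall v, supported (k :|: tm)%SET v ->
     dotc e (X *m v) ^+ 2 <= q * sqn (X *m v) /\ n%:R * ep * sqn v <= sqn (X *m v)) ->
  (forall i, `|B i 0| <= M) -> (forall i, B i 0 != 0 -> rho <= `|B i 0|) ->
  (#|tm| <= t0)%N ->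
  s / 2 <= sqn e / n%:R <= 2 * s -> 0 < sqn e - q / (1 - th) ->
  0 <= D <= \sum_(i | i \notin k) B i 0 ^+ 2 ->
  0 < marginal r alpha1 alpha2 X A y tm /\
  marginal r alpha1 alpha2 X A y k <=
    C * expR (ratio_exponent c ep th (sqn e) S n #|tm| #|(k :&: tm)%SET| #|(k :\: tm)%SET|)
    * marginal r alpha1 alpha2 X A y tm].
Proof.
have [Cu [c [Cu0 c0 ub]]] := marginal_ub_ex t0 a1_gt0 a2_gt0 r_gt0 alpha1_gt0 alpha2_gt0 M_ge0.
have [cl cl0 lb] := marginal_lb_uniform.
exists (Cu / cl), c; split => //; first by rewrite divr_ge0// ltW.
move=> n p X A B e ep th q D k tm y S n0 boxs ep01 th01 kap1 q0 hA hX hv BM Brho tmt0 Ebd S0' D01.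
have n0' : 0 < (n%:R : R) by rewrite ltr0n.
have /andP[ep0 ep1] := ep01; have /andP[th0 th1] := th01; have /andP[D0 D1] := D01.
have /andP[E1 E2] := Ebd.
have E0 : 0 < sqn e / n%:R by apply: lt_le_trans E1; rewrite divr_gt0.
have E0' : 0 < sqn e by move: E0; rewrite pmulr_lgt0// invr_gt0.
have kap0 : 0 <= th * (n%:R * ep) by exact: le_trans ler01 kap1.
have S0 : 0 < S by rewrite /S ltr_wpDr// mulr_ge0.
have hvt v : supported (tm :|: tm)%SET v ->
     dotc e (X *m v) ^+ 2 <= q * sqn (X *m v) /\ n%:R * ep * sqn v <= sqn (X *m v).
  move=> sv; apply: hv => i; rewrite finset.in_setU negb_or => /andP[_ it].
  by apply: sv; rewrite finset.setUid.
have mE (k' : {set 'I_p}) : #|[set j : 'I_#|k'| | B (enum_val j) 0 == 0]%SET| = #|(k' :\: tm)%SET|.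
  rewrite (card_enum_val_set k' (fun i => B i 0 == 0)); apply: eq_card => i.
  by rewrite !finset.inE negbK andbC.
have tE (k' : {set 'I_p}) : #|[set j : 'I_#|k'| | B (enum_val j) 0 != 0]%SET| = #|(k' :&: tm)%SET|.
  rewrite (card_enum_val_set k' (fun i => B i 0 != 0)); apply: eq_card => i.
  by rewrite !finset.inE.
have ubk (k' : {set 'I_p}) S' : 0 < S' ->
   (forall b : #|k'|.-tuple R, S' + th * (n%:R * ep) * \sum_j (tnth b j - B (enum_val j) 0) ^+ 2
      <= sqn (y - design_sub X k' *m col_of_tuple b)) ->
   (marginal_integral alpha1 alpha2 r X A k' y <=
    (Cu * expR (c * #|k'|%:R - (#|k'|%:R / 2 + (r * #|(k' :\: tm)%SET|)%:R) * ln (th * (n%:R * ep))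
     - (r%:R + 2^-1) * (#|k'|%:R * ln n%:R)
     + (r%:R + 2^-1) * (#|(k' :\: tm)%SET|%:R * ln #|(k' :\: tm)%SET|%:R)
     + ln n%:R / 10 + log_peak n S'))%:E)%E.
  move=> S'0 key; have := ub n p X A k' y (fun j => B (enum_val j) 0) S' (th * (n%:R * ep)) n0 hA S'0 kap1.
  rewrite mE; apply => //; rewrite tE; apply: leq_trans tmt0.
  by apply: subset_leq_card; apply: finset.subsetIr.
have lbt := @marginal_integral_lb R a1 a2 alpha1 alpha2 M rho s r a1_gt0 a2_gt0 r_gt0 alpha1_gt0
   alpha2_gt0 M_ge0 rho_gt0 s_gt0 n p X A tm y n0 hA (fun j => B (enum_val j) 0) (box_lo X e)
   (fun j => box_lo X e j + (Num.sqrt n%:R)^-1) (sqn e / n%:R) (sqn e) (#|tm|%:R / ep).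
have {}lbt : ((cl * expR (log_peak n (sqn e) - #|tm|%:R / ep / s - (r%:R + 1) * #|tm|%:R * ln n%:R
    - ln n%:R))%:E <= marginal_integral alpha1 alpha2 r X A tm y)%E.
  have h : ((marginal_lb_cst a1 a2 alpha1 alpha2 M rho s r #|tm| *
     expR (log_peak n (sqn e) - #|tm|%:R / ep / s - (r%:R + 1) * #|tm|%:R * ln n%:R
    - ln n%:R))%:E <= marginal_integral alpha1 alpha2 r X A tm y)%E.
    apply: lbt => //.
    - by rewrite divfK// gt_eqF.
    - by rewrite divr_ge0// ltW.
    - move=> j; rewrite BM andbT Brho//; have := enum_valP j.
      by rewrite finset.inE.
    - by move=> j; split; [exact: box_lo_bounds|rewrite addrAC subrr add0r].
    - by move=> b hb; apply: residual_upper_bound.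
  apply: le_trans h; rewrite lee_fin ler_wpM2r ?expR_ge0//; exact: lb.
have It0 (k' : {set 'I_p}) := marginal_integral_ge0 X y k' n0 hA.
(* The upper bound is also applied to the true model, at the cruder peak without the gain in [D].
   Finiteness is what makes the lower bound survive [fine]. *)
have Ifin : marginal_integral alpha1 alpha2 r X A tm y \is a fin_num.
  rewrite ge0_fin_numE ?It0//; apply: le_lt_trans (ubk tm (sqn e - q / (1 - th)) S0' _) (ltry _).
  move=> b; apply: le_trans (residual_lower_bound n0 ep0 b th01 q0 hvt (lexx _)).
  by rewrite lerD2r lerDl mulr_ge0//; apply: sumr_ge0 => i _; exact: sqr_ge0.
pose LB := cl * expR (log_peak n (sqn e) - #|tm|%:R / ep / s - (r%:R + 1) * #|tm|%:R * ln n%:R - ln n%:R).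
have LB0 : 0 < LB by rewrite mulr_gt0 ?expR_gt0.
have mt : LB <= marginal r alpha1 alpha2 X A y tm.
  by rewrite -lee_fin [leRHS](_ : _ = marginal_integral alpha1 alpha2 r X A tm y) ?lbt// -(fineK Ifin).
split; first exact: lt_le_trans mt.
have uk := ubk k S S0 (fun b => residual_lower_bound n0 ep0 b th01 q0 hv D1).
set U := (X in (_ <= X%:E)%E) in uk.
have mk : marginal r alpha1 alpha2 X A y k <= U.
  have Ifk : marginal_integral alpha1 alpha2 r X A k y \is a fin_num.
    by rewrite ge0_fin_numE ?It0//; exact: le_lt_trans uk (ltry _).
  by rewrite -lee_fin [leLHS](_ : _ = marginal_integral alpha1 alpha2 r X A k y) ?uk// -(fineK Ifk).
apply: le_trans mk _.
apply: (@le_trans _ _ (Cu / cl * expR (ratio_exponent c ep th (sqn e) S n #|tm| #|(k :&: tm)%SET| #|(k :\: tm)%SET|) * LB)); last first.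
  by rewrite ler_wpM2l// mulr_ge0 ?expR_ge0// divr_ge0// ltW.
rewrite /LB (_ : Cu / cl * _ * _ = Cu * (expR (ratio_exponent c ep th (sqn e) S n #|tm| #|(k :&: tm)%SET| #|(k :\: tm)%SET|) *
  expR (log_peak n (sqn e) - #|tm|%:R / ep / s - (r%:R + 1) * #|tm|%:R * ln n%:R - ln n%:R))); last first.
  by field; rewrite gt_eqF.
rewrite /U -expRD ler_wpM2l// ler_expR /ratio_exponent.
have kE : #|k|%:R = #|(k :&: tm)%SET|%:R + #|(k :\: tm)%SET|%:R :> R.
  by rewrite -natrD -(finset.cardsID tm k).
rewrite !natrD natrM kE.
have lkE : ln (th * (n%:R * ep)) = ln n%:R - - ln (th * ep).
  by rewrite opprK -lnM ?posrE ?mulr_gt0//; congr ln; ring.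
have lam0 : 0 <= - ln (th * ep).
  by rewrite oppr_ge0 ln_le0// mulr_ile1// ltW.
have lp : log_peak n S - log_peak n (sqn e) <= n%:R / 2 * ((sqn e - S) / S).
  have -> : log_peak n S - log_peak n (sqn e) = n%:R / 2 * ln (sqn e / S).
    rewrite /log_peak !ln_div ?posrE//; ring.
  rewrite ler_wpM2l ?divr_ge0 ?(ltW n0')//.
  apply: le_trans (ln_leB1 _) _; first by rewrite divr_gt0.
  by rewrite mulrBl divff// gt_eqF.
rewrite lkE; set lam := - ln _ in lam0 *; set l := ln n%:R.
set T := #|(k :&: tm)%SET|%:R; set m := #|(k :\: tm)%SET|%:R.
have T0 : 0 <= T by [].
have m0 : 0 <= m by [].
have e1 : ((T + m) / 2 + r%:R * m) * lam <= (r%:R + 1) * lam * (T + m).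
  have r0 : 0 <= (r%:R : R) by [].
  have : 0 <= ((T + m) / 2 + r%:R * T) * lam  by rewrite mulr_ge0// addr_ge0// mulr_ge0// addr_ge0.
  by lra.
have e2 : #|tm|%:R / (ep * s) = #|tm|%:R / ep / s by rewrite invfM mulrA.
rewrite e2 !mulrBr.
move: lp e1; set lpS := log_peak n S; set lpE := log_peak n (sqn e); set G := n%:R / 2 * _.
set F := #|tm|%:R / ep / s; set H := m * ln m; move=> lp e1.
rewrite -subr_ge0.
have : 0 <= (r%:R + 1) * lam * (T + m) - ((T + m) / 2 + r%:R * m) * lam by lra.
have : 0 <= G - (lpS - lpE) by lra.
lra.
Qed.

End MarginalRatio.

(** * The exponent of the ratio tends to minus infinity like a multiple of [ln n] *)

Section ExponentBound.
Context (R : realType) (c s rho : R) (r t0 : nat).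
Hypotheses (c_ge0 : 0 <= c) (s_gt0 : 0 < s) (rho_gt0 : 0 < rho) (r_gt0 : (0 < r)%N).

Let tt : R := t0%:R.
(** [De] is the loss per coordinate in units of [dl * l]; its [3 / 2] absorbs the linear term left
    by bounding [m ln m]. [G] collects all the losses in units of [(m + 1) * l], and [g * (n ep)] is
    the gain in likelihood when a true coordinate is missed. *)
Let De : R := c + 50 * (r%:R + 1) + 3 / 2.
Let G : R := De * (tt + 1) + (r%:R + 1) * tt + 2 + tt / s.
Let g : R := rho ^+ 2 / (200 * (2 * s + rho ^+ 2)).

Let r1 : 1 <= (r%:R : R). Proof. by rewrite ler1n. Qed.
Let tt0 : 0 <= tt. Proof. by []. Qed.
Let De32 : 0 <= De - 3 / 2. Proof. by rewrite /De; have := c_ge0; have := r1; lra. Qed.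
Let De0 : 0 < De. Proof. by have := De32; lra. Qed.
Let rho2 : 0 < rho ^+ 2. Proof. by rewrite exprn_gt0. Qed.
Let sr : 0 < 2 * s + rho ^+ 2. Proof. by have := rho2; have := s_gt0; lra. Qed.
Let g0 : 0 < g. Proof. by apply: divr_gt0 => //; apply: mulr_gt0 => //; rewrite ltr0n. Qed.
Let Dt : 0 <= De * tt. Proof. by rewrite mulr_ge0// ltW. Qed.
Let ts : 0 <= tt / s. Proof. by rewrite divr_ge0// ltW. Qed.
Let rt : 0 <= (r%:R + 1) * tt. Proof. by rewrite mulr_ge0// addr_ge0. Qed.
Let G0 : 0 < G. Proof. by rewrite /G; have := Dt; have := rt; have := ts; have := De0; lra. Qed.

Section Fixed.
Context (dl : R) (n m T tK : nat) (ep E q : R).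
Hypotheses (dl0 : 0 < dl) (d1 : dl * 150 <= 1) (d2 : dl * (50 * De) <= 1).
Hypotheses (d3 : dl * (10 * (De * tt + tt / s)) <= 1) (d4 : 3 * s * dl <= rho ^+ 2 / 100).
Hypothesis d5 : G * dl <= g.
Let l : R := ln n%:R.
Let th : R := 50^-1.
Hypotheses (l1 : 1 <= dl * l) (epl : ep^-1 <= dl * l).
Hypothesis ml : (m%:R + 1) * l <= dl * (n%:R * ep).
Hypotheses (ep0 : 0 < ep) (ep1 : ep < 1) (mn : (m <= n)%N) (TK : (T <= tK)%N) (K0 : (tK <= t0)%N).
Hypotheses (E1 : 49 / 50 * (n%:R * s) <= E) (E2 : E <= 2 * (n%:R * s)).
Hypotheses (q0 : 0 <= q) (q1 : q <= s * (5 / 2 * (m%:R * l) + l / 10)).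

Let lpos : 0 <= l.
Proof. by rewrite -(pmulr_rge0 _ dl0); have := l1; lra. Qed.

Let lp : 1 <= l.
Proof.
have : dl * l <= 1 * l by rewrite ler_wpM2r//; have := d1; have := dl0; lra.
by have := l1; lra.
Qed.

Let n0 : (0 < n)%N.
Proof. by rewrite lt0n; apply: contraTneq lp => n0; rewrite /l n0 ln0// ler10. Qed.
Let N0 : 0 < (n%:R : R). Proof. by rewrite ltr0n. Qed.
Let m0 : 0 <= (m%:R : R). Proof. by []. Qed.

Let lam : - ln (th * ep) <= 50 * (dl * l).
Proof.
have -> : - ln (th * ep) = ln 50 + ln ep^-1.
  by rewrite -lnM ?posrE ?invr_gt0// -lnV ?posrE ?mulr_gt0 ?invr_gt0// invfM invrK.
have : ln 50 <= 49 :> R by apply: le_trans (ln_leB1 _) _ => //; lra.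
have : ln ep^-1 <= ep^-1 - 1 by apply: ln_leB1; rewrite invr_gt0.
by have := l1; have := epl; lra.
Qed.

Let lam0 : 0 <= - ln (th * ep).
Proof. by rewrite oppr_ge0 ln_le0// /th; have := ep0; have := ep1; lra. Qed.

Let Tt : T%:R <= tt. Proof. by rewrite /tt ler_nat (leq_trans TK). Qed.
Let Kt : tK%:R <= tt. Proof. by rewrite /tt ler_nat. Qed.
Let T0 : 0 <= (T%:R : R). Proof. by []. Qed.
Let nep : 0 < n%:R * ep. Proof. by rewrite mulr_gt0. Qed.
Let nepn : n%:R * ep <= n%:R. Proof. by rewrite ler_piMr// ltW. Qed.
Let ml0 : 0 <= m%:R * l. Proof. exact: mulr_ge0. Qed.
Let ns0 : 0 < n%:R * s. Proof. by rewrite mulr_gt0. Qed.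

Let qe : q / (1 - th) <= s * (50 / 49) * (5 / 2 * (m%:R * l) + l / 10).
Proof.
have -> : q / (1 - th) = 50 / 49 * q by rewrite /th; field.
by have := q1; lra.
Qed.

Let qe0 : 0 <= q / (1 - th). Proof. by rewrite divr_ge0// /th; lra. Qed.

Let qe3 : q / (1 - th) <= 3 * s * dl * (n%:R * ep).
Proof.
apply: (@le_trans _ _ (3 * s * ((m%:R + 1) * l))).
  apply: le_trans qe _; rewrite -subr_ge0.
  have -> : 3 * s * ((m%:R + 1) * l) - s * (50 / 49) * (5 / 2 * (m%:R * l) + l / 10) =
     s * ((3 - 125 / 49) * (m%:R * l) + (3 - 5 / 49) * l) by field.
  by rewrite mulr_ge0 ?(ltW s_gt0)//; have := ml0; have := lpos; lra.
by rewrite -[leRHS]mulrA ler_wpM2l// mulr_ge0// ltW.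
Qed.

(** The noise energy is at least [49/50] of its mean, and the correction [q / (1 - th)] takes at
    most another [1/50]. *)
Let S96 : 24 / 25 * (n%:R * s) <= E - q / (1 - th).
Proof.
have h1 : 3 * s * dl * (n%:R * ep) <= 3 * s * dl * n%:R.
  by rewrite ler_wpM2l// mulr_ge0 ?(ltW dl0)// mulr_ge0// ltW.
have h2 : 3 * s * dl * n%:R <= n%:R * s / 50.
  have -> : 3 * s * dl * n%:R = (n%:R * s) * (dl * 150) / 50 by field.
  by rewrite ler_wpM2r//; rewrite ler_piMr// ltW.
by have := qe3; have := E1; lra.
Qed.

Let S0 : 0 < E - q / (1 - th).
Proof. by apply: lt_le_trans S96; rewrite mulr_gt0. Qed.

Let thn : 1 <= th * (n%:R * ep).
Proof.
have h1 : l <= (m%:R + 1) * l by rewrite mulrDl mul1r lerDr.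
have h2 : 1 <= dl * (dl * (n%:R * ep)).
  by apply: le_trans l1 _; rewrite ler_wpM2l ?(ltW dl0)// (le_trans h1).
have h3 : dl * dl <= th.
  have : dl * dl <= dl * 1 by rewrite ler_wpM2l ?(ltW dl0)//; have := d1; lra.
  by rewrite /th; have := d1; lra.
by apply: le_trans h2 _; rewrite mulrA ler_wpM2r ?(ltW nep).
Qed.

Let bl : (c + (r%:R + 1) * - ln (th * ep)) * (T + m)%:R <= (De - 3 / 2) * (dl * l) * (T%:R + m%:R).
Proof.
rewrite natrD ler_wpM2r ?addr_ge0//.
have h1 : (r%:R + 1) * - ln (th * ep) <= (r%:R + 1) * (50 * (dl * l)).
  by rewrite ler_wpM2l// addr_ge0.
have h2 : c <= c * (dl * l) by rewrite ler_peMr.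
by rewrite /De; lra.
Qed.

Let tk : tK%:R / (ep * s) <= dl * l * (tt / s).
Proof.
have -> : tK%:R / (ep * s) = ep^-1 * (tK%:R / s) by rewrite invfM; ring.
apply: ler_pM => //; rewrite ?divr_ge0 ?(ltW s_gt0) ?invr_ge0 ?(ltW ep0)//.
by rewrite ler_wpM2r// invr_ge0 ltW.
Qed.

Let lnm : ln m%:R <= l.
Proof.
case: (posnP m) => [->|mp]; first by rewrite ln0// ltW.
by rewrite ler_ln ?posrE ?ltr0n// ler_nat.
Qed.

(** All losses proportional to [dl] are made at most [1/50] of [m l] or [1/10] of [l]. Against the
    gain [3/2 (m l + l)], the losses in [m l] add up to [133/100 + 1/50], and those in [l] to
    [11/10 + 6/100 + 1/10], which leaves more than [l / 10]. *)
Let overfit : T = tK -> (0 < m)%N ->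
  ratio_exponent s r c ep th E (E - q / (1 - th) + th * (n%:R * ep) * 0) n tK T m
  <= - (l / 10).
Proof.
move=> TE mp; rewrite mulr0 addr0 /ratio_exponent -/l.
have m1 : 1 <= (m%:R : R) by rewrite ler1n.
(* The term is written as [(m - 1) ln m + ln m], with [ln m <= l] in the first part and
   [ln m <= m - 1] in the second. The saved [l] is what pays for [n^(11/10)]. *)
have lnm1 : m%:R * ln m%:R <= m%:R * l - l + m%:R.
  have : (m%:R - 1) * ln m%:R <= (m%:R - 1) * l by rewrite ler_wpM2l// subr_ge0.
  by have := @ln_leB1 R m%:R; rewrite ltr0n => /(_ mp); lra.
have hm : (r%:R + 2^-1) * (m%:R * ln m%:R) <= (r%:R + 2^-1) * (m%:R * l - l + m%:R).
  by rewrite ler_wpM2l// addr_ge0.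
have hg : 3 / 2 * (m%:R * l + l - m%:R) <= (r%:R + 2^-1) * (m%:R * l + l - m%:R).
  rewrite ler_wpM2r//; last by have := r1; lra.
  have : m%:R <= m%:R * l by rewrite ler_peMr.
  by have := lpos; lra.
(* The denominator is at least [24/25 n s]; then [50/49 * 25/48] times [5/2] is below [133/100], and
   times [1/10] is below [6/100]. *)
have last : n%:R / 2 * ((E - (E - q / (1 - th))) / (E - q / (1 - th))) <=
   133 / 100 * (m%:R * l) + 6 / 100 * l.
  rewrite (_ : E - (E - q / (1 - th)) = q / (1 - th)); last by ring.
  apply: (@le_trans _ _ (n%:R / 2 * (s * (50 / 49) * (5 / 2 * (m%:R * l) + l / 10) / (24 / 25 * (n%:R * s))))).
    rewrite ler_wpM2l ?divr_ge0 ?(ltW N0)//; apply: ler_pM => //; first by rewrite invr_ge0 ltW.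
    by rewrite lef_pV2 ?posrE// mulr_gt0.
  rewrite (_ : n%:R / 2 * _ = 50 / 49 * (25 / 48) * (5 / 2 * (m%:R * l) + l / 10)).
    by have := ml0; have := lpos; lra.
  by field; rewrite !gt_eqF.
have m15 : m%:R <= m%:R * (dl * l) by rewrite ler_peMr.
have b2 : (De - 3 / 2) * (dl * l) * (T%:R + m%:R) + 3 / 2 * m%:R <= De * (dl * l) * (tt + m%:R).
  have h1 : (De - 3 / 2) * (dl * l) * (T%:R + m%:R) <= (De - 3 / 2) * (dl * l) * (tt + m%:R).
    rewrite ler_wpM2l ?lerD2r//; apply: mulr_ge0 => //.
    by apply: mulr_ge0 => //; apply: ltW.
  have h2 : 0 <= dl * l * tt by apply: mulr_ge0 => //; apply: mulr_ge0 => //; apply: ltW.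
  by move: h1 h2 m15; lra.
have b3 : De * (dl * l) * (tt + m%:R) <= dl * (De * tt) * l + 50^-1 * (m%:R * l).
  have h : dl * De * (m%:R * l) <= 50^-1 * (m%:R * l).
    by rewrite ler_wpM2r//; have := d2; lra.
  by move: h; lra.
have b4 : dl * (De * tt + tt / s) * l <= 10^-1 * l by rewrite ler_wpM2r//; have := d3; lra.
have Teq : T%:R = tK%:R :> R by rewrite TE.
have := bl; have := tk; have := lpos; have := ml0.
rewrite Teq subrr mulr0 mul0r addr0.
move: hm hg last b2 b3 b4; rewrite Teq; lra.
Qed.

(** Every loss is at most a multiple of [(m + 1) l], while the missed coefficient raises the
    residual by order [n ep]. The assumption on [(m + 1) l] and [G * dl <= g] make the gain win. *)
Let missing : ratio_exponent s r c ep th E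
  (E - q / (1 - th) + th * (n%:R * ep) * rho ^+ 2) n tK T m <= - (l / 10).
Proof.
rewrite /ratio_exponent -/l; set S := _ + th * _ * _.
have tr0 : 0 <= th * (n%:R * ep) * rho ^+ 2.
  by rewrite mulr_ge0 ?(ltW rho2)// (le_trans ler01).
have Sp : 0 < S by apply: lt_le_trans S0 _; rewrite lerDl.
have S2 : S <= n%:R * (2 * s + rho ^+ 2).
  have h1 : th * (n%:R * ep) * rho ^+ 2 <= 1 * n%:R * rho ^+ 2.
    by rewrite ler_wpM2r ?(ltW rho2)// ler_pM// ?(ltW nep)// /th; lra.
  by move: h1; rewrite /S; have := qe0; have := E2; lra.
have ES : E - S <= - (n%:R * ep * rho ^+ 2 / 100).
  have h1 : 3 * s * dl * (n%:R * ep) <= rho ^+ 2 / 100 * (n%:R * ep).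
    by rewrite ler_wpM2r// ltW.
  have h2 : th * (n%:R * ep) * rho ^+ 2 = n%:R * ep * rho ^+ 2 / 50 by rewrite /th; field.
  by rewrite /S h2; have := qe3; lra.
have last : n%:R / 2 * ((E - S) / S) <= - (g * (n%:R * ep)).
  rewrite -[leRHS](_ : n%:R / 2 * (- (n%:R * ep * rho ^+ 2 / 100) / (n%:R * (2 * s + rho ^+ 2))) = _); last first.
    by rewrite /g; field; rewrite !gt_eqF.
  rewrite ler_wpM2l ?divr_ge0 ?(ltW N0)//.
  apply: (@le_trans _ _ (- (n%:R * ep * rho ^+ 2 / 100) / S)).
    by rewrite ler_wpM2r// invr_ge0 ltW.
  rewrite !mulNr lerN2 ler_wpM2l//.
    by rewrite divr_ge0// mulr_ge0// ltW.
  by rewrite lef_pV2 ?posrE// mulr_gt0.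
have hm : (r%:R + 2^-1) * (m%:R * ln m%:R) <= (r%:R + 2^-1) * (m%:R * l).
  by rewrite ler_wpM2l ?addr_ge0// ler_wpM2l.
have hm2 : (r%:R + 2^-1) * (m%:R * l) <= (2 * r%:R + 1) * (m%:R * l).
  by rewrite ler_wpM2r//; have := r1; lra.
have dl1 : dl <= 1 by have := d1; lra.
have llm : l <= (m%:R + 1) * l by rewrite mulrDl mul1r lerDr.
have b1 : (De - 3 / 2) * (dl * l) * (T%:R + m%:R) <= De * (tt + 1) * ((m%:R + 1) * l).
  have dll : 0 <= dl * l by apply: mulr_ge0 => //; apply: ltW.
  have h1 : (De - 3 / 2) * (dl * l) <= De * l.
    apply: ler_pM => //; first by have := De0; lra.
    by rewrite ler_piMl.
  have h2 : T%:R + m%:R <= (tt + 1) * (m%:R + 1).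
    have : 0 <= tt * m%:R by rewrite mulr_ge0.
    by have := Tt; lra.
  rewrite (_ : De * _ * _ = De * l * ((tt + 1) * (m%:R + 1))); last by ring.
  by apply: ler_pM => //; apply: mulr_ge0.
have b2 : (r%:R + 1) * (tK%:R - T%:R) * l <= (r%:R + 1) * tt * ((m%:R + 1) * l).
  apply: ler_pM => //.
    by apply: mulr_ge0; [exact: addr_ge0|rewrite subr_ge0 ler_nat].
  by rewrite ler_wpM2l ?addr_ge0//; have := Kt; have := T0; lra.
have b3 : dl * l * (tt / s) <= tt / s * ((m%:R + 1) * l).
  rewrite mulrC ler_wpM2l//; apply: le_trans llm.
  by rewrite ler_piMl.
have fin : G * ((m%:R + 1) * l) <= g * (n%:R * ep).
  apply: (@le_trans _ _ (G * dl * (n%:R * ep))).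
    by rewrite -[leRHS]mulrA ler_wpM2l// ltW.
  by rewrite ler_wpM2r// ltW.
have := bl; have := tk; have := lpos.
by move: fin b1 b2 b3 hm hm2 last llm; rewrite /G; lra.
Qed.

Lemma exponent_bound_fixed :
  [/\ 0 < E - q / (1 - th), 1 <= th * (n%:R * ep),
   (T = tK -> (0 < m)%N ->
     ratio_exponent s r c ep th E (E - q / (1 - th) + th * (n%:R * ep) * 0) n tK T m
       <= - (l / 10)) &
   ratio_exponent s r c ep th E (E - q / (1 - th) + th * (n%:R * ep) * rho ^+ 2) n tK T m
     <= - (l / 10)].
Proof. by split. Qed.

End Fixed.

(* The number 5/2 is an upper deviation rate for the projected noise:
   exponential Markov with parameter 9/20 makes the sum over the false models
   converge, while 5/2 / 2 stays below the gain 3/2 of the nonlocal prior at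
   r = 1. *)
Lemma exponent_bound : exists2 dl : R, 0 < dl &
  forall (n m T tK : nat) (ep E q : R),
  let l := ln n%:R in let th := 50^-1 in
  1 <= dl * l -> ep^-1 <= dl * l -> (m%:R + 1) * l <= dl * (n%:R * ep) ->
  0 < ep < 1 -> (m <= n)%N -> (T <= tK <= t0)%N ->
  49 / 50 * (n%:R * s) <= E <= 2 * (n%:R * s) ->
  0 <= q <= s * (5 / 2 * (m%:R * l) + l / 10) ->
  [/\ 0 < E - q / (1 - th), 1 <= th * (n%:R * ep),
   (T = tK -> (0 < m)%N ->
     ratio_exponent s r c ep th E (E - q / (1 - th) + th * (n%:R * ep) * 0) n tK T m
       <= - (l / 10)) &
   ratio_exponent s r c ep th E (E - q / (1 - th) + th * (n%:R * ep) * rho ^+ 2) n tK T m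
     <= - (l / 10)].
Proof.
have sr2 : 0 <= 300 * s / rho ^+ 2 by apply: divr_ge0; [apply: mulr_ge0; [exact: ler0n|exact: ltW]|exact: ltW].
have Gg : 0 <= G / g by rewrite divr_ge0// ltW.
have dt10 : 0 <= 10 * (De * tt + tt / s) by apply: mulr_ge0 => //; exact: addr_ge0.
have De50 : 0 <= 50 * De by rewrite mulr_ge0// ltW.
(* The sum of the lower thresholds that the five smallness conditions impose on [1 / dl]. *)
pose D := 150 + 50 * De + 10 * (De * tt + tt / s) + 300 * s / rho ^+ 2 + G / g.
have D0 : 0 < D by rewrite /D; move: sr2 Gg dt10 De50; lra.
exists D^-1; first by rewrite invr_gt0.
have small x : 0 <= x -> x <= D -> D^-1 * x <= 1.
  by move=> x0 xD; rewrite mulrC ler_pdivrMr// mul1r.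
move=> n m T tK ep E q l th l1 epl ml /andP[ep0 ep1] mn /andP[TK K0] /andP[E1 E2] /andP[q0 q1].
apply: (@exponent_bound_fixed D^-1) => //; first by rewrite invr_gt0.
- by apply: small => //; rewrite /D; move: sr2 Gg dt10 De50; lra.
- by apply: small => //; rewrite /D; move: sr2 Gg dt10 De50; lra.
- by apply: small => //; rewrite /D; move: sr2 Gg dt10 De50; lra.
- have : D^-1 * (300 * s / rho ^+ 2) <= 1.
    by apply: small => //; rewrite /D; move: sr2 Gg dt10 De50; lra.
  by rewrite mulrA ler_pdivrMr// mul1r; lra.
- have : D^-1 * (G / g) <= 1.
    by apply: small => //; rewrite /D; move: sr2 Gg dt10 De50; lra.
  by rewrite mulrA ler_pdivrMr// mul1r mulrC.
Qed.

End ExponentBound.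

(** * Deviation of the noise *)

Section NoiseTails.
Context (R : realType) (d : measure_display) (T : measurableType d).
Context (P : probability T R) (n : nat) (Z : 'I_n -> {RV P >-> R}) (s : R).
Hypotheses (s_gt0 : 0 < s) (iidZ : iid_normal Z s).

Let s2 : 0 < s ^+ 2. Proof. by rewrite exprn_gt0. Qed.

Lemma measurable_noise_proj m (Q : 'M[R]_(m, n)) :
  measurable_fun setT (fun w => sqn (Q *m noise_vec Z w)).
Proof.
apply: measurable_fun_sumr => i; apply: measurable_funX.
rewrite (_ : (fun _ => _) = fun w => \sum_j Q i j * Z j w); last first.
  by apply/funext => w; rewrite mxE; apply: eq_bigr => j _; rewrite mxE.
by apply: measurable_fun_sumr => j; apply: measurable_funM; first exact: measurable_cst.
Qed.

(** Exponential Markov at parameter [-1/200]. With [ln (101/100) >= 1/101] the rate is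
    [1/202 - 49/10000], which exceeds [1/20000]. *)
Lemma energy_lower_tail :
  (P [set w | (sqn (noise_vec Z w) < 49 / 50 * (n%:R * s ^+ 2))%R]
   <= (expR (- (n%:R / (200 * 100))))%:E)%E.
Proof.
have c1 : - 200^-1 < 2^-1 :> R by lra.
rewrite [X in P X](_ : _ = [set w | - 200^-1 * (49 / 50 * n%:R) <
   - 200^-1 * sqn (noise_vec Z w) / s ^+ 2]); last first.
  have neg : - 200^-1 < 0 :> R by rewrite oppr_lt0 invr_gt0 ltr0n.
  apply/funext => w /=; congr (is_true _).
  by rewrite -[X in _ = (_ < X)]mulrA ltr_nM2l// ltr_pdivrMr// mulrA.
apply: (le_trans (@markov_exp _ _ _ _ _ ((Num.sqrt (1 - 2 * - 200^-1)) ^- n) _ _ _)).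
- apply: measurable_funM; last exact: measurable_cst.
  by apply: measurable_funM; [exact: measurable_cst|exact: measurable_noise_sqn].
- by rewrite (noise_sqn_mgf s_gt0 iidZ c1).
have e : 1 - 2 * - 200^-1 = 101 / 100 :> R by lra.
rewrite e lee_fin sqrt_expN ?divr_gt0 ?ltr0n// -expRD ler_expR.
have : ln (100 / 101) <= 100 / 101 - 1 :> R by apply: ln_leB1; rewrite divr_gt0 ?ltr0n.
have -> : ln (100 / 101) = - ln (101 / 100) :> R.
  by rewrite -lnV ?posrE ?divr_gt0 ?ltr0n// invf_div.
move=> h; have : n%:R / 2 * (1 - 100 / 101) <= n%:R / 2 * ln (101 / 100) :> R.
  by rewrite ler_wpM2l ?divr_ge0 ?ler0n//; lra.
have : 0 <= n%:R :> R by [].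
lra.
Qed.

(** Exponential Markov at parameter [1/8]: the rate is at least [1/4 - 1/6], by
    [ln (4/3) <= 1/3]. *)
Lemma energy_upper_tail :
  (P [set w | (2 * (n%:R * s ^+ 2) < sqn (noise_vec Z w))%R]
   <= (expR (- (n%:R / 12)))%:E)%E.
Proof.
have c1 : 8^-1 < 2^-1 :> R by lra.
rewrite [X in P X](_ : _ = [set w | 8^-1 * (2 * n%:R) <
   8^-1 * sqn (noise_vec Z w) / s ^+ 2]); last first.
  apply/funext => w /=; congr (is_true _).
  by rewrite -[X in _ = (_ < X)]mulrA ltr_pM2l ?invr_gt0 ?ltr0n// ltr_pdivlMr// mulrA.
apply: (le_trans (@markov_exp _ _ _ _ _ ((Num.sqrt (1 - 2 * 8^-1)) ^- n) _ _ _)).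
- apply: measurable_funM; last exact: measurable_cst.
  by apply: measurable_funM; [exact: measurable_cst|exact: measurable_noise_sqn].
- by rewrite (noise_sqn_mgf s_gt0 iidZ c1).
have e : 1 - 2 * 8^-1 = 3 / 4 :> R by lra.
rewrite e lee_fin sqrt_expN ?divr_gt0// -expRD ler_expR.
have : ln (4 / 3) <= 4 / 3 - 1 :> R by apply: ln_leB1; rewrite divr_gt0.
have -> : ln (4 / 3) = - ln (3 / 4) :> R.
  by rewrite -lnV ?posrE ?divr_gt0// invf_div.
move=> h; have : n%:R / 2 * - ln (3 / 4) <= n%:R / 2 * (1 / 3) :> R.
  by rewrite ler_wpM2l ?divr_ge0 ?ler0n//; lra.
lra.
Qed.

(** At parameter [9/20] the moment generating function is [10^(m/2)], and [ln 10 <= 9] is enough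
    since the factor only enters the constants of the union bound. *)
Lemma proj_upper_tail m (Q : 'M[R]_(n, m)) (x : R) : Q^T *m Q = 1%:M ->
  (P [set w | (s ^+ 2 * x < sqn (Q^T *m noise_vec Z w))%R]
   <= (expR (9 / 2 * m%:R - 9 / 20 * x))%:E)%E.
Proof.
move=> QQ; have c1 : 9 / 20 < 2^-1 :> R by lra.
have c0 : 0 <= 9 / 20 :> R by lra.
have c9 : 0 < 9 / 20 :> R by lra.
rewrite [X in P X](_ : _ = [set w | 9 / 20 * x <
   9 / 20 * sqn (Q^T *m noise_vec Z w) / s ^+ 2]); last first.
  apply/funext => w /=; congr (is_true _).
  by rewrite -[X in _ = (_ < X)]mulrA ltr_pM2l// ltr_pdivlMr// mulrC.
apply: (le_trans (@markov_exp _ _ _ _ _ ((Num.sqrt (1 - 2 * (9 / 20))) ^- m) _ _ _)).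
- apply: measurable_funM; last exact: measurable_cst.
  by apply: measurable_funM; [exact: measurable_cst|exact: measurable_noise_proj].
- by rewrite (noise_proj_mgf s_gt0 iidZ QQ c0 c1).
have e : 1 - 2 * (9 / 20) = 10^-1 :> R by lra.
rewrite e lee_fin sqrt_expN ?invr_gt0 ?ltr0n// -expRD ler_expR lnV ?posrE ?ltr0n//.
have : ln 10 <= 10 - 1 :> R by apply: ln_leB1; rewrite ltr0n.
move=> h; have : m%:R / 2 * ln 10 <= m%:R / 2 * 9 :> R.
  by rewrite ler_wpM2l ?divr_ge0 ?ler0n//; lra.
lra.
Qed.

(** An orthonormal basis of the span of the columns in [k] has at most [#|k|] vectors, and one event
    on the projected noise controls the cross term with every vector of the span at once. *)
Lemma proj_deviation p (X : 'M[R]_(n, p)) (k : {set 'I_p}) (m : nat) (x : R) :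
  (#|k| <= m)%N -> exists B : set T, [/\ measurable B,
  (P B <= (expR (9 / 2 * m%:R - 9 / 20 * x))%:E)%E &
  forall w, ~ B w -> exists2 q : R, 0 <= q <= s ^+ 2 * x &
   forall v, supported k v -> dotc (noise_vec Z w) (X *m v) ^+ 2 <= q * sqn (X *m v)].
Proof.
move=> km; have [dm [Q [S [dmk QQ XE]]]] := orthonormal_factor (design_sub X k).
exists [set w | s ^+ 2 * x < sqn (Q^T *m noise_vec Z w)]; split.
- rewrite -[X in measurable X]setTI.
  by apply: measurable_fun_ltr => //; exact: measurable_noise_proj.
- apply: le_trans (proj_upper_tail x QQ) _.
  rewrite lee_fin ler_expR lerD2r ler_wpM2l ?divr_ge0 ?ler0n// ler_nat.
  exact: leq_trans dmk km.
move=> w /= /negP; rewrite -leNgt => qx; exists (sqn (Q^T *m noise_vec Z w)).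
  by rewrite sqn_ge0.
move=> v kv; rewrite -(design_sub_mulE X kv) XE -mulmxA.
exact: dotc_proj_le.
Qed.

End NoiseTails.

Lemma sum_expr_card (R : comPzRingType) p (z : R) :
  \sum_(v : {set 'I_p}) z ^+ #|v| = (1 + z) ^+ p.
Proof.
transitivity (\prod_(i < p) (z + 1)); last by rewrite prodr_const card_ord addrC.
rewrite bigA_distr; apply: eq_bigr => v _.
by rewrite -big_mkcond prodr_const.
Qed.

Lemma measure_bigsetU_le d (T : measurableType d) (R : realType)
    (mu : {measure set T -> \bar R}) (I : finType) (B : I -> set T) :
  (forall i, measurable (B i)) ->
  measurable (\big[setU/set0]_i B i) /\
  (mu (\big[setU/set0]_i B i) <= \sum_i mu (B i))%E.
Proof.
move=> mB; elim/big_ind2: _ => [|x1 x2 y1 y2 [m1 h1] [m2 h2]|i _].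
- by rewrite measure0.
- split; first exact: measurableU.
  by apply: le_trans (measureU2 _ m1 m2) _; exact: leeD.
- by split.
Qed.

Lemma sqr_expR_le (R : realType) (x : R) : 0 <= x -> x ^+ 2 * expR (- (x / 8)) <= 256.
Proof.
move=> x0; have h : 1 + x / 16 <= expR (x / 16) by exact: expR_ge1Dx.
have h2 : (1 + x / 16) ^+ 2 <= expR (x / 8).
  have -> : x / 8 = 2%:R * (x / 16) by field.
  by rewrite expRM_natl lerXn2r ?nnegrE ?expR_ge0// addr_ge0// divr_ge0// ler0n.
rewrite expRN ler_pdivrMr ?expR_gt0//; apply: (@le_trans _ _ (256 * (1 + x / 16) ^+ 2)); last first.
  by rewrite ler_wpM2l// ler0n.
have -> : 256 * (1 + x / 16) ^+ 2 = x ^+ 2 + (256 + 32 * x) by field.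
by rewrite lerDl; lra.
Qed.

Lemma noise_deviation (R : realType) (s dl : R) (t0 : nat) : 0 < s ->
  exists2 C : R, 0 <= C &
  forall (d : measure_display) (T : measurableType d) (P : probability T R)
    (n : nat) (Z : 'I_n -> {RV P >-> R}), iid_normal Z s ->
  forall p (X : 'M[R]_(n, p)) (tm : {set 'I_p}) (ep : R),
  let l := ln n%:R in
  (0 < n)%N -> (#|tm| <= t0)%N -> 0 < ep -> p%:R * ep ^+ 2 <= n%:R ->
  ep^-1 <= dl * l ->
  exists bad : set T, [/\ measurable bad,
   (P bad <= (C * expR (- (l / (200 * 100))))%:E)%E &
   forall w, ~ bad w ->
    49 / 50 * (n%:R * s ^+ 2) <= sqn (noise_vec Z w) <= 2 * (n%:R * s ^+ 2) /\
    forall k : {set 'I_p}, exists2 q : R,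
      0 <= q <= s ^+ 2 * (5 / 2 * (#|(k :\: tm)%SET|%:R * l) + l / 10) &
      forall v, supported (k :|: tm)%SET v ->
        dotc (noise_vec Z w) (X *m v) ^+ 2 <= q * sqn (X *m v)].
Proof.
move=> s0; pose C0 := expR (9 / 2 * t0%:R + expR (9 / 2) * (dl ^+ 2 * 256)).
exists (1 + 1 + C0); first by rewrite !addr_ge0// expR_ge0.
move=> d T P n Z iidZ p X tm ep l n0 tmt0 ep0 pn epl.
have N0 : 0 < (n%:R : R) by rewrite ltr0n.
have l0 : 0 <= l by rewrite ln_ge0// ler1n.
have ln_ : l <= n%:R by apply: le_trans (ln_leB1 N0) _; lra.
pose x (v : {set 'I_p}) : R := 5 / 2 * (#|v|%:R * l) + l / 10.
have card_le (v : {set 'I_p}) : (#|(v :|: tm)%SET| <= #|v| + t0)%N.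
  by apply: leq_trans (leq_card_setU _ _) _; rewrite leq_add2l.
have [B hB] := choice (fun v => proj_deviation s0 iidZ X (x v) (card_le v)).
have mB v : measurable (B v) by have [] := hB v.
have [mU hU] := @measure_bigsetU_le _ _ _ P _ B mB.
set b1 := [set w | (sqn (noise_vec Z w) < 49 / 50 * (n%:R * s ^+ 2))%R].
set b2 := [set w | (2 * (n%:R * s ^+ 2) < sqn (noise_vec Z w))%R].
have mb1 : measurable b1.
  rewrite -[X in measurable X]setTI.
  by apply: measurable_fun_ltr => //; exact: measurable_noise_sqn.
have mb2 : measurable b2.
  rewrite -[X in measurable X]setTI.
  by apply: measurable_fun_ltr => //; exact: measurable_noise_sqn.
exists (b1 `|` b2 `|` \big[setU/set0]_v B v); split.
- by apply: measurableU => //; exact: measurableU.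
- apply: le_trans (measureU2 _ _ mU) _; first exact: measurableU.
  (* As [l <= n], tails that are exponential in [n] are weakened to one common rate in [l]. *)
  set ee := expR (- (l / (200 * 100))).
  have -> : ((1 + 1 + C0) * ee)%:E = (ee%:E + ee%:E + (C0 * ee)%:E)%E.
    by rewrite -!EFinD !mulrDl !mul1r.
  have h1 : (P (b1 `|` b2) <= ee%:E + ee%:E)%E.
    apply: le_trans (measureU2 _ mb1 mb2) _; apply: leeD.
      apply: le_trans (energy_lower_tail s0 iidZ) _.
      by rewrite lee_fin ler_expR lerN2 ler_wpM2r// invr_ge0 mulr_ge0 ?ler0n.
    apply: le_trans (energy_upper_tail s0 iidZ) _.
    rewrite lee_fin ler_expR lerN2; lra.
  apply: leeD => //; apply: le_trans hU _.
  (* The power [n^(-9/8)] is [9/20 * 5/2]; its excess over 1 is the [1/8] that outweighs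
     [1 / ep^2]. *)
  pose z : R := expR (9 / 2 - 9 / 8 * l).
  apply: (@le_trans _ _ (\sum_(v : {set 'I_p}) (expR (9 / 2 * t0%:R - 9 / 200 * l) * z ^+ #|v|)%:E)%E).
    apply: lee_sum => v _; have [_ h _] := hB v; apply: le_trans h _.
    rewrite lee_fin /z -expRM_natl -expRD ler_expR /x natrD le_eqVlt; apply/orP; left.
    by apply/eqP; field.
  rewrite sumEFin lee_fin -mulr_sumr sum_expr_card.
  have zp : (1 + z) ^+ p <= expR (expR (9 / 2) * (dl ^+ 2 * 256)).
    apply: (@le_trans _ _ (expR (p%:R * z))).
      rewrite expRM_natl lerXn2r ?nnegrE ?expR_ge0 ?expR_ge1Dx//.
      by rewrite addr_ge0// expR_ge0.
    rewrite ler_expR.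
    (* From [p <= n / ep^2] and [1 / ep <= dl * l]: the number of columns exceeds [n] by at most a
       factor [(dl * l)^2]. *)
    have p1 : p%:R <= expR l * (dl * l) ^+ 2.
      rewrite /l lnK ?posrE//; apply: (@le_trans _ _ (n%:R * ep^-1 ^+ 2)).
        by rewrite exprVn ler_pdivlMr// exprn_gt0.
      rewrite ler_wpM2l ?(ltW N0)// lerXn2r ?nnegrE ?invr_ge0 ?(ltW ep0)//.
      by rewrite (le_trans _ epl)// invr_ge0 ltW.
    apply: le_trans (ler_wpM2r (expR_ge0 _) p1) _.
    have -> : expR l * (dl * l) ^+ 2 * z = expR (9 / 2) * (dl ^+ 2 * (l ^+ 2 * expR (- (l / 8)))).
      have -> : z = expR (- l) * (expR (9 / 2) * expR (- (l / 8))).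
        by rewrite /z -!expRD; congr expR; field.
      by rewrite [expR (- l)]expRN; field; rewrite gt_eqF// expR_gt0.
    by rewrite ler_wpM2l ?expR_ge0// ler_wpM2l ?sqr_ge0// sqr_expR_le.
  apply: le_trans (ler_wpM2l (expR_ge0 _) zp) _.
  rewrite /C0 /ee -!expRD ler_expR.
  have : 0 <= l / (200 * 100) by rewrite divr_ge0// mulr_ge0 ?ler0n.
  have : l / (200 * 100) <= 9 / 200 * l by lra.
  lra.
move=> w /not_orP[/not_orP[h1 h2] h3]; split.
  by apply/andP; split; rewrite leNgt; apply/negP.
move=> k; pose v := (k :\: tm)%SET.
have nB : ~ B v w.
  by move=> Bw; apply: h3; rewrite (bigD1 v)//=; left.
have [_ _ /(_ w nB)[q q1 hq]] := hB v; exists q => // u su; apply: hq.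
rewrite (_ : v :|: tm = k :|: tm)%SET//; apply/setP => i.
by rewrite !finset.inE; case: (i \in tm); rewrite ?orbT ?orbF.
Qed.

(** * Asymptotics *)

(** The rate hypotheses are turned into the eventual inequalities consumed by the exponent bound.
    Everything is expressed through [l = ln n], which ultimately exceeds a single threshold. *)
Lemma growth_facts (R : realType) (eps q : nat -> R) (xi dl x0 : R) (t0 : nat) :
  xi < 1 -> 0 < dl -> 0 < x0 -> (forall n, (0 < n)%N -> 0 < eps n) ->
  (fun n => ((eps n)^-1)%R) =O_\oo (fun n => (ln (n%:R : R) `^ (1 / 8))%R) ->
  q =O_\oo (fun n => (n%:R `^ xi)%R) ->
  \forall n \near \oo, let l := ln (n%:R : R) in
   [/\ (0 < n)%N, 1 <= dl * l, (eps n)^-1 <= dl * l,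
    (`|q n| + 1) * l <= dl * (n%:R * eps n) &
    `|q n| + t0%:R <= n%:R /\ (Num.sqrt n%:R)^-1 <= x0].
Proof.
move=> xi1 dl0 x00 eps0 /eqO_exP[C C0 hC] /eqO_exP[K K0 hK].
(* [xi] may be negative; the truncation keeps [n^xi'] at least 1, so that it also dominates the
   summand 1 in [|q n| + 1]. *)
pose xi' := Num.max xi 0; pose ka := 1 - xi'.
have ka0 : 0 < ka by rewrite /ka subr_gt0 /xi' gt_max xi1 ltr01.
(* The sum of the thresholds on [l] required below, all of them nonnegative. *)
pose L0 := 1 + dl^-1 + (C / dl) ^+ 2 + t0%:R + 6 * (K + 1) / ka ^+ 3 + x0 ^- 2.
have a1 : 0 <= dl^-1 by rewrite invr_ge0 ltW.
have a2 : 0 <= (C / dl) ^+ 2 by exact: sqr_ge0.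
have a3 : 0 <= (t0%:R : R) by [].
have a4 : 0 <= 6 * (K + 1) / ka ^+ 3.
  by rewrite divr_ge0 ?exprn_ge0 ?(ltW ka0)// mulr_ge0// addr_ge0// ltW.
have a5 : 0 <= x0 ^- 2 by rewrite invr_ge0 sqr_ge0.
near=> n; set l := ln _.
have n0 : (0 < n)%N by near: n; exact: nbhs_infty_gt.
have N0 : 0 < (n%:R : R) by rewrite ltr0n.
have lL : L0 <= l.
  rewrite -ler_expR /l lnK ?posrE//; near: n; exact: nbhs_infty_ger.
have l1 : 1 <= l by move: lL; rewrite /L0; lra.
have l0 : 0 < l by lra.
have nl : n%:R = expR l :> R by rewrite /l lnK ?posrE.
have ln_ : l <= n%:R by apply: le_trans (ln_leB1 N0) _; lra.
have h1 : 1 <= dl * l.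
  rewrite -ler_pdivrMl// mulr1; move: lL; rewrite /L0; lra.
have h2 : (eps n)^-1 <= dl * l.
  have : `|(eps n)^-1| <= C * `|ln n%:R `^ (1 / 8)| by near: n; exact: hC.
  rewrite -/l (ger0_norm (powR_ge0 _ _)) ger0_norm ?invr_ge0 ?(ltW (eps0 _ n0))//.
  move/le_trans; apply.
  have sl : C / dl <= Num.sqrt l.
    rewrite -(ler_sqr) ?nnegrE ?sqrtr_ge0 ?divr_ge0 ?(ltW C0) ?(ltW dl0)// sqr_sqrtr ?(ltW N0) ?(ltW l0)//.
    move: lL; rewrite /L0; lra.
  have e1 : l `^ (1 / 8) <= Num.sqrt l.
    rewrite -powR12_sqrt ?(ltW l0)//; apply: ler_powR => //; lra.
  have -> : dl * l = dl * Num.sqrt l * Num.sqrt l.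
    by rewrite -mulrA -expr2 sqr_sqrtr ?(ltW l0).
  apply: ler_pM; rewrite ?powR_ge0 ?(ltW C0)//.
  by rewrite mulrC -ler_pdivrMr.
have qn : `|q n| <= K * expR (xi' * l).
  have : `|q n| <= K * `|n%:R `^ xi| by near: n; exact: hK.
  move/le_trans; apply; rewrite ger0_norm ?powR_ge0// ler_wpM2l ?(ltW K0)//.
  rewrite /powR gt_eqF// ler_expR -/l ler_wpM2r ?(ltW l0)//.
  by rewrite /xi' le_max lexx.
have e1 : 1 <= expR (xi' * l).
  by rewrite -expR0 ler_expR mulr_ge0 ?(ltW l0)// /xi' le_max lexx orbT.
(* The cubic term of the exponential series beats [l^2] once [l] exceeds [6 (K + 1) / ka^3]. *)
have grow : (K + 1) * l ^+ 2 <= expR (ka * l).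
  have kl : 0 <= ka * l by rewrite mulr_ge0 ?ltW.
  have := expR_ge1Dxn 2 kl => h.
  have h' : (ka * l) ^+ 3 / 6 <= expR (ka * l).
    by move: h; rewrite (_ : 3`!%:R = 6 :> R)//; lra.
  apply: le_trans h'.
  have h6 : 6 * (K + 1) / ka ^+ 3 <= l by move: lL; rewrite /L0; lra.
  have : 6 * (K + 1) <= ka ^+ 3 * l by move: h6; rewrite ler_pdivrMr ?exprn_gt0// [l * _]mulrC.
  move/(ler_wpM2r (sqr_ge0 l)).
  have -> : ka ^+ 3 * l * l ^+ 2 = (ka * l) ^+ 3 by ring.
  lra.
have qgrow : (`|q n| + 1) * l ^+ 2 <= n%:R.
  have h : (`|q n| + 1) * l ^+ 2 <= expR (xi' * l) * ((K + 1) * l ^+ 2).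
    rewrite [leRHS]mulrA; apply: ler_wpM2r; [exact: sqr_ge0|lra].
  apply: le_trans h _.
  have -> : n%:R = expR (xi' * l) * expR (ka * l).
    by rewrite -expRD nl; congr expR; rewrite /ka; ring.
  by rewrite ler_wpM2l ?expR_ge0.
split => //.
- have en := eps0 _ n0.
  have h3 : 1 <= dl * l * eps n by rewrite -ler_pdivrMr// div1r.
  have h4 : n%:R / l <= dl * (n%:R * eps n).
    rewrite ler_pdivrMr//.
    have -> : dl * (n%:R * eps n) * l = n%:R * (dl * l * eps n) by ring.
    by rewrite ler_peMr// ltW.
  apply: le_trans h4; rewrite ler_pdivlMr//.
  by apply: le_trans qgrow; rewrite -mulrA -expr2.
- split.
    apply: le_trans qgrow; rewrite mulrDl mul1r.
    have l2 : l <= l ^+ 2 by rewrite expr2 ler_peMr// ltW.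
    have : `|q n| <= `|q n| * l ^+ 2 by rewrite ler_peMr//; lra.
    have : t0%:R <= l by move: lL; rewrite /L0; lra.
    lra.
  have sq : 0 < Num.sqrt (n%:R : R) by rewrite sqrtr_gt0.
  rewrite -[leRHS]invrK lef_pV2 ?posrE ?invr_gt0//.
  rewrite -ler_sqr ?nnegrE ?invr_ge0 ?(ltW x00) ?(ltW sq)// sqr_sqrtr ?(ltW N0) ?(ltW l0)//.
  rewrite exprVn; apply: le_trans ln_; move: lL; rewrite /L0; lra.
Unshelve. all: by end_near.
Qed.

(** The deterministic core: on a good noise vector the ratio bound is used with [D = 0] for a proper
    superset of the true model, and with [D = rho^2] for a model that misses a true coordinate. *)
Lemma marginal_ratio_good (R : realType) (a1 a2 alpha1 alpha2 M rho s : R) (r t0 : nat) :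
  0 < a1 -> 0 < a2 -> (0 < r)%N -> 0 < alpha1 -> 0 < alpha2 -> 0 <= M ->
  0 < rho -> 0 < s ->
  exists C dl : R, [/\ 0 <= C, 0 < dl &
  forall n p (X : 'M[R]_(n, p)) (A : 'M[R]_p) (B : 'cV[R]_p) (e : 'cV[R]_n)
    (ep Qn : R) (k : {set 'I_p}),
  let tm := [set i | B i 0 != 0%R]%SET in
  let y := X *m B + e in
  let l := ln n%:R in
  (0 < n)%N -> (Num.sqrt n%:R)^-1 <= Num.min 1 (rho / 2) ->
  0 < ep < 1 -> 1 <= dl * l -> ep^-1 <= dl * l ->
  (Qn + 1) * l <= dl * (n%:R * ep) -> Qn + t0%:R <= n%:R ->
  (forall v : 'cV[R]_p, a1 * sqn v <= dotc v (A *m v) <= a2 * sqn v) ->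
  (forall k : {set 'I_p}, k != finset.set0 ->
     ep <= lambda_min X k /\ lambda_max X k <= ep^-1) ->
  (forall i, `|B i 0| <= M) -> (forall i, B i 0 != 0 -> rho <= `|B i 0|) ->
  (#|tm| <= t0)%N ->
  49 / 50 * (n%:R * s) <= sqn e <= 2 * (n%:R * s) ->
  (exists2 q : R, 0 <= q <= s * (5 / 2 * (#|(k :\: tm)%SET|%:R * l) + l / 10) &
    forall v, supported (k :|: tm)%SET v -> dotc e (X *m v) ^+ 2 <= q * sqn (X *m v)) ->
  #|k|%:R <= Qn ->
  0 < marginal r alpha1 alpha2 X A y tm /\
  (k != tm -> marginal r alpha1 alpha2 X A y k <=
    C * expR (- (l / 10)) * marginal r alpha1 alpha2 X A y tm)].
Proof.
move=> a10 a20 r0 al1 al2 M0 rh0 s0.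
have [C [c [C0 c0 main]]] := marginal_ratio_ex t0 a10 a20 r0 al1 al2 M0 rh0 s0.
have [dl dl0 expo] := exponent_bound t0 c0 s0 rh0 r0.
exists C, dl; split => // n p X A B e ep Qn k tm y l n0 boxs ep01 l1 epl Ql Qt hA hE BM Brho tmt0
  /andP[E1 E2] [q q01 hq] kQ.
have N0 : 0 < (n%:R : R) by rewrite ltr0n.
have /andP[ep0 ep1] := ep01; have /andP[q0 _] := q01.
have mk : (#|(k :\: tm)%SET| <= #|k|)%N by apply: subset_leq_card; exact: finset.subsetDl.
have ktn : (#|k| + t0 <= n)%N by rewrite -(ler_nat R) natrD; apply: le_trans Qt; rewrite lerD2r.
have l0 : 0 <= l by rewrite -(pmulr_rge0 _ dl0) (le_trans _ l1).
have ml : (#|(k :\: tm)%SET|%:R + 1) * l <= dl * (n%:R * ep).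
  apply: le_trans Ql; rewrite ler_wpM2r// lerD2r; apply: le_trans kQ.
  by rewrite ler_nat.
have mn : (#|(k :\: tm)%SET| <= n)%N.
  by apply: leq_trans mk _; apply: leq_trans ktn; exact: leq_addr.
have TK : (#|(k :&: tm)%SET| <= #|tm| <= t0)%N.
  by rewrite tmt0 andbT; apply: subset_leq_card; exact: finset.subsetIr.
have [S0 thn over miss] := expo n _ _ _ ep (sqn e) q l1 epl ml ep01 mn TK (introT andP (conj E1 E2)) q01.
have hX (v : 'cV[R]_p) : sqn (X *m v) <= n%:R / ep * sqn v.
  (* The eigenvalue bounds concern nonempty models, so the case without any column is settled by
     [v = 0]. *)
  have [k0|k0] := eqVneq ([set: 'I_p])%SET finset.set0.
    have -> : v = 0.
      by apply/colP => i; have := finset.in_setT i; rewrite k0 finset.in_set0.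
    by rewrite mulmx0 !sqn0 mulr0.
  have [_ h] := hE _ k0; apply: (design_sqn_le n0 _ h); first by rewrite invr_ge0 ltW.
  by move=> i; rewrite finset.in_setT.
have hv (v : 'cV[R]_p) : supported (k :|: tm)%SET v ->
     dotc e (X *m v) ^+ 2 <= q * sqn (X *m v) /\ n%:R * ep * sqn v <= sqn (X *m v).
  move=> sv; split; first exact: hq.
  have [u0|u0] := eqVneq (k :|: tm)%SET finset.set0.
    have -> : v = 0.
      by apply/colP => i; rewrite sv ?mxE// u0 finset.in_set0.
    by rewrite mulmx0 !sqn0 mulr0.
  have [h _] := hE _ u0; apply: (design_sqn_ge n0 _ ep0 h sv).
  apply: leq_trans (leq_card_setU _ _) _; apply: leq_trans ktn; by rewrite leq_add2l.
have th01 : 0 < (50^-1 : R) < 1.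
  by apply/andP; split; [rewrite invr_gt0 ltr0n|rewrite invf_lt1 ?ltr0n// ltr1n].
have Ebd : s / 2 <= sqn e / n%:R <= 2 * s.
  rewrite ler_pdivlMr// ler_pdivrMr//; apply/andP; split; last lra.
  apply: le_trans E1; have : 0 <= n%:R * s by rewrite mulr_ge0// ltW.
  lra.
have use D (hD : 0 <= D <= \sum_(i | i \notin k) B i 0 ^+ 2) := main n p X A B e ep 50^-1 q D k n0 boxs ep01 th01 thn q0 hA hX hv BM Brho tmt0 Ebd S0 hD.
have B2 : 0 <= \sum_(i | i \notin k) B i 0 ^+ 2 by apply: sumr_ge0 => i _; exact: sqr_ge0.
have mt0 : 0 < marginal r alpha1 alpha2 X A y tm.
  by have [] := use 0 _; rewrite ?lexx.
split => // ktm.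
have fin D : 0 <= D <= \sum_(i | i \notin k) B i 0 ^+ 2 ->
  ratio_exponent s r c ep 50^-1 (sqn e) (sqn e - q / (1 - 50^-1) + 50^-1 * (n%:R * ep) * D) n
     #|tm| #|(k :&: tm)%SET| #|(k :\: tm)%SET| <= - (l / 10) ->
  marginal r alpha1 alpha2 X A y k <= C * expR (- (l / 10)) * marginal r alpha1 alpha2 X A y tm.
  move=> hD hx; have [_ h] := use D hD; apply: le_trans h _.
  by rewrite ler_wpM2r ?(ltW mt0)// ler_wpM2l// ler_expR.
have [tk|/fintype.subsetPn[i it ik]] := boolP (tm \subset k).
  apply: (fin 0); first by rewrite lexx.
  apply: over; first by rewrite (finset.setIidPr tk).
  rewrite lt0n cards_eq0; apply: contra ktm.
  by rewrite finset.setD_eq0 => kt; rewrite finset.eqEsubset kt tk.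
apply: (fin (rho ^+ 2)) => //; rewrite sqr_ge0/= (bigD1 i)//=.
have : rho ^+ 2 <= B i 0 ^+ 2.
  rewrite -[leRHS]real_normK ?num_real// lerXn2r ?nnegrE ?normr_ge0 ?(ltW rh0)//.
  by apply: Brho; move: it; rewrite finset.inE.
move/le_trans; apply; rewrite lerDl; apply: sumr_ge0 => j _; exact: sqr_ge0.
Qed.

Lemma expR_ln_cvg0 (R : realType) (C ka : R) : 0 < ka ->
  (C * expR (- (ln n%:R / ka)) : R) @[n --> \oo] --> 0.
Proof.
move=> ka0; apply/cvgr0Pnorm_le => e e0.
near=> n.
have n0 : 0 < (n%:R : R) by rewrite ltr0n; near: n; exact: nbhs_infty_gt.
have h : ka * (`|C| / e) <= ln n%:R.
  by rewrite -ler_expR lnK ?posrE//; near: n; exact: nbhs_infty_ger.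
rewrite normrM [ `|expR _|]ger0_norm ?expR_ge0// expRN ler_pdivrMr ?expR_gt0//.
rewrite -ler_pdivrMl// mulrC; apply: (@le_trans _ _ (ln n%:R / ka)).
  by rewrite ler_pdivlMr// [leLHS]mulrC.
by apply: le_trans (expR_ge1Dx _); rewrite lerDr.
Unshelve. all: by end_near.
Qed.

Lemma cvg_in_probability_bad (R : realType) (d : nat -> measure_display)
    (T : forall n, measurableType (d n)) (P : forall n, probability (T n) R)
    (A : forall n, set (T n)) (v : nat -> R) :
  (forall n, (0 < n)%N -> measurable (A n)) ->
  (\forall n \near \oo, exists2 B : set (T n), measurable B /\ (P n B <= (v n)%:E)%E & A n `<=` B) ->
  v n @[n --> \oo] --> 0 -> P n (A n) @[n --> \oo] --> 0%E.
Proof.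
move=> mA hB v0; apply: (@squeeze_cvge _ _ _ _ (cst 0%E) _ (EFin \o v)).
- near=> n.
  have n0 : (0 < n)%N by near: n; exact: nbhs_infty_gt.
  have [B [mB PB] AB] : exists2 B : set (T n), measurable B /\ (P n B <= (v n)%:E)%E & A n `<=` B.
    by near: n.
  rewrite measure_ge0/=; apply: le_trans PB.
  by apply: le_measure; rewrite ?inE//; exact: mA.
- exact: cvg_cst.
- by apply: cvg_EFin => //; exact: nearW.
Unshelve. all: by end_near.
Qed.

(** The normalising sum cancels in the comparison. Where the prior vanishes the weight is 0;
    elsewhere the prior ratio costs [1 / om]. Some model has positive prior, hence so does [t], and
    the sum is positive. *)
Lemma weight_ratio (R : realType) (I : finType) (pr m : I -> R) (t : I) (om b : R) :
  0 < om -> 0 <= b -> (forall k, 0 <= pr k) -> \sum_k pr k = 1 ->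
  (forall k, 0 < pr k -> om < pr t / pr k) -> (forall k, 0 <= m k) ->
  (forall k, 0 < pr k -> 0 < m t /\ (k != t -> m k <= b * m t)) ->
  let W k := pr k * m k / \sum_j pr j * m j in
  forall k, k != t -> [/\ 0 < W t, 0 <= W k & W k <= b / om * W t].
Proof.
move=> om0 b0 pr0 pr1 hom m0 hm W k kt.
have [k0 pk0] : exists k0, 0 < pr k0.
  apply: contrapT => /forallNP h; move: pr1; rewrite big1 => [/eqP|i _]; first by rewrite eq_sym oner_eq0.
  by apply/eqP; rewrite eq_le pr0 andbT leNgt; apply/negP/h.
have pt0 : 0 < pr t.
  have := lt_trans om0 (hom _ pk0); by rewrite pmulr_lgt0// invr_gt0.
have [mt0 _] := hm _ pk0.
have S0 : 0 < \sum_j pr j * m j.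
  rewrite (bigD1 t)//=; apply: ltr_wpDr; last by rewrite mulr_gt0.
  by apply: sumr_ge0 => j _; rewrite mulr_ge0.
split.
- by rewrite /W !mulr_gt0// invr_gt0.
- by rewrite /W !mulr_ge0// invr_ge0 ltW.
rewrite /W mulrA ler_wpM2r ?invr_ge0 ?(ltW S0)//.
have := pr0 k; rewrite le_eqVlt => /predU1P[<-|pk].
  rewrite mul0r; apply: mulr_ge0; first by rewrite divr_ge0// ltW.
  by rewrite mulr_ge0// ltW.
have [_ /(_ kt) mk] := hm _ pk.
have -> : b / om * (pr t * m t) = (pr t / om) * (b * m t) by ring.
apply: ler_pM => //.
by rewrite ler_pdivlMr// mulrC -ler_pdivlMr// ltW// hom.
Qed.

Lemma seq_pos_lower_bound (R : realType) (I : eqType) (f : I -> R) (s : seq I) :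
  (forall i, i \in s -> 0 < f i) -> exists2 rho, 0 < rho & forall i, i \in s -> rho <= f i.
Proof.
elim: s => [|x s IH] h; first by exists 1.
have [|rho rho0 hr] := IH; first by move=> i si; apply: h; rewrite inE si orbT.
exists (Num.min rho (f x)); first by rewrite lt_min rho0 h// inE eqxx.
by move=> i; rewrite inE => /predU1P[->|/hr]; rewrite ge_min ?lexx ?orbT// => ->.
Qed.

Lemma seq_upper_bound (R : realType) (I : eqType) (f : I -> R) (s : seq I) :
  (forall i, 0 <= f i) -> exists2 M, 0 <= M & forall i, i \in s -> f i <= M.
Proof.
move=> f0; exists (\sum_(i <- s) f i); first exact: sumr_ge0.
move=> i si; rewrite (big_rem i)//= lerDl; exact: sumr_ge0.
Qed.

Lemma card_model_of_support p (t : {fset nat}) : (#|model_of_support p t| <= #|` t|)%N.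
Proof.
rewrite cardE -(size_map val); apply: uniq_leq_size.
  by rewrite map_inj_uniq ?enum_uniq//; exact: val_inj.
move=> _ /mapP[i + ->]; by rewrite mem_enum finset.inE.
Qed.

(** * Measurability of the events in the conclusion *)

Section PosteriorMeasurability.
Context (R : realType) (n p : nat) (X : 'M[R]_(n, p)) (A : 'M[R]_p).
Context (a1 a2 alpha1 alpha2 : R) (r : nat).
Hypotheses (a1_gt0 : 0 < a1) (a2_gt0 : 0 < a2) (r_gt0 : (0 < r)%N) (alpha1_gt0 : 0 < alpha1).
Hypothesis hA : forall v : 'cV[R]_p, a1 * sqn v <= dotc v (A *m v) <= a2 * sqn v.
Context (d : measure_display) (T : measurableType d) (P : probability T R).
Context (Z : 'I_n -> {RV P >-> R}) (beta0 : nat -> R) (prior : {set 'I_p} -> R).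

Let post k w := posterior r alpha1 alpha2 X A prior (response X beta0 Z w) k.

Lemma measurable_posterior k : measurable_fun setT (post k).
Proof.
have my i : measurable_fun setT (fun w => response X beta0 Z w i 0).
  rewrite (_ : (fun _ => _) = fun w => (X *m coef_vector p beta0) i 0 + Z i w); last first.
    by apply/funext => w; rewrite !mxE.
  by apply: measurable_funD => //; exact: measurable_cst.
have mm j : measurable_fun setT
    (fun w => prior j * marginal r alpha1 alpha2 X A (response X beta0 Z w) j).
  apply: measurable_funM; first exact: measurable_cst.
  apply: measurable_marginal => // tau s2 b.
  exact: (pmom_pdf_ge0 _ _ _ a1_gt0 a2_gt0 r_gt0 hA).
apply: measurable_funM; first exact: mm.
by apply: measurableT_comp; [exact: measurable_inv|exact: measurable_fun_sumr].
Qed.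

Lemma measurable_max_ratio (t : {set 'I_p}) :
  measurable_fun setT (fun w => \big[Num.max/0]_(k | k != t) (post k w / post t w)).
Proof.
have mq k : measurable_fun setT (fun w => post k w / post t w).
  apply: measurable_funM; first exact: measurable_posterior.
  by apply: measurableT_comp; [exact: measurable_inv|exact: measurable_posterior].
elim: (index_enum _) => [|k ks IH].
  rewrite (_ : (fun _ => _) = cst 0); first exact: measurable_cst.
  by apply/funext => w; rewrite big_nil.
case: (boolP (k != t)) => kt.
  rewrite (_ : (fun _ => _) = (fun w => post k w / post t w) \max
      (fun w => \big[Num.max/0]_(k <- ks | k != t) (post k w / post t w))).
    exact: measurable_maxr.
  by apply/funext => w; rewrite big_cons kt.
rewrite (_ : (fun _ => _) = (fun w => \big[Num.max/0]_(k <- ks | k != t) (post k w / post t w)))//.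
by apply/funext => w; rewrite big_cons (negbTE kt).
Qed.

Lemma measurable_posterior_mode (t : {set 'I_p}) :
  measurable [set w | forall k, k != t -> post k w < post t w].
Proof.
rewrite (_ : mkset _ = \bigcap_(k in [set k | k != t]) [set w | post k w < post t w])//.
apply: fin_bigcap_measurable; first exact: (@finite_finset _ _).
move=> k _; rewrite -[X in measurable X]setTI.
by apply: measurable_fun_ltr => //; exact: measurable_posterior.
Qed.

End PosteriorMeasurability.

Theorem theorem3p1 (R : realType)
  (p : nat -> nat) (p_incr : {homo p : m n / (m <= n)%N})
  (X : forall n, 'M[R]_(n, p n))
  (A : forall n, 'M[R]_(p n)) (A_sym : forall n, (0 < n)%N -> (A n)^T = A n)
  (t : {fset nat}) (beta0 : nat -> R)
  (t_support : forall i, (i \in t) = (beta0 i != 0))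
  (t_range : forall n, (0 < n)%N -> forall i, i \in t -> (i < p n)%N)
  (sigma0 : R) (sigma0_gt0 : 0 < sigma0)
  (d : nat -> measure_display) (T : forall n, measurableType (d n))
  (P : forall n, probability (T n) R)
  (noise : forall n, 'I_n -> {RV (P n) >-> R})
  (noise_iid : forall n, iid_normal (noise n) sigma0)
  (r : nat) (r_gt0 : (0 < r)%N)
  (alpha1 alpha2 : R) (alpha1_gt0 : 0 < alpha1) (alpha2_gt0 : 0 < alpha2)
  (prior : forall n, {set 'I_(p n)} -> R)
  (prior_distr : forall n, (0 < n)%N -> is_model_prior (@prior n))
  (eps : nat -> R)
  (eps_bounds : forall n, (0 < n)%N -> 0 < eps n < 1)
  (eigen_bounds : forall n, (0 < n)%N -> forall k : {set 'I_(p n)},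
     k != finset.set0 ->
     eps n <= lambda_min (X n) k /\
     lambda_min (X n) k <= lambda_max (X n) k /\
     lambda_max (X n) k <= (eps n)^-1)
  (eps_rate : (fun n => ((eps n)^-1)%R) =O_\oo
              (fun n => (ln (n%:R : R) `^ (1 / 8))%R))
  (q : nat -> R) (xi : R) (xi_lt1 : xi < 1)
  (q_rate : q =O_\oo (fun n => (n%:R `^ xi)%R))
  (prior_size : forall n, (0 < n)%N -> forall k : {set 'I_(p n)},
     q n < #|k|%:R -> prior n k = 0)
  (omega : R) (omega_gt0 : 0 < omega)
  (prior_ratio : forall n, (0 < n)%N -> forall k : {set 'I_(p n)},
     0 < prior n k ->
     omega < prior n (model_of_support (p n) t) / prior n k)
  (a1 a2 : R) (a1_gt0 : 0 < a1) (a1_lt_a2 : a1 < a2)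
  (A_eigen : forall n, (0 < n)%N -> forall a : R,
     eigenvalue (A n) a -> a1 < a < a2) :
  let tn n := model_of_support (p n) t in
  let post n (k : {set 'I_(p n)}) (w : T n) : R :=
    posterior r alpha1 alpha2 (X n) (A n) (@prior n)
      (response (X n) beta0 (noise n) w) k in
  cvg_in_probability P
    (fun n w => \big[Num.max/0]_(k : {set 'I_(p n)} | k != tn n)
                  (post n k w / post n (tn n) w)) 0
  /\
  (P n [set w | forall k : {set 'I_(p n)}, k != tn n ->
                  post n k w < post n (tn n) w] @[n --> \oo] --> 1%E).
Proof.
move=> tn post.
have a2_gt0 : 0 < a2 by exact: lt_trans a1_lt_a2.
(* The support is finite and does not vary with [n], which yields a positive lower bound on the
   nonzero coefficients. *)
have [rho rho0 hrho] : exists2 rho, 0 < rho & forall i, i \in enum_fset t -> rho <= `|beta0 i|.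
  by apply: seq_pos_lower_bound => i it; rewrite normr_gt0 -t_support.
have [M M0 hM] : exists2 M, 0 <= M & forall i, i \in enum_fset t -> `|beta0 i| <= M.
  exact: seq_upper_bound.
have {}hM i : `|beta0 i| <= M.
  have [/hM//|] := boolP (i \in t).
  by rewrite t_support negbK => /eqP ->; rewrite normr0.
have s0 : 0 < sigma0 ^+ 2 by rewrite exprn_gt0.
have [C [dl [C0 dl0 main]]] := marginal_ratio_good #|` t| a1_gt0 a2_gt0 r_gt0
  alpha1_gt0 alpha2_gt0 M0 rho0 s0.
have [C' C'0 dev] := noise_deviation dl #|` t| sigma0_gt0.
have x00 : 0 < Num.min 1 (rho / 2) by rewrite lt_min ltr01 divr_gt0.
have eps0 n : (0 < n)%N -> 0 < eps n by move=> /eps_bounds /andP[].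
have growth := growth_facts #|` t| xi_lt1 dl0 x00 eps0 eps_rate q_rate.
have hA n : (0 < n)%N -> forall v : 'cV[R]_(p n), a1 * sqn v <= dotc v (A n *m v) <= a2 * sqn v.
  move=> n0 v; rewrite qform_ge ?qform_le//; first exact: A_sym.
  - by move=> a /(A_eigen n n0)/andP[_ /ltW].
  - exact: A_sym.
  - by move=> a /(A_eigen n n0)/andP[/ltW].
(* [v] bounds the probability of the exceptional event, [rr] bounds every posterior ratio outside
   it; both are negative powers of [n]. *)
pose v n : R := C' * expR (- (ln n%:R / (200 * 100))).
pose rr n : R := C / omega * expR (- (ln n%:R / 10)).
have v0 : v n @[n --> \oo] --> 0.
  by apply: expR_ln_cvg0; apply: mulr_gt0; rewrite ltr0n.
have rr0 : rr n @[n --> \oo] --> 0 by apply: expR_ln_cvg0; rewrite ltr0n.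
have tE n : [set i | coef_vector (p n) beta0 i 0 != 0]%SET = tn n.
  by apply/setP => i; rewrite !finset.inE mxE -t_support.
have good : \forall n \near \oo, exists2 B : set (T n),
    measurable B /\ (P n B <= (v n)%:E)%E &
    forall w, ~ B w -> forall k, k != tn n ->
      [/\ 0 < post n (tn n) w, 0 <= post n k w & post n k w <= rr n * post n (tn n) w].
  near=> n.
  have [n0 l1 epl Ql [Qt boxs]] : let l := ln (n%:R : R) in
   [/\ (0 < n)%N, 1 <= dl * l, (eps n)^-1 <= dl * l,
    (`|q n| + 1) * l <= dl * (n%:R * eps n) &
    `|q n| + #|` t|%:R <= n%:R /\ (Num.sqrt n%:R)^-1 <= Num.min 1 (rho / 2)].
    by near: n; exact: growth.
  have ep01 := eps_bounds n n0; have ep0 := eps0 n n0.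
  have eb (k : {set 'I_(p n)}) : k != finset.set0 ->
      eps n <= lambda_min (X n) k /\ lambda_max (X n) k <= (eps n)^-1.
    by move=> /(eigen_bounds n n0)[h1 [_ h2]].
  have pn := design_columns_bound n0 ep01 eb.
  have tmt : (#|tn n| <= #|` t|)%N by exact: card_model_of_support.
  have [B [mB PB hB]] := dev _ _ (P n) n (noise n) (noise_iid n) _ (X n) (tn n) (eps n)
    n0 tmt ep0 pn epl.
  exists B; first by split.
  move=> w /hB[E12 hq] k ktn; have [pr0 pr1] := prior_distr n n0.
  have mge (j : {set 'I_(p n)}) :
      0 <= marginal r alpha1 alpha2 (X n) (A n) (response (X n) beta0 (noise n) w) j.
    exact: (marginal_ge0 _ a1_gt0 a2_gt0 r_gt0 alpha1_gt0 _ _ _ n0 (hA n n0)).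
  have b0 : 0 <= C * expR (- (ln n%:R / 10)) by rewrite mulr_ge0// expR_ge0.
  have mr (j : {set 'I_(p n)}) : 0 < prior n j ->
      0 < marginal r alpha1 alpha2 (X n) (A n) (response (X n) beta0 (noise n) w) (tn n) /\
      (j != tn n -> marginal r alpha1 alpha2 (X n) (A n) (response (X n) beta0 (noise n) w) j
        <= C * expR (- (ln n%:R / 10)) *
          marginal r alpha1 alpha2 (X n) (A n) (response (X n) beta0 (noise n) w) (tn n)).
    move=> pj; rewrite -tE.
    apply: (main n (p n) (X n) (A n) (coef_vector (p n) beta0) (noise_vec (noise n) w) (eps n) `|q n|) => //.
    - exact: hA.
    - by move=> i; rewrite mxE.
    - by move=> i; rewrite mxE => bi; apply: hrho; rewrite -[_ \in _]/(_ \in t) t_support.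
    - by rewrite tE.
    - by rewrite tE; exact: hq.
    (* A model of positive prior weight has size at most [q n], by contraposition of the assumption
       on large models. *)
    - apply: le_trans (ler_norm _); rewrite leNgt; apply/negP => /(prior_size n n0) pj0.
      by rewrite pj0 ltxx in pj.
  rewrite (_ : rr n = C * expR (- (ln n%:R / 10)) / omega); last by rewrite /rr mulrAC.
  exact: (weight_ratio omega_gt0 b0 pr0 pr1 (prior_ratio n n0) mge mr ktn).
have mmax n : (0 < n)%N -> measurable_fun setT
    (fun w => \big[Num.max/0]_(k | k != tn n) (post n k w / post n (tn n) w)).
  move=> n0; exact: (@measurable_max_ratio R n (p n) (X n) (A n) a1 a2 alpha1 alpha2 r a1_gt0 a2_gt0
    r_gt0 alpha1_gt0 (hA n n0) _ _ (P n) (noise n) beta0 (prior n) (tn n)).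
have mmode n : (0 < n)%N -> measurable [set w | forall k, k != tn n -> post n k w < post n (tn n) w].
  move=> n0; exact: (@measurable_posterior_mode R n (p n) (X n) (A n) a1 a2 alpha1 alpha2 r a1_gt0 a2_gt0
    r_gt0 alpha1_gt0 (hA n n0) _ _ (P n) (noise n) beta0 (prior n) (tn n)).
clearbody post rr v.
split.
  move=> e e0; apply: (cvg_in_probability_bad _ _ v0).
    move=> n n0; rewrite -[X in measurable X]setTI.
    rewrite (_ : mkset _ = [set w | e < \big[Num.max/0]_(k | k != tn n) (post n k w / post n (tn n) w)]).
      by apply: measurable_fun_ltr => //; exact: mmax.
    by apply/funext => w /=; rewrite subr0 ger0_norm// bigmax_ge_id.
  near=> n.
  have [B mPB hB] : exists2 B : set (T n), measurable B /\ (P n B <= (v n)%:E)%E &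
    forall w, ~ B w -> forall k, k != tn n ->
      [/\ 0 < post n (tn n) w, 0 <= post n k w & post n k w <= rr n * post n (tn n) w].
    by near: n.
  exists B => // w /=; apply: contraPP => nB; apply/negP; rewrite -leNgt.
  rewrite subr0 ger0_norm ?bigmax_ge_id//; apply/bigmax_leP; split; first exact: (ltW e0).
  move=> k /(hB w nB k)[p1 p2 p3]; rewrite (ler_pdivrMr _ _ p1); apply: le_trans p3 _.
  apply: (ler_wpM2r (ltW p1)); apply: le_trans (ler_norm _) _; near: n.
  by move/cvgr0Pnorm_le : rr0; exact.
(* The probability that [t] is the strict mode lies between [1 - v n] and 1: outside the exceptional
   event all ratios are at most [rr n], which is eventually below 1. *)
apply: (@squeeze_cvge _ _ _ _ (fun n => (1 - v n)%:E) _ (cst 1%E)); last exact: cvg_cst.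
  near=> n.
  have n0 : (0 < n)%N by near: n; exact: nbhs_infty_gt.
  have [B [mB PB] hB] : exists2 B : set (T n), measurable B /\ (P n B <= (v n)%:E)%E &
    forall w, ~ B w -> forall k, k != tn n ->
      [/\ 0 < post n (tn n) w, 0 <= post n k w & post n k w <= rr n * post n (tn n) w].
    by near: n.
  have mS := mmode n n0.
  rewrite probability_le1 ?andbT//; apply: (@le_trans _ _ (P n (~` B))).
    by rewrite probability_setC// EFinB leeB.
  apply: le_measure; rewrite ?inE//; first exact: measurableC.
  move=> w nB k /(hB w nB k)[p1 p2 p3]; apply: le_lt_trans p3 _.
  rewrite (gtr_pMl _ p1); apply: le_lt_trans (ler_norm _) _; near: n.
  by move/cvgr0Pnorm_lt : rr0; apply.
apply: cvg_EFin; first exact: nearW.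
rewrite -[X in _ --> X]subr0; apply: cvgB => //; exact: cvg_cst.
Unshelve. all: by end_near.
Qed.
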